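(* a) Let $G_t$ be the fundamental solution of the heat equation with $d\ge1$, or the fundamental solution of the wave equation with $d\le2$. Then for any $(t,x)\in\mathbb R_+\times\mathbb R^d$, the map $(s,y)\mapsto\big(G_{t-s}(x-\cdot)*\kappa\big)(y)$ is measurable on $[0,t)\times\mathbb R^d$. b) Let $G_t$ be the fundamental solution of the wave equation with $d\ge3$, and suppose that Dalang's condition $\int_{\mathbb R^d}\frac{1}{1+|\xi|^2}\mu(d\xi)<\infty$ holds. Then for any $(t,x)\in\mathbb R_+\times\mathbb R^d$ there exists a measurable function $g:[0,t)\times\mathbb R^d\to\mathbb R$, depending on $(t,x)$, such that $g(s,\cdot)=G_{t-s}(x-\cdot)*\kappa$ in $L^2(\mathbb R^d)$, for almost all $s\in[0,t)$.
   Context: $\mathcal F\varphi(\xi)=\int e^{-i\xi\cdot x}\varphi(x)dx$, extended to tempered distributions. A measurable function $g$ is tempered if $\int(1+|x|^2)^{-\ell}|g(x)|dx<\infty$ for some $\ell>0$. $\kappa:\mathbb R^d\to[0,\infty]$ is a tempered function such that (a) its Fourier transform $h=\mathcal F\kappa$ is a tempered function; (b) $|h|^2$ is a tempered function; (c) there is a tempered function $f:\mathbb R^d\to[0,\infty]$ with $|h|^2=\mathcal Ff$ in $\mathcal S'(\mathbb R^d)$. Let $\mu(d\xi)=(2\pi)^{-d}|\mathcal F\kappa(\xi)|^2d\xi$. Fundamental solutions ($t>0$). Heat ($\frac{\partial}{\partial t}-\frac12\Delta$): $G_t(x)=(2\pi t)^{-d/2}e^{-|x|^2/(2t)}$. Wave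 ($\frac{\partial^2}{\partial t^2}-\Delta$): $G_t$ is the compactly supported distribution on $\mathbb R^d$ with $\mathcal FG_t(\xi)=\sin(t|\xi|)/|\xi|$; it is the function $G_t(x)=\frac12 1_{\{|x|<t\}}$ if $d=1$ and $G_t(x)=\frac1{2\pi}(t^2-|x|^2)^{-1/2}1_{\{|x|<t\}}$ if $d=2$. The distribution $G_t(x-\cdot)$ is given by $(G_t(x-\cdot),\varphi)=(G_t,\varphi(x-\cdot))$. When $G_t$ is a function, $(G_{t-s}(x-\cdot)*\kappa)(y)=\int_{\mathbb R^d}G_{t-s}(x-z)\kappa(y-z)dz\in[0,\infty]$; in general $G_{t-s}(x-\cdot)*\kappa$ is the convolution of a compactly supported distribution with the tempered distribution $\kappa$. *)

(* Defs.v *)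
From HB Require Import structures.
From mathcomp Require Import all_boot all_order all_algebra.
From mathcomp Require Import all_classical all_reals all_analysis.
From mathcomp Require Import measurable_realfun.
From mathcomp Require Export complex.

Set Implicit Arguments.
Unset Strict Implicit.
Unset Printing Implicit Defensive.

Import Order.TTheory GRing.Theory Num.Theory.
Import numFieldNormedType.Exports.

Local Open Scope classical_set_scope.
Local Open Scope ring_scope.
Local Open Scope complex_scope.

Export Normc.

(* Borel sets and Lebesgue measure on R^d = 'rV[R]_d. The sigma-algebra is
   generated by the coordinates, i.e. it is the d-fold product of the Borel
   sigma-algebra of R, which is the Borel sigma-algebra of R^d. *)

Definition rV_display : measure_display -> measure_display.
Proof. exact. Qed.

Section rV_measurable.
Context {R : realType}.
Variable n : nat.

Let coord (i : 'I_n) (x : 'rV[R]_n) : R := x ord0 i.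

Let rV_set0 : g_sigma_preimage coord set0.
Proof. exact: sigma_algebra0. Qed.

Let rV_setC A : g_sigma_preimage coord A -> g_sigma_preimage coord (~` A).
Proof. exact: sigma_algebraC. Qed.

Let rV_bigcup (F : _^nat) : (forall i, g_sigma_preimage coord (F i)) ->
  g_sigma_preimage coord (\bigcup_i (F i)).
Proof. exact: sigma_algebra_bigcup. Qed.

HB.instance Definition _ :=
  @isMeasurable.Build (rV_display default_measure_display)
    'rV[R]_n (g_sigma_preimage coord) rV_set0 rV_setC rV_bigcup.

End rV_measurable.

Section rV_measurability.
Context {R : realType}.

Lemma measurable_coord n (i : 'I_n) :
  measurable_fun [set: 'rV[R]_n] (fun x : 'rV[R]_n => x ord0 i).
Proof.
move=> _ Y mY; rewrite setTI; apply: sub_sigma_algebra => /=.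
rewrite -bigcup_seq/=; exists i => /=; first by rewrite mem_index_enum.
by exists Y => //; rewrite setTI.
Qed.

Lemma measurable_fun_rVP d (T : measurableType d) n (f : T -> 'rV[R]_n) :
  (forall i, measurable_fun [set: T] (fun x => f x ord0 i)) ->
  measurable_fun [set: T] f.
Proof.
move=> mf; suff H : g_sigma_preimage (fun i x => f x ord0 i) `<=` measurable.
  move=> _ A mA; rewrite setTI; apply: H.
  have := @g_sigma_preimage_comp _ _ n _ (fun i (x : 'rV[R]_n) => x ord0 i) _ f.
  by rewrite /comp => ->; exists A => //; rewrite setTI.
apply: smallest_sub; first exact: sigma_algebra_measurable.
case: n => [|n] in f mf *; first by rewrite big_ord0.
rewrite -bigcup_mkord_ord; apply: bigcup_sub => i Ii.
by move=> A [B mB <-]; exact: mf.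
Qed.

End rV_measurability.

Section lebesgue_rV.
Context {R : realType}.

Definition cons_rV n (p : R * 'rV[R]_n) : 'rV[R]_n.+1 :=
  \row_i oapp (p.2 ord0) p.1 (unlift ord0 i).

Definition uncons_rV n (v : 'rV[R]_n.+1) : R * 'rV[R]_n :=
  (v ord0 ord0, \row_i v ord0 (lift ord0 i)).

Lemma cons_rVK n : cancel (@cons_rV n) (@uncons_rV n).
Proof.
move=> [a v]; rewrite /uncons_rV /cons_rV !mxE unlift_none /=; congr pair.
by apply/rowP => i; rewrite !mxE liftK.
Qed.

Lemma measurable_cons_rV n : measurable_fun setT (@cons_rV n).
Proof.
apply: measurable_fun_rVP => i.
rewrite (_ : (fun x => _) =
    (fun p : R * 'rV[R]_n => oapp (p.2 ord0) p.1 (unlift ord0 i))); last first.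
  by apply/funext => p; rewrite /cons_rV mxE.
case: unliftP => [j|] _ /=; last exact: measurable_fst.
apply: (@measurableT_comp _ _ _ _ _ _ (fun x : 'rV[R]_n => x ord0 j)).
  exact: measurable_coord.
exact: measurable_snd.
Qed.

Lemma measurable_uncons_rV n : measurable_fun setT (@uncons_rV n).
Proof.
apply/measurable_fun_pairP; split; first exact: measurable_coord.
apply: measurable_fun_rVP => i.
rewrite (_ : (fun x => _) = (fun v : 'rV[R]_n.+1 => v ord0 (lift ord0 i))).
  exact: measurable_coord.
by apply/funext => v /=; rewrite mxE.
Qed.

Section step.
Variables (n : nat) (m : {sigma_finite_measure set 'rV[R]_n -> \bar R}).

Definition lebesgue_step : set 'rV[R]_n.+1 -> \bar R :=
  pushforward (@lebesgue_measure R \x m)%E (@cons_rV n).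


Let mcons := @measurable_cons_rV n.

Let step0 : lebesgue_step set0 = 0%E.
Proof. by rewrite /lebesgue_step /pushforward preimage_set0 measure0. Qed.

Let step_ge0 A : (0 <= lebesgue_step A)%E.
Proof. exact: measure_ge0. Qed.

Let step_sigma_additive : semi_sigma_additive lebesgue_step.
Proof. exact: (@measure_semi_sigma_additive _ _ _ (pushforward _ _)). Qed.

HB.instance Definition _ := isMeasure.Build _ _ _ lebesgue_step
  step0 step_ge0 step_sigma_additive.

Let step_sigma_finite : sigma_finite setT lebesgue_step.
Proof.
have /sigma_finiteP[F [TF ndF Foo]] := sigma_finiteT (@lebesgue_measure R).
have /sigma_finiteP[G [TG ndG Goo]] := sigma_finiteT m.
exists (fun k => @uncons_rV n @^-1` (F k `*` G k)).
  rewrite -preimage_bigcup (_ : \bigcup_k _ = setT) ?preimage_setT//.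
  rewrite -setXTT TF TG predeqE => -[x y]; split.
    by move=> [k _ []/= ? ?]; split; exists k.
  move=> [/= [k _ Fkx] [l _ Gly]]; exists (maxn k l) => //; split.
  - by move: x Fkx; exact/subsetPset/ndF/leq_maxl.
  - by move: y Gly; exact/subsetPset/ndG/leq_maxr.
move=> k; have [mFk Fk] := Foo k; have [mGk Gk] := Goo k; split.
  rewrite -[X in measurable X]setTI.
  by apply: measurable_uncons_rV => //; exact: measurableX.
rewrite /lebesgue_step /pushforward -comp_preimage.
rewrite (_ : _ \o _ = id); last by apply/funext => p; exact: cons_rVK.
rewrite preimage_id product_measure1E//.
by rewrite lte_mul_pinfty// ge0_fin_numE.
Qed.

HB.instance Definition _ := Measure_isSigmaFinite.Build _ _ _ lebesgue_step
  step_sigma_finite.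

End step.

Fixpoint lebesgue_rV n : {sigma_finite_measure set 'rV[R]_n -> \bar R} :=
  match n with
  | 0 => \d_(0 : 'rV[R]_0)
  | n'.+1 => lebesgue_step (lebesgue_rV n')
  end.

End lebesgue_rV.
Arguments lebesgue_rV {R n}.

Section kernels.
Context {R : realType}.
Variable d : nat.
Implicit Types x y z xi : 'rV[R]_d.

Definition dotp x y : R := \sum_(i < d) x ord0 i * y ord0 i.

(* The Euclidean norm; the norm `|x| of the library on 'rV[R]_d is the
   sup norm. *)
Definition enorm x : R := Num.sqrt (dotp x x).

Definition heat_kernel (t : R) x : R :=
  (2 * pi * t) `^ (- (d%:R / 2)) * expR (- (enorm x ^+ 2 / (2 * t))).

(* Meaningful for d = 1 and d = 2 only. *)
Definition wave_kernel (t : R) x : R :=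
  if enorm x < t then
    if d == 1%N then 2^-1
    else (2 * pi)^-1 * (t ^+ 2 - enorm x ^+ 2) `^ (- 2^-1)
  else 0.

(* (G(x - .) * kappa)(y), with values in [0, +oo] for G >= 0 *)
Definition kernel_conv (G : 'rV[R]_d -> R) x (kappa : 'rV[R]_d -> \bar R) y :
    \bar R :=
  (\int[lebesgue_rV]_z ((G (x - z)%R)%:E * kappa (y - z)%R))%E.

Definition temperate (g : 'rV[R]_d -> \bar R) : Prop :=
  measurable_fun [set: 'rV[R]_d] g /\
  exists2 l : R, 0 < l &
    (\int[lebesgue_rV]_x (((1 + enorm x ^+ 2) `^ (- l))%:E * `|g x|) < +oo)%E.

Definition ctemperate (g : 'rV[R]_d -> R[i]) : Prop :=
  [/\ measurable_fun [set: 'rV[R]_d] (fun x => complex.Re (g x)),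
      measurable_fun [set: 'rV[R]_d] (fun x => complex.Im (g x)) &
      temperate (fun x => (normc (g x))%:E)].

End kernels.
Arguments heat_kernel {R d}.
Arguments wave_kernel {R d}.

Section distributions.
Context {R : realType}.
Variable d : nat.
Local Notation Rd := 'rV[R]_d.
Local Notation C := R[i].
Implicit Types (phi psi : Rd -> C) (x y xi : Rd).

Definition partial (i : 'I_d) (f : Rd -> R) : Rd -> R :=
  fun x => 'D_(delta_mx ord0 i) f x.

Definition partials (s : seq 'I_d) (f : Rd -> R) : Rd -> R := foldr partial f s.

Definition smooth (f : Rd -> R) : Prop :=
  forall s : seq 'I_d, continuous (partials s f) /\
    forall i x, derivable (partials s f) x (delta_mx ord0 i).

Definition csmooth phi : Prop :=
  smooth (fun x => complex.Re (phi x)) /\ smooth (fun x => complex.Im (phi x)).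

Definition cpartials (s : seq 'I_d) phi : Rd -> C := fun x =>
  partials s (fun y => complex.Re (phi y)) x +i*
  partials s (fun y => complex.Im (phi y)) x.

(* sup over x and over the derivatives D of order at most N of
   (1 + |x|^2)^N |D phi(x)|; this family of seminorms defines the topology of
   the Schwartz space S(R^d) *)
Definition schwartz_seminorm (N : nat) phi : \bar R :=
  ereal_sup [set ((1 + enorm p.2 ^+ 2) ^+ N * normc (cpartials p.1 phi p.2))%:E
            | p in [set p : seq 'I_d * Rd | (size p.1 <= N)%N]].

Definition schwartz phi : Prop :=
  csmooth phi /\ forall N, (schwartz_seminorm N phi < +oo)%E.

Definition support_of phi : set Rd := closure [set x | phi x != 0].

Definition test_function phi : Prop := csmooth phi /\ compact (support_of phi).

(* A distribution T is represented by a functional on all functions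
   R^d -> C; only its values on S(R^d) are relevant. *)
Definition distribution_type := (Rd -> C) -> C.
Implicit Types S T : distribution_type.

Definition tempered_distribution T : Prop :=
  (forall (c : C) phi psi, schwartz phi -> schwartz psi ->
    T (fun x => c * phi x + psi x) = c * T phi + T psi) /\
  exists (M : R) (N : nat), forall phi, schwartz phi ->
    ((normc (T phi))%:E <= M%:E * schwartz_seminorm N phi)%E.

Definition eq_tempered S T : Prop := forall phi, schwartz phi -> S phi = T phi.

Definition compactly_supported T : Prop :=
  exists2 K : set Rd, compact K &
    forall phi, test_function phi -> support_of phi `&` K = set0 -> T phi = 0.

Definition cintegral (f : Rd -> C) : C :=
  (\int[lebesgue_rV]_x complex.Re (f x)) +i*
  (\int[lebesgue_rV]_x complex.Im (f x)).

Definition expi (theta : R) : C := cos theta +i* sin theta.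

Definition fourier phi : Rd -> C :=
  fun xi => cintegral (fun x => expi (- dotp xi x) * phi x).

Definition dist_of_cfun (g : Rd -> C) : distribution_type :=
  fun phi => cintegral (fun x => g x * phi x).

Definition dist_of_rfun (g : Rd -> R) : distribution_type :=
  dist_of_cfun (fun x => (g x)%:C).

(* A [0, +oo]-valued tempered function is finite almost everywhere, so that
   the value 0 taken by fine at +oo does not matter. *)
Definition dist_of_efun (g : Rd -> \bar R) : distribution_type :=
  dist_of_rfun (fun x => fine (g x)).

Definition fourier_dist T : distribution_type := fun phi => T (fourier phi).

(* G(x - .) *)
Definition reflect_translate x T : distribution_type :=
  fun phi => T (fun z => phi (x - z)).

(* S * T for S with compact support and T tempered:
   (S * T, phi) = (T_y, (S_z, phi(z + y))), where y |-> (S_z, phi(z + y))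
   belongs to S(R^d) when phi does. *)
Definition conv_dist S T : distribution_type :=
  fun phi => T (fun y => S (fun z => phi (z + y))).

Definition wave_fundamental_solution (t : R) T : Prop :=
  [/\ tempered_distribution T, compactly_supported T &
      eq_tempered (fourier_dist T)
        (dist_of_rfun (fun xi => sin (t * enorm xi) / enorm xi))].

(* The standing assumptions on kappa, where h is its Fourier transform. *)
Record noise_kernel (kappa : Rd -> \bar R) (h : Rd -> C) : Prop := NoiseKernel {
  nk_ge0 : forall x, (0 <= kappa x)%E ;
  nk_temperate : temperate kappa ;
  nk_fourier : eq_tempered (fourier_dist (dist_of_efun kappa)) (dist_of_cfun h) ;
  nk_fourier_temperate : ctemperate h ;
  nk_sqr_temperate : temperate (fun xi => (normc (h xi) ^+ 2)%:E) ;
  nk_cov : exists f : Rd -> \bar R,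
    [/\ forall x, (0 <= f x)%E, temperate f &
        eq_tempered (dist_of_rfun (fun xi => normc (h xi) ^+ 2))
          (fourier_dist (dist_of_efun f))] }.

Definition spectral_measure (h : Rd -> C) : set Rd -> \bar R := fun A =>
  (\int[lebesgue_rV]_(xi in A)
     (((2 * pi) ^- d)%:E * (normc (h xi) ^+ 2)%:E))%E.

Definition dalang (h : Rd -> C) : Prop :=
  (\int[spectral_measure h]_xi ((1 + enorm xi ^+ 2)^-1)%:E < +oo)%E.

End distributions.

(* Main.v *)
(* Part a) is the measurability part of Tonelli's theorem.

   For part b), let m_r(xi) = sin(r|xi|)/|xi|. It is a smooth function of |xi|^2
   with bounded derivatives, so that it multiplies Schwartz functions. By Fourier
   inversion, z |-> phi(x + y - z) is the Fourier transform of a Schwartz function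
   chi_y, and applying G_r to it gives P(y) = int m_r chi_y, which is in turn the
   Fourier transform at y of a Schwartz function theta. Applying kappa to P and
   using F kappa = h gives (G_r(x - .) * kappa, phi) = int h theta, an integral of
   m_r h against the Fourier transform of phi.

   Dalang's condition says that |h|^2 / (1 + |xi|^2) is integrable, and
   m_r^2 (1 + |xi|^2) is bounded uniformly in 0 < r <= t. Truncate m_r h to balls
   outside of which the integral of |h|^2 / (1 + |xi|^2) is at most 8^-k. The
   inverse Fourier transforms g_k(r, .) of the truncations are absolutely
   convergent integrals, hence jointly measurable, and by Bessel's inequality they
   converge in L^2 so fast that they converge almost everywhere. Then
   g = limsup g_k is jointly measurable and g(r, .) is the required L^2 density. *)

Require Import Defs.
From HB Require Import structures.
From mathcomp Require Import all_boot all_order all_algebra.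
From mathcomp Require Import all_classical all_reals all_analysis.
From mathcomp Require Import measurable_realfun complex ring lra.
Set Implicit Arguments.
Unset Strict Implicit.
Unset Printing Implicit Defensive.
Import Order.TTheory GRing.Theory Num.Theory.
Import numFieldNormedType.Exports.
Local Open Scope classical_set_scope.
Local Open Scope ring_scope.

(** * Lebesgue measure on R^n *)

(** All analysis is done on real integrands. A complex transform becomes a pair of cosine and sine
    integrals, and parity in the frequency variable (the multiplier and [shiftT] are even, [shiftS]
    is odd) makes the unwanted halves vanish. That all derivatives of [sin (sqrt u) / sqrt u] are
    bounded for [u >= 0] is not visible on the power series; it comes from a second-order
    differential equation whose coefficients are affine in [u]. Bessel's inequality for functions in
    both L^1 and L^2, obtained by Gaussian regularisation, takes the place of Plancherel's theorem,
    and the limit is taken pointwise. The rate [8^-k] serves this: weighted by [4^k], the squared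
    increments still have integrals of order [2^-k], while the weights force increments of order
    [2^-k] at almost every point. Joint measurability dictates the order of choices. The radii
    depend on [k] and [h] but not on time, so one sequence [g_k] serves all times, and a limsup is
    measurable before any convergence is known. *)

Section measure_rV.
Context {R : realType}.
Local Notation leb := (@lebesgue_measure R).

(** The topology is that of the sup norm, so the countably many boxes with rational centres and
    radii [1/(k+1)] that lie in [U] exhaust it, and each box is a finite intersection of coordinate
    preimages. *)
Lemma open_measurable_rV n (U : set 'rV[R]_n) : open U -> measurable U.
Proof.
move=> oU.
pose box (q : 'rV[rat]_n * nat) : set 'rV[R]_n :=
  \bigcap_(i in [set: 'I_n])
    ((fun x : 'rV[R]_n => x ord0 i) @^-1` ball (ratr (q.1 ord0 i) : R) q.2.+1%:R^-1).
have mbox q : measurable (box q).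
  apply: fin_bigcap_measurable => // i _; rewrite -[X in measurable X]setTI.
  by apply: measurable_coord => //; exact: measurable_ball.
have -> : U = \bigcup_q (if pselect (box q `<=` U) then box q else set0).
  apply/seteqP; split=> [x Ux|x [q _ /=]]; last by case: pselect => // qU; exact: qU.
  have : nbhs x U by move: oU; rewrite openE => /(_ _ Ux).
  rewrite -nbhs_ballE => -[e /= e0 eU].
  (* Half of [e]: the centre is within [w] of [x] and the points of the box are within [w] of the
     centre. *)
  have [k ke] : exists k : nat, 0 + k.+1%:R^-1 < e / 2.
    by apply: ltr_add_invr; lra.
  have : 0 < k.+1%:R^-1 :> R by rewrite invr_gt0.
  have [w wE] : exists w : R, w = k.+1%:R^-1 by eexists.
  rewrite -wE in ke *; move=> w0.
  have /choice[q Hq] : forall i, exists q : rat, `|ratr q - x ord0 i| < w.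
    move=> i.
    have [|q] := @rat_in_itvoo R (x ord0 i - w) (x ord0 i + w); first lra.
    rewrite in_itv /= => /andP[q1 q2]; exists q; rewrite ltr_norml; apply/andP; split; lra.
  have bx : box (\row_i q i, k) x by move=> i _ /=; rewrite mxE -wE; exact: Hq.
  exists (\row_i q i, k) => //; case: pselect => //; case => y Hy.
  apply: eU; split=> // i j; rewrite (ord1 i).
  have := Hq j; have := Hy j I; rewrite /= mxE -wE /ball /=.
  rewrite !ltr_norml => /andP[? ?] /andP[? ?]; apply/andP; split; lra.
apply: countable_bigcupT_measurable => [|q]; [exact: countableP|].
by case: (pselect _) => ? //=; exact: mbox.
Qed.

Lemma continuous_measurable_rV n (f : 'rV[R]_n -> R) :
  continuous f -> measurable_fun setT f.
Proof.
move=> cf; apply: (measurability _ (RGenOpens.measurableE R)) => _ [_ [a [b ->]] <-].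
rewrite setTI; apply: open_measurable_rV.
by apply: open_comp; [move=> ? _; exact: cf|exact: interval_open].
Qed.

(** [lebesgue_step] is the image of a product measure, so Tonelli peels off the first coordinate.
    This is the induction step for every computation on R^n. *)
Lemma ge0_integral_rVS n (f : 'rV[R]_n.+1 -> \bar R) :
  measurable_fun setT f -> (forall x, 0 <= f x)%E ->
  (\int[lebesgue_rV]_x f x = \int[leb]_t \int[lebesgue_rV]_v f (cons_rV (t, v)))%E.
Proof.
move=> mf f0.
have mc : measurable_fun [set: measurableTypeR R * 'rV[R]_n] (@cons_rV R n).
  exact: measurable_cons_rV.
transitivity (\int[(@lebesgue_measure R \x @lebesgue_rV R n)%E]_p f (cons_rV p))%E.
  have := ge0_integral_pushforward mc
    [the measure _ _ of (@lebesgue_measure R \x @lebesgue_rV R n)%E] measurableT mf.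
  by rewrite preimage_setT => <-.
apply: (@fubini_tonelli1 _ _ (measurableTypeR R) 'rV[R]_n R (@lebesgue_measure R)
  (@lebesgue_rV R n) (f \o @cons_rV R n)) => [|p]; last exact: f0.
exact: measurableT_comp mf mc.
Qed.

(** The condition [s * s = 1] covers translations, used for integration by parts, and reflections,
    used for convolutions. Uniqueness of the measure reduces the claim to half-open intervals. *)
Lemma lebesgue_affine1 (s a : R) : s * s = 1 -> forall A, measurable A ->
  leb A = leb ((fun t : R => s * t + a) @^-1` A).
Proof.
move=> ss.
pose phi : measurableTypeR R -> measurableTypeR R := fun t : R => s * t + a.
have mphi : measurable_fun setT phi.
  have : measurable_fun setT (fun t : R => s * t + a).
    by apply: measurable_funD => //; exact: measurable_funM.
  exact.
apply: (@lebesgue_measure_unique R (pushforward leb phi)) => _ [[b c] _ <-].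
have [s1|s1] : s = 1 \/ s = -1.
  have : (s - 1) * (s + 1) = 0 by lra.
  by move/eqP; rewrite mulf_eq0 => /orP[]/eqP ?; [left|right]; lra.
- transitivity (leb [set` `]b - a, c - a]]); last first.
    congr (lebesgue_measure _); apply/seteqP; split => t /=;
    rewrite /phi s1 !in_itv /= => /andP[? ?]; apply/andP; split; lra.
  rewrite !lebesgue_measure_itv /= !lte_fin ltrD2r.
  by case: ifP => // _; rewrite -!EFinB; congr EFin; lra.
(* A reflection moves the closed end of the interval to the other side; the length is the same. *)
- transitivity (leb [set` `[a - c, a - b[]); last first.
    congr (lebesgue_measure _); apply/seteqP; split => t /=;
    rewrite /phi s1 !in_itv /= => /andP[? ?]; apply/andP; split; lra.
  rewrite !lebesgue_measure_itv /= !lte_fin ltrD2l ltrN2.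
  by case: ifP => // _; rewrite -!EFinB; congr EFin; lra.
Qed.

Lemma ge0_integral_affine1 (s a : R) (f : R -> \bar R) : s * s = 1 ->
  measurable_fun setT f -> (forall x, 0 <= f x)%E ->
  (\int[leb]_t f (s * t + a)%R = \int[leb]_t f t)%E.
Proof.
move=> ss mf f0.
pose phi : measurableTypeR R -> measurableTypeR R := fun t : R => s * t + a.
have mphi : measurable_fun setT phi.
  have : measurable_fun setT (fun t : R => s * t + a).
    by apply: measurable_funD => //; exact: measurable_funM.
  exact.
have := @ge0_integral_pushforward _ _ _ (measurableTypeR R) R _ mphi leb setT f measurableT mf.
rewrite preimage_setT /= => <- //.
apply: eq_measure_integral => A mA _.
by rewrite [RHS](lebesgue_affine1 a ss) .
Qed.

Lemma measurable_affine_rV n (s : R) (a : 'rV[R]_n) :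
  measurable_fun setT (fun x : 'rV[R]_n => s *: x + a).
Proof.
apply: measurable_fun_rVP => i.
rewrite (_ : (fun x => _) = (fun x : 'rV[R]_n => s * x ord0 i + a ord0 i)); last first.
  by apply/funext => x; rewrite !mxE.
by apply: measurable_funD => //; apply: measurable_funM => //; exact: measurable_coord.
Qed.

Lemma ge0_integral_affine_rV n (s : R) (a : 'rV[R]_n) (f : 'rV[R]_n -> \bar R) :
  s * s = 1 -> measurable_fun setT f -> (forall x, 0 <= f x)%E ->
  (\int[lebesgue_rV]_x f (s *: x + a)%R = \int[lebesgue_rV]_x f x)%E.
Proof.
move=> ss; elim: n a f => [|n IH] a f mf f0.
  by apply: eq_integral => x _; congr f; apply/rowP => -[].
rewrite !ge0_integral_rVS //; last first.
  exact: (measurableT_comp mf (measurable_affine_rV s a)).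
transitivity (\int[leb]_t \int[lebesgue_rV]_v f (cons_rV ((s * t + a ord0 ord0)%R, v)))%E.
  apply: eq_integral => t _.
  rewrite -(IH (\row_i a ord0 (lift ord0 i)) (fun v => f (cons_rV (_, v)))) //.
    apply: eq_integral => v _; congr f; apply/rowP => i; rewrite !mxE /=.
    by case: unliftP => [j ->|->] /=; rewrite ?mxE.
  apply: (measurableT_comp mf); apply: (measurableT_comp (@measurable_cons_rV R n)).
  exact: measurable_pair1.
rewrite (ge0_integral_affine1 (a ord0 ord0) (f:= fun t => \int[lebesgue_rV]_v f (cons_rV (t, v)))%E ss) //.
  apply: (measurable_fun_fubini_tonelli_F (f \o @cons_rV R n)) => [|p]; last exact: f0.
  by apply: measurableT_comp => //; exact: measurable_cons_rV.
by move=> t; apply: integral_ge0 => v _; exact: f0.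
Qed.

Lemma lebesgue_rV_affine n (s : R) (a : 'rV[R]_n) (A : set 'rV[R]_n) :
  s * s = 1 -> measurable A ->
  pushforward lebesgue_rV (fun x : 'rV[R]_n => s *: x + a) A = lebesgue_rV A.
Proof.
move=> ss mA; rewrite /pushforward.
have mphi := measurable_affine_rV s a.
have mA' : measurable ((fun x : 'rV[R]_n => s *: x + a) @^-1` A).
  by rewrite -[X in measurable X]setTI; exact: mphi.
have E (B : set 'rV[R]_n) : measurable B -> (lebesgue_rV B = \int[lebesgue_rV]_x (\1_B x)%:E :> \bar R)%E.
  by move=> mB; rewrite integral_indic // setIT.
rewrite (E _ mA') (E _ mA) -(ge0_integral_affine_rV (f := fun x => (\1_A x)%:E) a ss) //.
exact/measurable_EFinP/measurable_indic.
Qed.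

Lemma integrable_affine_rV n (s : R) (a : 'rV[R]_n) (f : 'rV[R]_n -> \bar R) :
  s * s = 1 -> lebesgue_rV.-integrable setT f ->
  lebesgue_rV.-integrable setT (fun x => f (s *: x + a)).
Proof.
move=> ss /integrableP[mf fi]; apply/integrableP; split.
  exact: (measurableT_comp mf (measurable_affine_rV s a)).
rewrite (@ge0_integral_affine_rV n s a (fun x => `|f x|%E)) //.
exact: measurableT_comp.
Qed.

Lemma Rintegral_affine_rV n (s : R) (a : 'rV[R]_n) (f : 'rV[R]_n -> R) :
  s * s = 1 -> lebesgue_rV.-integrable setT (EFin \o f) ->
  \int[lebesgue_rV]_x f (s *: x + a) = \int[lebesgue_rV]_x f x.
Proof.
move=> ss fi; congr fine.
have /integrableP[mf _] := fi.
have fi' := integrable_affine_rV a ss fi.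
have mphi := measurable_affine_rV s a.
have := @integral_pushforward _ _ _ _ _ _ mphi (@lebesgue_rV R n) setT _ mf.
rewrite preimage_setT => /(_ fi' measurableT) <-.
apply: eq_measure_integral => A mA _.
exact: (lebesgue_rV_affine a ss mA).
Qed.

End measure_rV.

(** * Polynomial and Gaussian weights on R^n *)

Section weights.
Context {R : realType}.
Local Notation leb := (@lebesgue_measure R).

Lemma measurable_prod_rV n (w : R -> R) : measurable_fun setT w ->
  measurable_fun setT (fun x : 'rV[R]_n => (\prod_(i < n) w (x ord0 i))%:E).
Proof.
move=> mw; apply/measurable_EFinP.
apply: measurable_prod => i _.
by apply: (measurableT_comp mw); exact: measurable_coord.
Qed.

Lemma ge0_integral_prod_rV n (w : R -> R) (r : R) :
  measurable_fun setT w -> (forall t, 0 <= w t) ->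
  (\int[leb]_t (w t)%:E = r%:E)%E ->
  (\int[@lebesgue_rV R n]_x (\prod_(i < n) w (x ord0 i))%:E = (r ^+ n)%:E)%E.
Proof.
move=> mw w0 wr.
have mP k := @measurable_prod_rV k w mw.
have P0 k (x : 'rV[R]_k) : (0 <= (\prod_(i < k) w (x ord0 i))%:E)%E.
  by rewrite lee_fin; apply: prodr_ge0.
elim: n => [|n IH].
  under eq_integral do rewrite big_ord0.
  rewrite integral_cst //= mul1e; exact: diracT.
rewrite ge0_integral_rVS //.
transitivity (\int[leb]_t ((w t)%:E * (r ^+ n)%:E))%E.
  apply: eq_integral => t _.
  rewrite -IH -ge0_integralZl ?lee_fin //; last exact: mP.
  apply: eq_integral => v _; rewrite -EFinM; congr EFin.
  rewrite big_ord_recl; congr (_ * _); first by rewrite mxE unlift_none.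
  by apply: eq_bigr => i _; rewrite mxE liftK.
have r0 : 0 <= r.
  by rewrite -lee_fin -wr; apply: integral_ge0 => u _; rewrite lee_fin.
rewrite ge0_integralZr //.
- by rewrite wr -EFinM exprS.
- exact/measurable_EFinP.
- by move=> t _; rewrite lee_fin.
- by rewrite lee_fin exprn_ge0.
Qed.

Lemma dotpE n (x : 'rV[R]_n) : dotp x x = \sum_(i < n) x ord0 i ^+ 2.
Proof. by apply: eq_bigr => i _; rewrite expr2. Qed.

Lemma dotp_ge0 n (x : 'rV[R]_n) : 0 <= dotp x x.
Proof. by rewrite dotpE; apply: sumr_ge0 => i _; exact: sqr_ge0. Qed.

Lemma enormE n (x : 'rV[R]_n) : enorm x ^+ 2 = dotp x x.
Proof. by rewrite /enorm sqr_sqrtr // dotp_ge0. Qed.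

Lemma coord_le_dotp n (x : 'rV[R]_n) i : x ord0 i ^+ 2 <= dotp x x.
Proof.
by rewrite dotpE (bigD1 i) //= lerDl; apply: sumr_ge0 => j _; exact: sqr_ge0.
Qed.

Lemma continuous_coord n (i : 'I_n) : continuous (fun x : 'rV[R]_n => x ord0 i).
Proof. exact: coord_continuous. Qed.

Lemma continuous_sum_fun (T : topologicalType) (I : Type) (r : seq I)
    (f : I -> T -> R) :
  (forall i, continuous (f i)) -> continuous (fun x => \sum_(i <- r) f i x).
Proof.
move=> cf; elim: r => [|a r IH].
  by under eq_fun do rewrite big_nil; exact: cst_continuous.
under eq_fun do rewrite big_cons.
by move=> x; apply: continuousD; [exact: cf|exact: IH].
Qed.

Lemma continuous_dotp n (x : 'rV[R]_n) : continuous (fun y : 'rV[R]_n => dotp x y).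
Proof.
apply: continuous_sum_fun => i y.
by apply: continuousM; [exact: cst_continuous|exact: continuous_coord].
Qed.

Lemma continuous_dotpxx n : continuous (fun y : 'rV[R]_n => dotp y y).
Proof.
apply: continuous_sum_fun => i y.
by apply: continuousM; exact: continuous_coord.
Qed.

Definition gauss n (e : R) (x : 'rV[R]_n) : R := expR (- (e / 2 * dotp x x)).

(** Up to its peak value the integrand is the normal density of variance [1/e], which has mass
    one. *)
Lemma integral_gauss1 (e : R) : 0 < e ->
  (\int[leb]_t (expR (- (e / 2 * t ^+ 2)))%:E = (Num.sqrt (2 * pi / e))%:E)%E.
Proof.
move=> e0; pose s := Num.sqrt e^-1.
have s2 : s ^+ 2 = e^-1 by rewrite sqr_sqrtr // invr_ge0 ltW.
have s0 : s != 0 by rewrite gt_eqF // sqrtr_gt0 invr_gt0.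
have sp : 0 < normal_peak s := normal_peak_gt0 s0.
transitivity (\int[leb]_t ((normal_peak s)^-1%:E * (normal_pdf 0 s t)%:E))%E.
  apply: eq_integral => t _; rewrite -EFinM; congr EFin.
  rewrite normal_pdfE // mulKf ?gt_eqF // /normal_fun subr0 s2; congr expR.
  by rewrite -mulr_natr; field; rewrite gt_eqF.
rewrite integralZl //; last exact: integrable_normal_pdf.
rewrite integral_normal_pdf mule1 /normal_peak invrK s2; congr (Num.sqrt _)%:E.
by rewrite -mulr_natr; field; rewrite gt_eqF.
Qed.

Lemma integral_gauss n (e : R) : 0 < e ->
  (\int[@lebesgue_rV R n]_x (gauss e x)%:E = (Num.sqrt (2 * pi / e) ^+ n)%:E)%E.
Proof.
move=> e0; rewrite -(ge0_integral_prod_rV n _ _ (integral_gauss1 e0)).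
- apply: eq_integral => x _; congr EFin.
  by rewrite /gauss dotpE mulr_sumr -sumrN expR_sum.
- apply: measurableT_comp => //; apply: measurableT_comp => //.
  by apply: measurable_funM => //; exact: measurable_funX.
- by move=> t; exact: expR_ge0.
Qed.

(** Since [1 + |x|^2] dominates each [1 + x_i^2], the power [n] bounds the weight by the product of
    the one-dimensional weights [1 / (1 + x_i^2)], each of integral [pi]. *)
Lemma integral_weight n :
  (\int[@lebesgue_rV R n]_x (((1 + dotp x x) ^- n)%:E) < +oo)%E.
Proof.
have H : (\int[leb]_t ((oneDsqr t)^-1)%:E = pi%:E)%E.
  rewrite ge0_symfun_integralT.
  - rewrite (_ : [set x | _] = `[0, +oo[%classic); last first.
      by apply/seteqP; split => x/=; rewrite in_itv/= andbT.
    by rewrite integral0y_oneDsqr -EFinM mulrC divfK.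
  - by move=> x; rewrite invr_ge0 (le_trans _ (oneDsqr_ge1 _)).
  - exact: continuous_oneDsqrV.
  - by move=> x /=; rewrite /oneDsqr sqrrN.
have mw : measurable_fun setT (fun t : R => (oneDsqr t)^-1).
  exact: continuous_measurable_fun (@continuous_oneDsqrV R).
have w0 (t : R) : 0 <= (oneDsqr t)^-1.
  by rewrite invr_ge0 (le_trans _ (oneDsqr_ge1 _)).
apply: (@le_lt_trans _ _ (pi ^+ n)%:E); last exact: ltry.
rewrite -(ge0_integral_prod_rV n mw w0 H); apply: ge0_le_integral => //.
- by move=> x _; rewrite lee_fin invr_ge0 exprn_ge0 // addr_ge0 // dotp_ge0.
- apply/measurable_EFinP; apply: continuous_measurable_rV => x.
  have := @continuousV R 'rV[R]_n (fun y : 'rV[R]_n => (1 + dotp y y) ^+ n) x.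
  apply.
    by rewrite expf_neq0 // gt_eqF // ltr_pwDl // dotp_ge0.
  apply: (@continuous_comp _ _ _ (fun y : 'rV[R]_n => 1 + dotp y y) (fun t : R => t ^+ n)).
    by apply: continuousD; [exact: cst_continuous|exact: continuous_dotpxx].
  exact: exprn_continuous.
- exact: (@measurable_prod_rV n _ mw).
- move=> x _; rewrite lee_fin -exprVn.
  rewrite -[X in X <= _](_ : \prod_(i < n) (1 + dotp x x)^-1 = _); last first.
    by rewrite prodr_const card_ord.
  apply: ler_prod => i _; rewrite invr_ge0 addr_ge0 ?dotp_ge0 //=.
  rewrite lef_pV2 ?posrE ?ltr_pwDl ?dotp_ge0 ?sqr_ge0 //.
  by rewrite lerD2l coord_le_dotp.
Qed.

End weights.

(** * Schwartz functions and multipliers *)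

Section is_derive_tools.
Context {R : realType} {V : normedModType R}.
Implicit Types (x v : V) (f g : V -> R).

(** Directional derivatives become derivatives at 0 along a line, so that the one-variable chain
    rule and differentiation under the integral apply to partial derivatives. *)
Lemma is_derive_line x v f (df : R) :
  is_derive (0 : R) (1 : R) (fun t : R => f (t *: v + x)) df <-> is_derive x v f df.
Proof.
have D : 'D_1 (fun t : R => f (t *: v + x)) 0 = 'D_v f x.
  rewrite /derive; set g1 := fun h => h^-1 *: _; set g2 := fun h => h^-1 *: _.
  suff -> : g1 = g2 by [].
  by apply/funext => h; rewrite /g1 /g2 /= addr0 scale0r add0r [_%:A]mulr1.
split=> -[d e].
  by split; [exact: (proj2 (derivable1P f x v) d)|rewrite -e D].
by split; [exact: (proj1 (derivable1P f x v) d)|rewrite -e -D].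
Qed.

Lemma is_derive_eqr x v f (df' df : R) :
  is_derive x v f df' -> df' = df -> is_derive x v f df.
Proof. by move=> ? <-. Qed.

Lemma is_derive_cstf x v (c : R) : is_derive x v (fun=> c) 0.
Proof. exact: is_derive_cst. Qed.

Lemma is_derive_comp1 x v f (F : R -> R) (df dF : R) :
  is_derive x v f df -> is_derive (f x) 1 F dF ->
  is_derive x v (fun y => F (f y)) (dF * df).
Proof.
move=> /is_derive_line fx Fx; apply/is_derive_line.
apply: (@is_derive1_comp _ F (fun t : R => f (t *: v + x))).
by rewrite scale0r add0r.
Qed.

Lemma is_derive_mulf x v f g (df dg : R) :
  is_derive x v f df -> is_derive x v g dg ->
  is_derive x v (fun y => f y * g y) (f x * dg + df * g x).
Proof.
move=> fx gx; have := is_deriveM fx gx.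
by rewrite -[_ *: dg]/(_ * dg) -[_ *: df]/(_ * df) [g x * df]mulrC.
Qed.

Lemma is_derive_addf x v f g (df dg : R) :
  is_derive x v f df -> is_derive x v g dg ->
  is_derive x v (fun y => f y + g y) (df + dg).
Proof. by move=> fx gx; exact: is_deriveD. Qed.

Lemma is_derive_scal x v f (c df : R) :
  is_derive x v f df -> is_derive x v (fun y => c * f y) (c * df).
Proof. by move=> fx; exact: (@is_deriveZ _ _ _ f c x v df). Qed.

End is_derive_tools.

Section continuity_tools.
Context {R : realType} {T : topologicalType}.
Implicit Types f g : T -> R.

Lemma contD f g : continuous f -> continuous g -> continuous (fun x => f x + g x).
Proof. by move=> cf cg x; apply: continuousD; [exact: cf|exact: cg]. Qed.

Lemma contM f g : continuous f -> continuous g -> continuous (fun x => f x * g x).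
Proof. by move=> cf cg x; apply: continuousM; [exact: cf|exact: cg]. Qed.

Lemma contN f : continuous f -> continuous (fun x => - f x).
Proof. by move=> cf x; apply: continuousN; exact: cf. Qed.

Lemma contcomp f (F : R -> R) : continuous f -> continuous F ->
  continuous (fun x => F (f x)).
Proof. by move=> cf cF x; apply: continuous_comp; [exact: cf|exact: cF]. Qed.

End continuity_tools.

Section tame.
Context {R : realType} {n : nat}.
Local Notation V := 'rV[R]_n.
Implicit Types (f g u v : V -> R) (s : seq 'I_n).
Local Notation e i := (delta_mx ord0 i : V).

Lemma is_derive_coord (i j : 'I_n) (x : V) :
  is_derive x (e i) (fun y : V => y ord0 j) ((i == j)%:R).
Proof.
apply/is_derive_line.
rewrite (_ : (fun t : R => _) = (fun t : R => (i == j)%:R * t + x ord0 j)); last first.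
  by apply/funext => t; rewrite !mxE eqxx /= eq_sym mulrC.
apply: (@is_derive_eqr _ _ _ _ _ ((i == j)%:R * 1 + 0)); lra.
Qed.

Lemma is_derive_sum_fun (I : Type) (r : seq I) (f : I -> V -> R) (df : I -> R) (x v : V) :
  (forall i, is_derive x v (f i) (df i)) ->
  is_derive x v (fun y => \sum_(i <- r) f i y) (\sum_(i <- r) df i).
Proof.
move=> H; elim: r => [|a r IH].
  under eq_fun do rewrite big_nil; rewrite big_nil; exact: is_derive_cstf.
under eq_fun do rewrite big_cons; rewrite big_cons.
exact: is_derive_addf.
Qed.

Lemma is_derive_dotp (i : 'I_n) (a x : V) :
  is_derive x (e i) (fun y : V => dotp a y) (a ord0 i).
Proof.
apply: (@is_derive_eqr _ _ _ _ _ (\sum_(j < n) (a ord0 j * (i == j)%:R))).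
  by apply: is_derive_sum_fun => j; apply: is_derive_scal; exact: is_derive_coord.
rewrite (bigD1 i) //= eqxx mulr1 big1 ?addr0 // => j /negbTE.
by rewrite eq_sym => ->; rewrite mulr0.
Qed.

Lemma is_derive_dotpxx (i : 'I_n) (x : V) :
  is_derive x (e i) (fun y : V => dotp y y) (2 * x ord0 i).
Proof.
apply: (@is_derive_eqr _ _ _ _ _
  (\sum_(j < n) (x ord0 j * (i == j)%:R + (i == j)%:R * x ord0 j))).
  by apply: is_derive_sum_fun => j; apply: is_derive_mulf; exact: is_derive_coord.
rewrite (bigD1 i) //= eqxx mulr1 mul1r big1; first by lra.
by move=> j /negbTE; rewrite eq_sym => ->; rewrite mulr0 mul0r addr0.
Qed.

(* The square of the Japanese bracket of x. *)
Definition japan (x : V) : R := 1 + dotp x x.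

Lemma japan_ge1 x : 1 <= japan x.
Proof. by rewrite lerDl dotp_ge0. Qed.

Lemma japan_gt0 x : 0 < japan x.
Proof. exact: lt_le_trans (japan_ge1 x). Qed.

Lemma japanX_ge0 N x : 0 <= japan x ^+ N.
Proof. by rewrite exprn_ge0 // ltW // japan_gt0. Qed.

Lemma continuous_japan : continuous japan.
Proof.
by apply: contD; [exact: cst_continuous|exact: continuous_dotpxx].
Qed.

Definition rapid f := forall N, exists C, forall x, japan x ^+ N * `|f x| <= C.
Definition slow f := exists N C, forall x, `|f x| <= C * japan x ^+ N.

Lemma slow_cst c : slow (fun=> c).
Proof. by exists 0%N, `|c| => x; rewrite expr0 mulr1. Qed.

(** As [japan >= 1], exponents may be raised once [C] is nonnegative; two growth bounds can then
    share an exponent. *)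
Lemma slow_wlog f : slow f -> exists N C, 0 <= C /\
  forall M, (N <= M)%N -> forall x, `|f x| <= C * japan x ^+ M.
Proof.
case=> N [C fC]; exists N, `|C|; split=> // M NM x.
apply: (le_trans (fC x)).
apply: (@le_trans _ _ (`|C| * japan x ^+ N)).
  by rewrite ler_wpM2r ?ler_norm // exprn_ge0 // ltW // japan_gt0.
by rewrite ler_wpM2l // ler_weXn2l // japan_ge1.
Qed.

Lemma slow_add f g : slow f -> slow g -> slow (fun x => f x + g x).
Proof.
move=> /slow_wlog[N [C [_ fC]]] /slow_wlog[M [D [_ gD]]].
exists (maxn N M), (C + D) => x; rewrite mulrDl (le_trans (ler_normD _ _)) //.
by rewrite lerD // ?fC ?gD // ?leq_maxl ?leq_maxr.
Qed.

Lemma slow_mul f g : slow f -> slow g -> slow (fun x => f x * g x).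
Proof.
move=> /slow_wlog[N [C [_ fC]]] /slow_wlog[M [D [_ gD]]].
exists (N + M)%N, (C * D) => x; rewrite normrM exprD mulrACA.
by apply: ler_pM => //; [exact: fC|exact: gD].
Qed.

Lemma rapid_add f g : rapid f -> rapid g -> rapid (fun x => f x + g x).
Proof.
move=> rf rg N; have [C fC] := rf N; have [D gD] := rg N.
exists (C + D) => x; apply: le_trans (lerD (fC x) (gD x)).
by rewrite -mulrDr ler_wpM2l ?ler_normD // exprn_ge0 // ltW // japan_gt0.
Qed.

Lemma rapid_mul_slow f g : rapid f -> slow g -> rapid (fun x => f x * g x).
Proof.
move=> rf /slow_wlog[M [D [D0 gD]]] N; have [C fC] := rf (N + M)%N.
exists (C * D) => x; rewrite normrM.
apply: (@le_trans _ _ ((japan x ^+ (N + M) * `|f x|) * D)); last first.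
  by rewrite ler_wpM2r // fC.
rewrite exprD -!mulrA ler_wpM2l ?japanX_ge0 //.
by rewrite [leRHS]mulrCA ler_wpM2l // [leRHS]mulrC gD.
Qed.

(* [tame rapid] is the real Schwartz space and [tame slow] is its space of
   multipliers. *)
Definition tame (Q : (V -> R) -> Prop) f := forall s,
  [/\ continuous (partials s f), forall i x, derivable (partials s f) x (e i)
    & Q (partials s f)].

(** A class [P] that is closed under partial derivatives acts as an invariant, so that iterated
    derivatives never have to be computed. *)
Lemma tame_coind Q (P : (V -> R) -> Prop) :
  (forall f, P f -> [/\ continuous f, Q f &
    forall i, exists df, (forall x, is_derive x (e i) f (df x)) /\ P df]) ->
  forall f, P f -> tame Q f.
Proof.
move=> H.
have dH f df i : (forall x, is_derive x (e i) f (df x)) -> partial i f = df.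
  by move=> fdf; apply/funext => x; have [] := fdf x.
have P_partials s f : P f -> P (partials s f).
  elim: s f => [//|i s IH] f Pf /=; have [_ _ /(_ i)[df [/dH-> //]]] := H _ (IH _ Pf).
move=> f Pf s; have [cf Qf df] := H _ (P_partials s _ Pf).
split=> // i x; have [g [fg _]] := df i; by have [] := fg x.
Qed.

Lemma partials_rcons s i f : partials (rcons s i) f = partials s (partial i f).
Proof. by rewrite /partials foldr_rcons. Qed.

Lemma tame_partial Q f i : tame Q f -> tame Q (partial i f).
Proof. by move=> tf s; rewrite -partials_rcons. Qed.

Lemma tame_is_derive Q f i x : tame Q f -> is_derive x (e i) f (partial i f x).
Proof. by move=> /(_ [::])[_ df _]; exact: derivableP. Qed.

Lemma tame_cont Q f : tame Q f -> continuous f.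
Proof. by move=> /(_ [::])[]. Qed.

Lemma tameQ Q f : tame Q f -> Q f.
Proof. by move=> /(_ [::])[]. Qed.

Inductive alg (B : (V -> R) -> Prop) : (V -> R) -> Prop :=
| alg_base f : B f -> alg B f
| alg_cst c : alg B (fun=> c)
| alg_add f g : alg B f -> alg B g -> alg B (fun x => f x + g x)
| alg_mul f g : alg B f -> alg B g -> alg B (fun x => f x * g x).

(* Coinduction up to sums and products: only generators need be differentiated. *)
Lemma alg_slow B :
  (forall f, B f -> [/\ continuous f, slow f &
    forall i, exists df, (forall x, is_derive x (e i) f (df x)) /\ alg B df]) ->
  forall f, alg B f -> tame slow f.
Proof.
move=> H; apply: tame_coind => f; elim => {f} [f /H //|c|f g|f g].
- split; [exact: cst_continuous|exact: slow_cst|move=> i; exists (fun=> 0)].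
  by split; [move=> x; exact: is_derive_cstf|exact: alg_cst].
- move=> af [cf sf df] ag [cg sg dg]; split; [|exact: slow_add|].
    exact: contD.
  move=> i; have [f' [ff' af']] := df i; have [g' [gg' ag']] := dg i.
  exists (fun x => f' x + g' x); split; last exact: alg_add.
  by move=> x; exact: is_derive_addf.
- move=> af [cf sf df] ag [cg sg dg]; split; [|exact: slow_mul|].
    exact: contM.
  move=> i; have [f' [ff' af']] := df i; have [g' [gg' ag']] := dg i.
  exists (fun x => f x * g' x + f' x * g x); split.
    by move=> x; exact: is_derive_mulf.
  by apply: alg_add; apply: alg_mul.
Qed.

Lemma alg_tame_slow f : alg (tame slow) f -> tame slow f.
Proof.
apply: alg_slow => {}f tf; split; [exact: tame_cont tf|exact: tameQ tf|].
move=> i; exists (partial i f); split; first by move=> x; exact: tame_is_derive tf.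
by apply: alg_base; exact: tame_partial.
Qed.

Lemma slow_coord j : tame slow (fun x : V => x ord0 j).
Proof.
apply: (@alg_slow (fun f => f = fun x : V => x ord0 j)); last exact: alg_base.
move=> _ ->; split; first exact: continuous_coord.
  exists 1%N, 1 => x; rewrite mul1r expr1.
  have := coord_le_dotp x j; rewrite -real_normK ?num_real //.
  by rewrite /japan; have := normr_ge0 (x ord0 j); nra.
move=> i; exists (fun=> (i == j)%:R); split; last exact: alg_cst.
by move=> x; exact: is_derive_coord.
Qed.

Lemma tslow_cst c : tame slow (fun=> c).
Proof. by apply: alg_tame_slow; exact: alg_cst. Qed.

Lemma tslow_add f g : tame slow f -> tame slow g -> tame slow (fun x => f x + g x).
Proof. by move=> *; apply: alg_tame_slow; apply: alg_add; exact: alg_base. Qed.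

Lemma tslow_mul f g : tame slow f -> tame slow g -> tame slow (fun x => f x * g x).
Proof. by move=> *; apply: alg_tame_slow; apply: alg_mul; exact: alg_base. Qed.

(** The two functions are generators of the same algebra: each is, up to a constant factor, the
    derivative of the other, and neither alone gives a closed class. *)
Lemma tslow_trig (a : V) : tame slow (fun x => cos (dotp a x)) /\ tame slow (fun x => sin (dotp a x)).
Proof.
have H : forall f, alg (fun f => f = (fun x => cos (dotp a x)) \/
    f = (fun x => sin (dotp a x))) f -> tame slow f.
  apply: alg_slow => f [->|->]; split.
  - by apply: contcomp; [exact: continuous_dotp|exact: continuous_cos].
  - by exists 0%N, 1 => x; rewrite expr0 mulr1 ler_norml cos_geN1 cos_le1.
  - move=> i; exists (fun x => (- a ord0 i) * sin (dotp a x)); split.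
      move=> x; apply: (@is_derive_eqr _ _ _ _ _ (- sin (dotp a x) * a ord0 i)); last by lra.
      by apply: is_derive_comp1; exact: is_derive_dotp.
    by apply: alg_mul; [exact: alg_cst|apply: alg_base; right].
  - by apply: contcomp; [exact: continuous_dotp|exact: continuous_sin].
  - by exists 0%N, 1 => x; rewrite expr0 mulr1 ler_norml sin_geN1 sin_le1.
  - move=> i; exists (fun x => a ord0 i * cos (dotp a x)); split.
      move=> x; apply: (@is_derive_eqr _ _ _ _ _ (cos (dotp a x) * a ord0 i)); last by lra.
      by apply: is_derive_comp1; exact: is_derive_dotp.
    by apply: alg_mul; [exact: alg_cst|apply: alg_base; left].
by split; apply: H; apply: alg_base; [left|right].
Qed.

(** The product rule turns rapid times slow into a sum of two such products; closing under sums
    gives a class to which [tame_coind] applies. *)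
Inductive salg : (V -> R) -> Prop :=
| salg_mul f g : tame rapid f -> tame slow g -> salg (fun x => f x * g x)
| salg_add f g : salg f -> salg g -> salg (fun x => f x + g x).

Lemma salg_rapid f : salg f -> tame rapid f.
Proof.
apply: tame_coind => {}f; elim => {f} [f g tf tg|f g].
- split; first by apply: contM; [exact: tame_cont tf|exact: tame_cont tg].
    by apply: rapid_mul_slow; [exact: tameQ tf|exact: tameQ tg].
  move=> i; exists (fun x => f x * partial i g x + partial i f x * g x); split.
    by move=> x; apply: is_derive_mulf; [exact: tame_is_derive tf|exact: tame_is_derive tg].
  by apply: salg_add; apply: salg_mul => //; exact: tame_partial.
- move=> af [cf sf df] ag [cg sg dg]; split; [|exact: rapid_add|].
    exact: contD.
  move=> i; have [f' [ff' af']] := df i; have [g' [gg' ag']] := dg i.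
  exists (fun x => f' x + g' x); split; last exact: salg_add.
  by move=> x; exact: is_derive_addf.
Qed.

Lemma trapid_mul f g : tame rapid f -> tame slow g -> tame rapid (fun x => f x * g x).
Proof. by move=> *; apply: salg_rapid; exact: salg_mul. Qed.

Lemma trapid_add f g : tame rapid f -> tame rapid g -> tame rapid (fun x => f x + g x).
Proof.
move=> tf tg; apply: salg_rapid; rewrite -[X in salg X]/(fun x => f x + g x).
have := salg_add (salg_mul tf (tslow_cst 1)) (salg_mul tg (tslow_cst 1)).
by under [X in salg X -> _]eq_fun do rewrite !mulr1.
Qed.

Lemma trapid_scal c f : tame rapid f -> tame rapid (fun x => c * f x).
Proof.
by move=> tf; under eq_fun do rewrite mulrC; apply: trapid_mul => //; exact: tslow_cst.
Qed.

Lemma continuous_gauss (c : R) : continuous (@gauss R n c).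
Proof.
apply: contcomp; last exact: continuous_expR.
by apply: contN; apply: contM; [exact: cst_continuous|exact: continuous_dotpxx].
Qed.

Lemma rapid_gauss (c : R) : 0 < c -> rapid (@gauss R n c).
(* With [y = c / 2 * japan x] the Gaussian is [expR (c / 2) / expR y], and [expR y] is at least
   [y ^+ N.+1 / N.+1!]. The constant solves this inequality for [japan x ^+ N.+1], which dominates
   [japan x ^+ N]. *)
Proof.
move=> c0 N; exists (expR (c / 2) * N.+1`!%:R * (c / 2) ^- N.+1) => x.
have J0 := japan_gt0 x.
have y0 : 0 < c / 2 * japan x by rewrite mulr_gt0 // divr_gt0.
have := expR_ge1Dxn N (ltW y0); set E := expR _ => HE.
have f0 : 0 < N.+1`!%:R :> R by rewrite ltr0n fact_gt0.
have gE : gauss c x = expR (c / 2) / E.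
  rewrite -expRN -expRD /gauss /japan; congr expR; ring.
have E0 : 0 < E by exact: expR_gt0.
rewrite gE ger0_norm; last by rewrite divr_ge0 ?expR_ge0 // ltW.
have H2 : (c / 2 * japan x) ^+ N.+1 <= N.+1`!%:R * E.
  by rewrite [leRHS]mulrC -ler_pdivrMr //; apply: le_trans HE; rewrite lerDr.
have H3 : japan x ^+ N <= japan x ^+ N.+1.
  by rewrite ler_weXn2l // japan_ge1.
have w0 : 0 < (c / 2) ^+ N.+1 by rewrite exprn_gt0 // divr_gt0.
rewrite mulrCA -[leRHS]mulrA ler_pM2l ?expR_gt0 // ler_pdivrMr // (le_trans H3) //.
by rewrite mulrAC ler_pdivlMr // mulrC -exprMn.
Qed.

Lemma trapid_gauss (c : R) : 0 < c -> tame rapid (@gauss R n c).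
Proof.
move=> c0.
(* Invariant class: the fixed Gaussian times an arbitrary multiplier. Differentiating the Gaussian
   only changes the multiplier, by a factor [- c * x_i]. *)
apply: (@tame_coind _ (fun f => exists v, tame slow v /\ f = fun x => gauss c x * v x)); last first.
  by exists (fun=> 1); split; [exact: tslow_cst|apply/funext => x; rewrite mulr1].
move=> _ [v [tv ->]]; split.
- by apply: contM; [exact: continuous_gauss|exact: tame_cont tv].
- by apply: rapid_mul_slow; [exact: rapid_gauss|exact: tameQ tv].
- move=> i.
  pose v' x := partial i v x + (- c) * (x ord0 i * v x).
  exists (fun x => gauss c x * v' x); split.
    move=> x; apply: (@is_derive_eqr _ _ _ _ _
      (gauss c x * partial i v x + gauss c x * (- (c / 2 * (2 * x ord0 i))) * v x)).
      apply: is_derive_mulf; last exact: tame_is_derive tv.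
      apply: (@is_derive_comp1 _ _ _ _ (fun y : V => - (c / 2 * dotp y y)) expR).
      apply: is_deriveN; apply: is_derive_scal; exact: is_derive_dotpxx.
    by rewrite /v'; lra.
  exists v'; split => //.
  apply: tslow_add; first exact: tame_partial.
  by apply: tslow_mul; [exact: tslow_cst|apply: tslow_mul => //; exact: slow_coord].
Qed.

End tame.

(** * The Schwartz space in terms of real and imaginary parts *)

Section schwartz_real.
Context {R : realType} {n : nat}.
Local Notation V := 'rV[R]_n.
Implicit Types (f g u v : V -> R) (s : seq 'I_n).

Lemma integrable_japan : lebesgue_rV.-integrable setT (EFin \o (fun x : V => japan x ^- n)).
Proof.
have mJ : measurable_fun setT (fun x : V => (japan x ^- n)).
  apply: continuous_measurable_rV => x.
  have := @continuousV R V (fun y : V => japan y ^+ n) x; apply.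
    by rewrite expf_neq0 // gt_eqF // japan_gt0.
  have := @contcomp R V japan (fun t => t ^+ n) (@continuous_japan R n).
  by apply; exact: exprn_continuous.
apply/integrableP; split; first exact/measurable_EFinP.
rewrite (eq_integral (fun x => ((1 + dotp x x) ^- n)%:E)); first exact: integral_weight.
by move=> x _ /=; rewrite ger0_norm // invr_ge0 japanX_ge0.
Qed.

Lemma integrable_japan_dom f C : measurable_fun setT f ->
  (forall x, japan x ^+ n * `|f x| <= C) -> lebesgue_rV.-integrable setT (EFin \o f).
Proof.
move=> mf fC.
have C0 : 0 <= C by apply: le_trans (fC 0); rewrite mulr_ge0 // japanX_ge0.
have H := integrableZl measurableT C integrable_japan.
apply: le_integrable H => //; first exact/measurable_EFinP.
move=> x _; rewrite -EFinM /= lee_fin [leRHS]ger0_norm; last first.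
  by rewrite mulr_ge0 // invr_ge0 japanX_ge0.
by rewrite ler_pdivlMr ?exprn_gt0 ?japan_gt0 // mulrC.
Qed.

Lemma integrable_rapid f : continuous f -> rapid f ->
  lebesgue_rV.-integrable setT (EFin \o f).
Proof.
move=> cf /(_ n)[C fC]; apply: integrable_japan_dom fC.
exact: continuous_measurable_rV.
Qed.

(** A seminorm takes a supremum over all words [s] of length at most [N], whereas [tame] gives one
    constant per word. The induction strips the innermost derivative and adds the constants of the
    finitely many [partial i f]. *)
Lemma tame_rapid_unif K N f : tame rapid f ->
  exists C, forall s, (size s <= N)%N -> forall x, japan x ^+ K * `|partials s f x| <= C.
Proof.
elim: N f => [|N IH] f tf.
  have [C fC] := tameQ tf K; exists C => -[|//] _ x; exact: fC.
have /choice[D HD] : forall i, exists C, forall s, (size s <= N)%N ->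
    forall x, japan x ^+ K * `|partials s (partial i f) x| <= C.
  by move=> i; apply: IH; exact: tame_partial.
have [C fC] := tameQ tf K.
exists (`|C| + \sum_i `|D i|) => s; case: (lastP s) => [_ x|t i].
  apply: (le_trans (fC x)); apply: (le_trans (ler_norm _)).
  by rewrite lerDl; apply: sumr_ge0.
rewrite size_rcons ltnS partials_rcons => tN x.
apply: (le_trans (HD i t tN x)); apply: (le_trans (ler_norm _)).
rewrite (bigD1 i) //= addrA addrAC lerDr addr_ge0 //; exact: sumr_ge0.
Qed.

Lemma normc_ge_abs (z : R[i]) : (`|complex.Re z| <= normc z) /\ (`|complex.Im z| <= normc z).
Proof.
case: z => a b /=; rewrite -!sqrtr_sqr.
by split; rewrite ler_wsqrtr // ?lerDl ?lerDr sqr_ge0.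
Qed.

Lemma normc_le_abs (z : R[i]) : normc z <= `|complex.Re z| + `|complex.Im z|.
Proof.
case: z => a b /=; rewrite -[leRHS]ger0_norm ?addr_ge0 // -sqrtr_sqr ler_wsqrtr //.
have := real_normK (num_real a); have := real_normK (num_real b).
by have := normr_ge0 a; have := normr_ge0 b; nra.
Qed.

Lemma schwartzP (phi : V -> R[i]) : schwartz phi <->
  tame rapid (fun x => complex.Re (phi x)) /\ tame rapid (fun x => complex.Im (phi x)).
Proof.
split=> [[[sR sI] semi]|[tR tI]].
  have H s N : exists C, forall x, japan x ^+ N * normc (cpartials s phi x) <= C.
    (* One index of the seminorm governs both the weight and the order of differentiation, hence the
       maximum. *)
    have fin := semi (maxn N (size s)).
    exists (fine (schwartz_seminorm (maxn N (size s)) phi)) => x.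
    have le1 : ((japan x ^+ maxn N (size s) * normc (cpartials s phi x))%:E <=
        schwartz_seminorm (maxn N (size s)) phi)%E.
      apply: ereal_sup_ubound; exists (s, x); rewrite /= ?leq_maxr //.
      by rewrite enormE.
    have n0 : 0 <= normc (cpartials s phi x).
      exact: le_trans (proj1 (normc_ge_abs _)).
    apply: (@le_trans _ _ (japan x ^+ maxn N (size s) * normc (cpartials s phi x))).
      by rewrite ler_wpM2r // ler_weXn2l ?japan_ge1 ?leq_maxl.
    rewrite -lee_fin fineK // fin_numE; apply/andP; split.
      by apply: contraTneq le1 => ->.
    by apply: contraTneq fin => ->.
  split=> s.
    have [cs ds] := sR s; split=> // N; have [C HC] := H s N.
    exists C => x; apply: le_trans (HC x).
    by rewrite ler_wpM2l ?japanX_ge0 //; exact: (proj1 (normc_ge_abs (cpartials s phi x))).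
  have [cs ds] := sI s; split=> // N; have [C HC] := H s N.
  exists C => x; apply: le_trans (HC x).
  by rewrite ler_wpM2l ?japanX_ge0 //; exact: (proj2 (normc_ge_abs (cpartials s phi x))).
split; first by split=> s; [have [] := tR s|have [] := tI s].
move=> N; have [C HC] := tame_rapid_unif N N tR; have [D HD] := tame_rapid_unif N N tI.
apply: (@le_lt_trans _ _ (C + D)%:E); last exact: ltry.
apply: ge_ereal_sup => _ [[s x] /= sN <-]; rewrite lee_fin enormE -/(japan x).
apply: (@le_trans _ _ (japan x ^+ N * (`|partials s (fun y => complex.Re (phi y)) x| +
  `|partials s (fun y => complex.Im (phi y)) x|))).
  by rewrite ler_wpM2l ?japanX_ge0 //; exact: (normc_le_abs (cpartials s phi x)).
by rewrite mulrDr lerD // ?HC ?HD.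
Qed.

End schwartz_real.

(** * The multiplier of the wave equation *)

Section sinc_series.
Context {R : realType}.
Implicit Types (c : nat -> R) (x u r : R).

(** Coefficients of exponential type. Formal differentiation preserves the bound, with [A * B] in
    place of [A], so all derived series converge everywhere. *)
Definition entire c := exists A B : R, 0 <= B /\
  forall k, `|c k| <= A * (B ^+ k / k`!%:R).

Lemma entire_cvg c x : entire c -> cvgn (pseries c x).
Proof.
move=> [A [B [B0 cAB]]].
have H k : `|c k * x ^+ k| <= A * exp_coeff (B * `|x|) k.
  rewrite normrM normrX /exp_coeff /= exprMn [X in A * X]mulrAC mulrA.
  by rewrite ler_wpM2r ?exprn_ge0.
apply: normed_cvg.
apply: (@series_le_cvg _ _ (fun k => A * exp_coeff (B * `|x|) k)).
- by move=> k; exact: normr_ge0.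
- by move=> k; apply: le_trans (H k).
- exact: H.
- rewrite (_ : (fun k => _) = A *: exp_coeff (B * `|x|)); last by apply/funext.
  by apply: is_cvg_seriesZ; exact: is_cvg_series_exp_coeff.
Qed.

Lemma entire_diffs c : entire c -> entire (pseries_diffs c).
Proof.
move=> [A [B [B0 cAB]]]; exists (A * B), B; split=> // k.
rewrite /pseries_diffs normrM ger0_norm //.
apply: (@le_trans _ _ (k.+1%:R * (A * (B ^+ k.+1 / k.+1`!%:R)))).
  by rewrite ler_wpM2l.
rewrite factS natrM exprS le_eqVlt; apply/orP; left; apply/eqP.
have f0 : k`!%:R != 0 :> R by rewrite pnatr_eq0 -lt0n fact_gt0.
have k0 : k.+1%:R != 0 :> R by rewrite pnatr_eq0.
by move: (k.+1%:R) k0 => K k0; field; rewrite f0 k0.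
Qed.

Lemma is_derive_entire c x : entire c ->
  is_derive x (1 : R) (fun u => limn (pseries c u)) (limn (pseries (pseries_diffs c) x)).
Proof.
move=> ec; apply: (@pseries_snd_diffs _ _ (`|x| + 1)); try exact: entire_cvg.
- by apply: entire_cvg; exact: entire_diffs.
- by apply: entire_cvg; do 2 apply: entire_diffs.
- by rewrite [ltRHS]ger0_norm ?addr_ge0 // ltrDl.
Qed.

(** Coefficients of [sin r / r] as a series in [u = r^2]. Using [u] as the variable makes the
    composition with [dotp x x] smooth at the origin, where the Euclidean norm is not. *)
Definition sinc_coeff (k : nat) : R := (-1) ^+ k / k.*2.+1`!%:R.

(* The k-th derivative of u |-> sin (sqrt u) / sqrt u. *)
Definition sincd (k : nat) (u : R) : R :=
  limn (pseries (iter k (@pseries_diffs R) sinc_coeff) u).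

Lemma entire_sinc k : entire (iter k (@pseries_diffs R) sinc_coeff).
Proof.
elim: k => [|k IH] /=; last exact: entire_diffs.
exists 1, 1; split=> // k; rewrite /sinc_coeff normrM normrX normrN1 !expr1n !mul1r.
rewrite normfV ger0_norm // lef_pV2 ?posrE ?ltr0n ?fact_gt0 // ler_nat.
by apply: leq_fact; rewrite -addnn -addnS leq_addr.
Qed.

Lemma is_derive_sincd k u : is_derive u (1 : R) (sincd k) (sincd k.+1 u).
Proof. exact: is_derive_entire (entire_sinc k). Qed.

Lemma continuous_sincd k : continuous (sincd k).
Proof.
move=> u; apply/differentiable_continuous/derivable1_diffP.
by have [] := is_derive_sincd k u.
Qed.

Lemma sincd0E r : r * sincd 0 (r ^+ 2) = sin r.
Proof.
have /cvg_lim <- // := @cvg_sin_coeff' R r.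
have -> : sin_coeff' r = r *: (fun k => sinc_coeff k * (r ^+ 2) ^+ k).
  apply/funext => k; rewrite /sin_coeff' /sinc_coeff /= exprS -mul2n exprM mul2n.
  rewrite -exprnP -[RHS]/(r * (_ * _)).
  by move: ((-1) ^+ k) ((k.*2.+1)`!%:R^-1) ((r ^+ 2) ^+ k) => a b c; ring.
by rewrite lim_seriesZ //; exact: (@entire_cvg _ (r ^+ 2) (entire_sinc 0)).
Qed.

Lemma is_derive_sqr (u : R) : is_derive u (1 : R) (fun v : R => v ^+ 2) (2 * u).
Proof.
apply: (@is_derive_eqr R R u 1 (fun v : R => v * v) (u * 1 + 1 * u)); last by lra.
apply: is_derive_mulf.
Qed.

Lemma is_derive_sincd_sqr k r :
  is_derive r (1 : R) (fun u : R => sincd k (u ^+ 2)) (sincd k.+1 (r ^+ 2) * (2 * r)).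
Proof.
apply: (@is_derive_comp1 R R r 1 (fun u : R => u ^+ 2)); last exact: is_derive_sincd.
exact: is_derive_sqr.
Qed.

(** The derivative of the identity [r * sincd 0 (r ^+ 2) = sin r]. Differentiating once more and
    dividing by [r] yields the differential equation in [sincd_rec0]. *)
Lemma sincd1E r : sincd 0 (r ^+ 2) + 2 * r ^+ 2 * sincd 1 (r ^+ 2) = cos r.
Proof.
have d0 := is_derive_sincd_sqr 0 r.
have [_ <-] := is_derive_sin r.
have -> : sin = fun r : R => r * sincd 0 (r ^+ 2) by apply/funext => t; rewrite sincd0E.
have [_ ->] := is_derive_mulf (is_derive_id r (1 : R)) d0.
by rewrite expr2; ring.
Qed.

Lemma sincd_rec0 r : 0 < r -> 4 * r ^+ 2 * sincd 2 (r ^+ 2) + 6 * sincd 1 (r ^+ 2)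
  + sincd 0 (r ^+ 2) = 0.
Proof.
move=> r0; have [_ H] := is_derive_cos r.
have E : cos = fun r : R => sincd 0 (r ^+ 2) + (2 * (r ^+ 2 * sincd 1 (r ^+ 2))).
  by apply/funext => t; rewrite -sincd1E mulrA.
move: H; rewrite E.
have d1 := is_derive_addf (is_derive_sincd_sqr 0 r)
  (is_derive_scal 2 (is_derive_mulf (is_derive_sqr r) (is_derive_sincd_sqr 1 r))).
have [_ ->] := d1; rewrite -sincd0E => H.
by apply: (mulfI (lt0r_neq0 r0)); rewrite mulr0; lra.
Qed.

(* f = sincd 0 satisfies 4 u f'' + 6 f' + f = 0; differentiating k times gives
   a recursion that bounds all the derivatives of f near +oo. *)
Lemma sincd_rec k u : 0 < u ->
  4 * (u * sincd k.+2 u) + (6 + 4 * k%:R) * sincd k.+1 u + sincd k u = 0.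
Proof.
elim: k u => [|k IH] u u0.
  have := @sincd_rec0 (Num.sqrt u); rewrite sqrtr_gt0 sqr_sqrtr ?(ltW u0) // => /(_ u0).
  lra.
have d : is_derive u (1 : R) (fun u : R => 4 * (u * sincd k.+2 u) +
    (6 + 4 * k%:R) * sincd k.+1 u + sincd k u)
    (4 * (u * sincd k.+3 u + 1 * sincd k.+2 u) + (6 + 4 * k%:R) * sincd k.+2 u + sincd k.+1 u).
  apply: is_derive_addf; last exact: is_derive_sincd.
  apply: is_derive_addf; apply: is_derive_scal; last exact: is_derive_sincd.
  by apply: is_derive_mulf; exact: is_derive_sincd.
(* By the induction hypothesis the expression vanishes on a whole neighbourhood of [u > 0], so its
   derivative, computed above, is 0. *)
have d0 : is_derive u (1 : R) (fun u : R => 4 * (u * sincd k.+2 u) +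
    (6 + 4 * k%:R) * sincd k.+1 u + sincd k u) 0.
  apply: (@near_eq_is_derive _ _ _ (fun=> 0)).
  near=> v; rewrite IH //; near: v; exact: lt_nbhsr.
have [_] := d; have [_ ->] := d0 => ->.
rewrite -natr1; ring.
Unshelve. all: by end_near. Qed.

(** Continuity settles [[0, 1]]. For [u >= 1] the recursion gives the derivative of order [k + 2]
    from the two preceding ones after division by [4 * u]; the claim therefore carries two
    consecutive orders. *)
Lemma sincd_bounded k : exists C, forall u, 0 <= u -> `|sincd k u| <= C.
Proof.
suff H : exists C, forall u, 1 <= u -> `|sincd k u| <= C /\ `|sincd k.+1 u| <= C.
  have [C HC] := H.
  have [|c _ Hc] := @EVT_max R (fun u => `|sincd k u|) 0 1 ler01.
    apply: continuous_subspaceT => x.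
    apply: (@continuous_comp _ _ _ (sincd k) (@Num.norm R R)); first exact: continuous_sincd.
    exact: norm_continuous.
  exists (`|sincd k c| + `|C|) => u u0; have [u1|u1] := leP u 1.
    by rewrite (le_trans (Hc u _)) ?in_itv /= ?u0 // lerDl.
  have [+ _] := HC u (ltW u1) => /le_trans; apply.
  by rewrite (le_trans (ler_norm _)) // lerDr.
elim: k => [|k [C HC]].
  (* With [r = sqrt u >= 1], the identities for [sin r] and [cos r] can be solved for [sincd 0 u]
     and [sincd 1 u], and both are at most 1 in absolute value. *)
  exists 1 => u u1; have u0 : 0 < u by lra.
  pose r := Num.sqrt u; have r2 : r ^+ 2 = u by rewrite sqr_sqrtr // ltW.
  have r1 : 1 <= r by rewrite -sqrtr1 ler_wsqrtr.
  have := sincd0E r; have := sincd1E r; rewrite r2.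
  have := sin_le1 r; have := sin_geN1 r; have := cos_le1 r; have := cos_geN1 r.
  move: (sin r) (cos r) (sincd 0 u) (sincd 1 u) => S C J0 J1 C1 C2 S1 S2 H1 H0.
  have HJ0 : `|J0| <= 1 by rewrite ler_norml; apply/andP; split; nra.
  split=> //; move: HJ0; rewrite !ler_norml => /andP[? ?]; apply/andP; split; nra.
exists (`|C| + ((6 + 4 * k%:R) * `|C| + `|C|) / 4) => u u1.
have [H0 H1] := HC u u1; have u0 : 0 < u by lra.
have := sincd_rec k u0; have := ler0n R k; move: (k%:R) => K K0.
have := normr_ge0 C; have := ler_norm C; move: (`|C|) => D CD D0 E.
have {}H0 := le_trans H0 CD; have {}H1 := le_trans H1 CD.
split; first by rewrite (le_trans H1) // lerDl; nra.
have : `|4 * (u * sincd k.+2 u)| <= (6 + 4 * K) * D + D.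
  have -> : 4 * (u * sincd k.+2 u) = - ((6 + 4 * K) * sincd k.+1 u + sincd k u) by lra.
  rewrite normrN (le_trans (ler_normD _ _)) // lerD // normrM ger0_norm; last by lra.
  by rewrite ler_wpM2l //; lra.
rewrite !normrM (ger0_norm (ltW u0)) ger0_norm //.
have := normr_ge0 (sincd k.+2 u); nra.
Qed.

End sinc_series.

Section wave_multiplier.
Context {R : realType} {n : nat}.
Local Notation V := 'rV[R]_n.

Lemma tslow_sincd k (a : R) : 0 <= a -> tame slow (fun x : V => sincd k (a * dotp x x)).
Proof.
move=> a0.
apply: (@alg_slow _ _ (fun f => (exists k, f = fun x : V => sincd k (a * dotp x x)) \/
  tame slow f)); last by apply: alg_base; left; exists k.
move=> f [[{}k ->]|tf]; last first.
  split; [exact: tame_cont tf|exact: tameQ tf|move=> i].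
  exists (partial i f); split; first by move=> x; exact: tame_is_derive tf.
  by apply: alg_base; right; exact: tame_partial.
split.
- apply: contcomp; last exact: continuous_sincd.
  by apply: contM; [exact: cst_continuous|exact: continuous_dotpxx].
- have [C HC] := @sincd_bounded R k; exists 0%N, C => x; rewrite expr0 mulr1.
  by apply: HC; rewrite mulr_ge0 // dotp_ge0.
- move=> i; exists (fun x => sincd k.+1 (a * dotp x x) * (a * 2 * x ord0 i)); split.
    move=> x; rewrite -mulrA.
    apply: (@is_derive_comp1 _ _ _ _ (fun y : V => a * dotp y y)); last exact: is_derive_sincd.
    by apply: is_derive_scal; exact: is_derive_dotpxx.
  apply: alg_mul; apply: alg_base; [by left; exists k.+1|right].
  by apply: tslow_mul; [exact: tslow_cst|exact: slow_coord].
Qed.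

(* The Fourier multiplier sin (r|x|) / |x|, with the right value at x = 0. *)
Definition wave_mult (r : R) (x : V) : R := r * sincd 0 (r ^+ 2 * dotp x x).

Lemma tslow_wave_mult r : tame slow (wave_mult r).
Proof.
by apply: tslow_mul; [exact: tslow_cst|apply: tslow_sincd; exact: sqr_ge0].
Qed.

Lemma wave_multE r (x : V) : x != 0 -> wave_mult r x = sin (r * enorm x) / enorm x.
Proof.
move=> x0; have e0 : enorm x != 0.
  apply: contra x0 => /eqP E; have H : dotp x x = 0 by rewrite -enormE E expr0n.
  apply/eqP/rowP => i; rewrite mxE; apply/eqP; rewrite -sqrf_eq0 eq_le sqr_ge0 andbT.
  by rewrite (le_trans (coord_le_dotp x i)) // H.
by rewrite -sincd0E exprMn enormE /wave_mult; field.
Qed.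

(** The two terms of [japan] are bounded separately: the square of the multiplier is at most
    [C^2 t^2], and its product with [|x|^2] is [sin^2 (r |x|)], at most 1. Hence the weight in
    Dalang's condition. *)
Lemma wave_mult_bound (t : R) : exists2 K, 0 <= K & forall r (x : V), 0 < r <= t ->
  wave_mult r x ^+ 2 * japan x <= K.
Proof.
have [C HC] := @sincd_bounded R 0.
have C0 : 0 <= C by apply: le_trans (HC 0 _).
exists (C ^+ 2 * t ^+ 2 + 1) => [|r x /andP[r0 rt]].
  by rewrite addr_ge0 // mulr_ge0 // sqr_ge0.
rewrite /japan mulrDr mulr1 lerD //.
  rewrite /wave_mult exprMn mulrC -[X in X * _]real_normK ?num_real //.
  apply: ler_pM; rewrite ?sqr_ge0 // lerXn2r ?nnegrE // ?(ltW r0) //; last by lra.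
  by apply: HC; rewrite mulr_ge0 ?sqr_ge0 ?dotp_ge0.
rewrite -enormE -exprMn mulrC /wave_mult mulrA [enorm x * r]mulrC -enormE -exprMn sincd0E.
rewrite -[leRHS](expr1n _ 2) -[X in X <= _]real_normK ?num_real // lerXn2r ?nnegrE //.
by rewrite ler_norml sin_geN1 sin_le1.
Qed.

End wave_multiplier.

(** * Fourier cosine and sine transforms *)

Section integrable_tools.
Context d (T : measurableType d) (R : realType) (mu : {measure set T -> \bar R}).
Implicit Types f g w : T -> R.

Lemma integrable_le f g : mu.-integrable setT (EFin \o f) -> measurable_fun setT g ->
  (forall x, `|g x| <= `|f x|) -> mu.-integrable setT (EFin \o g).
Proof.
move=> fi mg gf; apply: le_integrable fi => //; first exact/measurable_EFinP.
by move=> x _ /=; rewrite lee_fin.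
Qed.

Lemma integrable_meas f : mu.-integrable setT (EFin \o f) -> measurable_fun setT f.
Proof. by move=> /integrableP[/measurable_EFinP]. Qed.

Lemma integrable_add f g : mu.-integrable setT (EFin \o f) ->
  mu.-integrable setT (EFin \o g) -> mu.-integrable setT (EFin \o (fun x => f x + g x)).
Proof. by move=> fi gi; exact: (integrableD measurableT fi gi). Qed.

Lemma integrable_scal c f : mu.-integrable setT (EFin \o f) ->
  mu.-integrable setT (EFin \o (fun x => c * f x)).
Proof. by move=> fi; exact: (integrableZl measurableT c fi). Qed.

Lemma integrable_mulb (K : R) w f : mu.-integrable setT (EFin \o f) -> measurable_fun setT w ->
  (forall x, `|w x| <= K) -> mu.-integrable setT (EFin \o (fun x => w x * f x)).
Proof.
move=> fi mw wK; apply: (integrable_le (integrable_scal K fi)).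
  by apply: measurable_funM => //; exact: integrable_meas.
by move=> x; rewrite !normrM ler_wpM2r // (le_trans (wK x)) // ler_norm.
Qed.

Lemma integrable_norm f : mu.-integrable setT (EFin \o f) ->
  mu.-integrable setT (EFin \o (fun x => `|f x|)).
Proof.
move=> fi; apply: (integrable_le fi); last by move=> x; rewrite normr_id.
apply: (measurableT_comp (@normr_measurable R setT)); exact: integrable_meas.
Qed.

Lemma is_derive_integral (F dF : R -> T -> R) (G : T -> R) :
  (forall t, mu.-integrable setT (EFin \o F t)) ->
  (forall t x, is_derive t (1 : R) (fun t => F t x) (dF t x)) ->
  mu.-integrable setT (EFin \o G) ->
  (forall t x, `|t| < 1 -> `|dF t x| <= G x) ->
  is_derive (0 : R) (1 : R) (fun t => \int[mu]_x F t x) (\int[mu]_x dF 0 x).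
Proof.
move=> Fi Fd Gi FG.
have I0 : (`]-1, 1[%classic : set R) 0 by rewrite /= in_itv /= ltrN10 ltr01.
have G0 x : 0 <= G x by apply: le_trans (FG 0 x _) => //; rewrite normr0.
have d1 t x : partial1of2 F t x = dF t x.
  by rewrite partial1of2E; have [] := Fd t x.
have b1 t x : (`]-1, 1[%classic : set R) t -> setT x -> `|partial1of2 F t x| <= G x.
  by rewrite /= in_itv /= => It _; rewrite d1 FG // ltr_norml.
have der t x : (`]-1, 1[%classic : set R) t -> setT x -> derivable (F^~ x) t 1.
  by move=> _ _; have [] := Fd t x.
split.
  exact: (@derivable_under_integral R d T mu F setT measurableT 0 (-1) 1 I0
    (fun x _ => Fi x) der G G0 Gi b1).
rewrite -derive1E (@differentiation_under_integral R d T mu F setT measurableT 0 (-1) 1 I0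
    (fun x _ => Fi x) der G G0 Gi b1).
by apply: eq_Rintegral => x _; rewrite d1.
Qed.

End integrable_tools.

Section transforms.
Context {R : realType} {n : nat}.
Local Notation V := 'rV[R]_n.
Local Notation L1 f := ((@lebesgue_rV R n).-integrable setT (EFin \o f)).
Implicit Types (f g : V -> R) (x y v xi : V).

(** For real [f] the Fourier transform is [cosT f - i sinT f]. *)
Definition cosT f xi : R := \int[lebesgue_rV]_x (cos (dotp xi x) * f x).
Definition sinT f xi : R := \int[lebesgue_rV]_x (sin (dotp xi x) * f x).

Lemma dotpC x y : dotp x y = dotp y x.
Proof. by apply: eq_bigr => i _; rewrite mulrC. Qed.

Lemma dotpDl x y z : dotp (x + y : V) z = dotp x z + dotp y z.
Proof. by rewrite /dotp -big_split /=; apply: eq_bigr => i _; rewrite mxE mulrDl. Qed.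

Lemma dotpZl (t : R) x y : dotp (t *: x : V) y = t * dotp x y.
Proof. by rewrite /dotp mulr_sumr; apply: eq_bigr => i _; rewrite mxE mulrA. Qed.

Lemma dotpZr (t : R) x y : dotp y (t *: x : V) = t * dotp y x.
Proof. by rewrite dotpC dotpZl (dotpC y). Qed.

Lemma dotpNl x y : dotp (- x : V) y = - dotp x y.
Proof. by rewrite -scaleN1r dotpZl mulN1r. Qed.

Lemma dotpNr x y : dotp y (- x : V) = - dotp y x.
Proof. by rewrite dotpC dotpNl (dotpC y). Qed.

Lemma normr_cos_le1 (t : R) : `|cos t| <= 1.
Proof. by rewrite ler_norml cos_geN1 cos_le1. Qed.

Lemma normr_sin_le1 (t : R) : `|sin t| <= 1.
Proof. by rewrite ler_norml sin_geN1 sin_le1. Qed.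

Lemma measurable_cos_dotp xi : measurable_fun setT (fun x : V => cos (dotp xi x)).
Proof.
apply: continuous_measurable_rV; apply: contcomp; last exact: continuous_cos.
exact: continuous_dotp.
Qed.

Lemma measurable_sin_dotp xi : measurable_fun setT (fun x : V => sin (dotp xi x)).
Proof.
apply: continuous_measurable_rV; apply: contcomp; last exact: continuous_sin.
exact: continuous_dotp.
Qed.

Lemma integrable_cos f xi : L1 f -> L1 (fun x => cos (dotp xi x) * f x).
Proof.
move=> fi; apply: (integrable_mulb (K := 1)) => //; first exact: measurable_cos_dotp.
by move=> x; exact: normr_cos_le1.
Qed.

Lemma integrable_sin f xi : L1 f -> L1 (fun x => sin (dotp xi x) * f x).
Proof.
move=> fi; apply: (integrable_mulb (K := 1)) => //; first exact: measurable_sin_dotp.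
by move=> x; exact: normr_sin_le1.
Qed.

Lemma L1_tame f : tame rapid f -> L1 f.
Proof. by move=> tf; apply: integrable_rapid; [exact: tame_cont tf|exact: tameQ tf]. Qed.

Lemma tslow_dotp v : tame slow (fun x : V => dotp v x).
Proof.
rewrite /dotp; elim: (index_enum _) => [|i r IH].
  by under eq_fun do rewrite big_nil; exact: tslow_cst.
under eq_fun do rewrite big_cons.
by apply: tslow_add => //; apply: tslow_mul; [exact: tslow_cst|exact: slow_coord].
Qed.

Lemma cosTD f g xi : L1 f -> L1 g -> cosT (fun x => f x + g x) xi = cosT f xi + cosT g xi.
Proof.
move=> fi gi; rewrite /cosT -RintegralD //; [|exact: integrable_cos..].
by apply: eq_Rintegral => x _; rewrite mulrDr.
Qed.

Lemma cosTZ c f xi : L1 f -> cosT (fun x => c * f x) xi = c * cosT f xi.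
Proof.
move=> fi; rewrite /cosT -RintegralZl //; last exact: integrable_cos.
by apply: eq_Rintegral => x _; rewrite mulrCA.
Qed.

Lemma sinTD f g xi : L1 f -> L1 g -> sinT (fun x => f x + g x) xi = sinT f xi + sinT g xi.
Proof.
move=> fi gi; rewrite /sinT -RintegralD //; [|exact: integrable_sin..].
by apply: eq_Rintegral => x _; rewrite mulrDr.
Qed.

Lemma sinTZ c f xi : L1 f -> sinT (fun x => c * f x) xi = c * sinT f xi.
Proof.
move=> fi; rewrite /sinT -RintegralZl //; last exact: integrable_sin.
by apply: eq_Rintegral => x _; rewrite mulrCA.
Qed.

Lemma is_derive_affine (a b t : R) : is_derive t (1 : R) (fun t : R => t * a + b) a.
Proof.
apply: (@is_derive_eqr R R t 1 (fun t : R => t * a + b) ((t * 0 + 1 * a) + 0)); last by lra.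
apply: is_derive_addf; apply: is_derive_mulf.
Qed.

Lemma is_derive_cosT f xi v : tame rapid f ->
  is_derive xi v (cosT f) (- sinT (fun x => dotp v x * f x) xi).
Proof.
move=> tf; have tg : tame rapid (fun x => dotp v x * f x).
  under eq_fun do rewrite mulrC; apply: trapid_mul => //; exact: tslow_dotp.
apply/is_derive_line.
pose F (t : R) x := cos (t * dotp v x + dotp xi x) * f x.
pose dF (t : R) x := - sin (t * dotp v x + dotp xi x) * (dotp v x * f x).
rewrite (_ : - sinT _ _ = \int[lebesgue_rV]_x dF 0 x); last first.
  rewrite -mulN1r -RintegralZl //; last exact: (integrable_sin _ (L1_tame tg)).
  by apply: eq_Rintegral => x _; rewrite /dF mul0r add0r mulN1r mulNr.
rewrite (_ : (fun t : R => _) = fun t => \int[lebesgue_rV]_x F t x); last first.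
  by apply/funext => t; apply: eq_Rintegral => x _; rewrite /F dotpDl dotpZl.
apply: (is_derive_integral _ _ (integrable_norm (L1_tame tg))).
- move=> t; have := integrable_cos (t *: v + xi) (L1_tame tf).
  by congr (_.-integrable _ _); apply/funext => x; rewrite /F /= dotpDl dotpZl.
- move=> t x; apply: (@is_derive_eqr R R t 1 (fun t => F t x)
    (- sin (t * dotp v x + dotp xi x) * dotp v x * f x)); last by rewrite /dF mulrA.
  rewrite /F; under eq_fun do rewrite mulrC.
  rewrite mulrC; apply: is_derive_scal.
  apply: (@is_derive_comp1 R R t 1 (fun t : R => t * dotp v x + dotp xi x)).
  exact: is_derive_affine.
- move=> t x _; rewrite /dF normrM normrN -[leRHS]mul1r ler_wpM2r //.
  exact: normr_sin_le1.
Qed.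

Lemma is_derive_sinT f xi v : tame rapid f ->
  is_derive xi v (sinT f) (cosT (fun x => dotp v x * f x) xi).
Proof.
move=> tf; have tg : tame rapid (fun x => dotp v x * f x).
  under eq_fun do rewrite mulrC; apply: trapid_mul => //; exact: tslow_dotp.
apply/is_derive_line.
pose F (t : R) x := sin (t * dotp v x + dotp xi x) * f x.
pose dF (t : R) x := cos (t * dotp v x + dotp xi x) * (dotp v x * f x).
rewrite (_ : cosT _ _ = \int[lebesgue_rV]_x dF 0 x); last first.
  by apply: eq_Rintegral => x _; rewrite /dF mul0r add0r.
rewrite (_ : (fun t : R => _) = fun t => \int[lebesgue_rV]_x F t x); last first.
  by apply/funext => t; apply: eq_Rintegral => x _; rewrite /F dotpDl dotpZl.
apply: (is_derive_integral _ _ (integrable_norm (L1_tame tg))).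
- move=> t; have := integrable_sin (t *: v + xi) (L1_tame tf).
  by congr (_.-integrable _ _); apply/funext => x; rewrite /F /= dotpDl dotpZl.
- move=> t x; apply: (@is_derive_eqr R R t 1 (fun t => F t x)
    (cos (t * dotp v x + dotp xi x) * dotp v x * f x)); last by rewrite /dF mulrA.
  rewrite /F; under eq_fun do rewrite mulrC.
  rewrite mulrC; apply: is_derive_scal.
  apply: (@is_derive_comp1 R R t 1 (fun t : R => t * dotp v x + dotp xi x)).
  exact: is_derive_affine.
- move=> t x _; rewrite /dF normrM -[leRHS]mul1r ler_wpM2r //.
  exact: normr_cos_le1.
Qed.

(** It lets one integrable function dominate the derivatives of all translates with [|t| < 1]. The
    factor 3 comes from [(b - t)^2 <= 2 * b^2 + 2]. *)
Lemma japan_shift (i : 'I_n) (t : R) x : `|t| < 1 ->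
  japan x <= 3 * japan (t *: delta_mx ord0 i + x).
Proof.
move=> t1; set y := _ + x; have -> : x = y - t *: delta_mx ord0 i by rewrite /y addrC addKr.
clearbody y.
have t2 : t ^+ 2 <= 1.
  by rewrite -real_normK ?num_real // -[leRHS](expr1n _ 2) lerXn2r ?nnegrE // ltW.
rewrite /japan !dotpE (bigD1 i) //= [in leRHS](bigD1 i) //=.
rewrite !mxE !eqxx mulr1 (eq_bigr (fun j => y ord0 j ^+ 2)); last first.
  by move=> j /negbTE ji; rewrite !mxE eqxx ji mulr0 subr0.
have : 0 <= \sum_(j < n | j != i) y ord0 j ^+ 2 by apply: sumr_ge0 => j _; exact: sqr_ge0.
have := sqr_ge0 (y ord0 i + t); have := sqr_ge0 (y ord0 i).
move: (\sum_(j < n | _) _) (y ord0 i) t2 => S y0; rewrite !expr2 => t2 y2 yt S0; lra.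
Qed.

(** By translation invariance the integral of [f (t *: ei + x)] does not depend on [t]; its
    derivative at [t = 0], taken under the integral, is the left-hand side. *)
Lemma integral_partial f i : tame rapid f -> \int[lebesgue_rV]_x partial i f x = 0.
Proof.
move=> tf; have tp := tame_partial i tf.
set ei : V := delta_mx ord0 i.
have [C HC] := tameQ tp n.
have C0 : 0 <= C by apply: le_trans (HC 0); rewrite mulr_ge0 // japanX_ge0.
have H : is_derive (0 : R) (1 : R) (fun t : R => \int[lebesgue_rV]_x f (t *: ei + x))
    (\int[lebesgue_rV]_x partial i f (0 *: ei + x)).
  apply: (is_derive_integral (F := fun t x => f (t *: ei + x))
    (dF := fun t x => partial i f (t *: ei + x))
    (G := fun x => (3 ^+ n * C) * japan x ^- n)).
  - move=> t; have := integrable_affine_rV (t *: ei) (mulr1 1) (L1_tame tf).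
    by congr (_.-integrable _ _); apply/funext => x /=; rewrite scale1r addrC.
  - move=> t x.
    apply: (@is_derive_eqr R R t 1 (fun t : R => f (t *: ei + x))
      (partial i f (t *: ei + x) * 1)); last by rewrite mulr1.
    rewrite (_ : (fun t : R => _) = fun s : R => f ((s - t) *: ei + (t *: ei + x))); last first.
      by apply/funext => s; rewrite addrA -scalerDl subrK.
    apply: (@is_derive_comp1 R R t 1 (fun s : R => s - t) (fun h => f (h *: ei + (t *: ei + x)))).
      have := @is_derive_addf R R t 1 id (fun=> - t) _ _ (is_derive_id t 1) (is_derive_cstf t 1 (- t)).
      by rewrite addr0.
    rewrite subrr; apply/is_derive_line; exact: tame_is_derive tf.
  - exact: integrable_scal (@integrable_japan R n).
  - move=> t x t1; rewrite ler_pdivlMr ?exprn_gt0 ?japan_gt0 // mulrC.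
    apply: (@le_trans _ _ ((3 * japan (t *: ei + x)) ^+ n * `|partial i f (t *: ei + x)|)).
      rewrite ler_wpM2r // lerXn2r ?nnegrE ?mulr_ge0 ?(ltW (japan_gt0 _)) //.
      exact: japan_shift.
    by rewrite exprMn -mulrA ler_wpM2l ?exprn_ge0 //; exact: HC.
have [_ H1] := H.
transitivity (\int[lebesgue_rV]_x partial i f (0 *: ei + x)).
  by apply: eq_Rintegral => x _; rewrite scale0r add0r.
rewrite -H1 (_ : (fun t : R => _) = cst (\int[lebesgue_rV]_x f x)) ?derive_cst //.
apply/funext => t; rewrite -(Rintegral_affine_rV (t *: ei) (mulr1 1) (L1_tame tf)).
by apply: eq_Rintegral => x _; rewrite scale1r addrC.
Qed.

(** Integration by parts: the partial derivative of [f x * sin (dotp xi x)] has integral 0. *)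
Lemma cosT_partial f i xi : tame rapid f -> xi ord0 i * cosT f xi = - sinT (partial i f) xi.
Proof.
move=> tf; have [tc ts] := tslow_trig xi.
have tsf := trapid_mul tf ts; have tcf := trapid_mul tf tc.
have := integral_partial i tsf.
have -> : partial i (fun x => f x * sin (dotp xi x)) =
    (fun x => xi ord0 i * (cos (dotp xi x) * f x) + sin (dotp xi x) * partial i f x).
  apply/funext => x.
  have d1 : is_derive x (delta_mx ord0 i) (fun x : V => sin (dotp xi x)) (cos (dotp xi x) * xi ord0 i).
    by apply: is_derive_comp1; exact: is_derive_dotp.
  have [_ E] := is_derive_mulf (tame_is_derive i x tf) d1.
  by apply: (etrans E); ring.
rewrite RintegralD //; last 2 first.
- by apply: integrable_scal; apply: integrable_cos; exact: L1_tame.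
- by apply: integrable_sin; apply: L1_tame; exact: tame_partial.
rewrite RintegralZl //; last by apply: integrable_cos; exact: L1_tame.
by rewrite /cosT /sinT => /eqP; rewrite addr_eq0 => /eqP.
Qed.

Lemma sinT_partial f i xi : tame rapid f -> xi ord0 i * sinT f xi = cosT (partial i f) xi.
Proof.
move=> tf; have [tc ts] := tslow_trig xi.
have tsf := trapid_mul tf ts; have tcf := trapid_mul tf tc.
have := integral_partial i tcf.
have -> : partial i (fun x => f x * cos (dotp xi x)) =
    (fun x => (- xi ord0 i) * (sin (dotp xi x) * f x) + cos (dotp xi x) * partial i f x).
  apply/funext => x.
  have d1 : is_derive x (delta_mx ord0 i) (fun x : V => cos (dotp xi x)) (- sin (dotp xi x) * xi ord0 i).
    by apply: is_derive_comp1; exact: is_derive_dotp.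
  have [_ E] := is_derive_mulf (tame_is_derive i x tf) d1.
  by apply: (etrans E); ring.
rewrite RintegralD //; last 2 first.
- by apply: integrable_scal; apply: integrable_sin; exact: L1_tame.
- by apply: integrable_cos; apply: L1_tame; exact: tame_partial.
rewrite RintegralZl //; last by apply: integrable_sin; exact: L1_tame.
by rewrite /cosT /sinT => /eqP; rewrite mulNr addrC subr_eq0 => /eqP.
Qed.

Lemma trapid0 : tame rapid (fun _ : V => 0 : R).
Proof.
have := trapid_scal 0 (@trapid_gauss R n 1 ltr01).
by under [X in tame _ X -> _]eq_fun do rewrite mul0r.
Qed.

(* Fourier multiplier [japan], i.e. 1 - Laplacian. *)
Definition bessel_op f : V -> R := fun x => f x + \sum_i (- 1) * partial i (partial i f) x.

Lemma tame_bessel_op f : tame rapid f -> tame rapid (bessel_op f).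
Proof.
move=> tf; apply: trapid_add => //; elim: (index_enum _) => [|i r IH].
  by under eq_fun do rewrite big_nil; exact: trapid0.
under eq_fun do rewrite big_cons.
by apply: trapid_add => //; apply: trapid_scal; do 2 apply: tame_partial.
Qed.

Lemma japan_cosT f xi : tame rapid f -> japan xi * cosT f xi = cosT (bessel_op f) xi.
Proof.
move=> tf; rewrite /japan mulrDl mul1r dotpE.
have tr (r : seq 'I_n) : tame rapid (fun x => \sum_(i <- r) (- 1) * partial i (partial i f) x).
  elim: r => [|i r IH].
    by under eq_fun do rewrite big_nil; exact: trapid0.
  under eq_fun do rewrite big_cons.
  by apply: trapid_add => //; apply: trapid_scal; do 2 apply: tame_partial.
rewrite /bessel_op cosTD; [|exact: L1_tame..]; congr (_ + _).
elim: (index_enum _) => [|i r IH].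
  rewrite big_nil mul0r; transitivity (\int[@lebesgue_rV R n]_x (0 : R)).
    by rewrite Rintegral_cst // mul0r.
  by apply: eq_Rintegral => x _; rewrite big_nil mulr0.
rewrite big_cons mulrDl IH; under [in RHS]eq_fun do rewrite big_cons.
have t2 : tame rapid (partial i (partial i f)) by do 2 apply: tame_partial.
rewrite cosTD ?cosTZ; [|exact: L1_tame|exact: L1_tame (trapid_scal _ t2)|exact: L1_tame].
congr (_ + _); rewrite expr2 -mulrA mulN1r cosT_partial // mulrN; congr (- _).
by apply: sinT_partial; exact: tame_partial.
Qed.

Lemma japan_sinT f xi : tame rapid f -> japan xi * sinT f xi = sinT (bessel_op f) xi.
Proof.
move=> tf; rewrite /japan mulrDl mul1r dotpE.
have tr (r : seq 'I_n) : tame rapid (fun x => \sum_(i <- r) (- 1) * partial i (partial i f) x).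
  elim: r => [|i r IH].
    by under eq_fun do rewrite big_nil; exact: trapid0.
  under eq_fun do rewrite big_cons.
  by apply: trapid_add => //; apply: trapid_scal; do 2 apply: tame_partial.
rewrite /bessel_op sinTD; [|exact: L1_tame..]; congr (_ + _).
elim: (index_enum _) => [|i r IH].
  rewrite big_nil mul0r; transitivity (\int[@lebesgue_rV R n]_x (0 : R)).
    by rewrite Rintegral_cst // mul0r.
  by apply: eq_Rintegral => x _; rewrite big_nil mulr0.
rewrite big_cons mulrDl IH; under [in RHS]eq_fun do rewrite big_cons.
have t2 : tame rapid (partial i (partial i f)) by do 2 apply: tame_partial.
rewrite sinTD ?sinTZ; [|exact: L1_tame|exact: L1_tame (trapid_scal _ t2)|exact: L1_tame].
congr (_ + _); rewrite expr2 -mulrA mulN1r sinT_partial //.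
by apply: cosT_partial; exact: tame_partial.
Qed.

(** Multiplying a transform by [japan xi] amounts to replacing [f] by [bessel_op f], which is tame
    again, so each induction step gains one power of the weight. The L^1 norm is the base bound. *)
Lemma rapid_transforms f : tame rapid f -> rapid (cosT f) /\ rapid (sinT f).
Proof.
move=> tf; split=> N; elim: N f tf => [|N IH] f tf.
- exists (\int[lebesgue_rV]_x `|f x|) => xi; rewrite expr0 mul1r.
  have ci := integrable_cos xi (L1_tame tf).
  apply: le_trans (le_normr_Rintegral measurableT ci) _.
  apply: le_Rintegral => //; [exact: integrable_norm|exact: integrable_norm (L1_tame tf)|].
  by move=> x _; rewrite normrM -[leRHS]mul1r ler_wpM2r // normr_cos_le1.
- have [C HC] := IH _ (tame_bessel_op tf); exists C => xi; apply: le_trans (HC xi).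
  by rewrite exprSr -mulrA -japan_cosT // normrM (ger0_norm (ltW (japan_gt0 _))).
- exists (\int[lebesgue_rV]_x `|f x|) => xi; rewrite expr0 mul1r.
  have ci := integrable_sin xi (L1_tame tf).
  apply: le_trans (le_normr_Rintegral measurableT ci) _.
  apply: le_Rintegral => //; [exact: integrable_norm|exact: integrable_norm (L1_tame tf)|].
  by move=> x _; rewrite normrM -[leRHS]mul1r ler_wpM2r // normr_sin_le1.
- have [C HC] := IH _ (tame_bessel_op tf); exists C => xi; apply: le_trans (HC xi).
  by rewrite exprSr -mulrA -japan_sinT // normrM (ger0_norm (ltW (japan_gt0 _))).
Qed.

End transforms.

(** * Smoothness of transforms, and the transform of a Gaussian *)

Section transforms_tame.
Context {R : realType} {n : nat}.
Local Notation V := 'rV[R]_n.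
Local Notation L1 f := ((@lebesgue_rV R n).-integrable setT (EFin \o f)).
Implicit Types (f g : V -> R) (x y v xi : V).

Lemma lipschitz1 (F dF : R -> R) : (forall t, is_derive t (1 : R) F (dF t)) ->
  (forall t, `|dF t| <= 1) -> forall a b, `|F a - F b| <= `|a - b|.
Proof.
move=> Fd F1.
suff H a b : a <= b -> `|F b - F a| <= `|b - a|.
  move=> a b; have [ab|ba] := leP a b; last exact: H (ltW ba).
  by rewrite distrC [leRHS]distrC; exact: H.
move=> ab; have [|c _ ->] := @MVT_segment R F dF a b ab (fun t _ => Fd t).
- apply: derivable_within_continuous => t _; exact: (@ex_derive _ _ _ _ _ _ _ (Fd t)).
- by rewrite normrM -[leRHS]mul1r ler_wpM2r.
Qed.

Lemma sum_coord_bound (e : R) x y : (forall i, `|x ord0 i| <= e) ->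
  `|dotp x y| <= e * \sum_i `|y ord0 i|.
Proof.
move=> xe; apply: (le_trans (ler_norm_sum _ _ _)); rewrite mulr_sumr.
by apply: ler_sum => i _; rewrite normrM ler_wpM2r.
Qed.

(** [F] is 1-Lipschitz, so moving [xi] by at most [d] in each coordinate changes the value by at
    most [d] times the integral of the sum of the [|x_i * f x|]. A general [F] covers cosine and
    sine. *)
Lemma cont_transform (F dF : R -> R) f : tame rapid f ->
  (forall t, is_derive t (1 : R) F (dF t)) ->
  (forall t, `|dF t| <= 1) -> (forall t, `|F t| <= 1) -> continuous F ->
  continuous (fun xi => \int[lebesgue_rV]_x (F (dotp xi x) * f x)).
Proof.
move=> tf Fd dF1 F1 cF xi.
have Fi z : L1 (fun x => F (dotp z x) * f x).
  apply: (integrable_mulb (K := 1)) => //; first exact: L1_tame.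
  by apply: continuous_measurable_rV; apply: contcomp => //; exact: continuous_dotp.
pose w x := \sum_i `|x ord0 i * f x|.
have wi : L1 w.
  rewrite /w; elim: (index_enum _) => [|i r IH].
    by under eq_fun do rewrite big_nil; exact: L1_tame trapid0.
  under eq_fun do rewrite big_cons; apply: integrable_add => //.
  apply: integrable_norm; under eq_fun do rewrite mulrC.
  by apply: L1_tame; apply: trapid_mul => //; exact: slow_coord.
set K := \int[lebesgue_rV]_x w x.
have K0 : 0 <= K by apply: Rintegral_ge0 => x _; apply: sumr_ge0.
have FF : Filter (nbhs (xi : V)) by exact: nbhs_filter.
apply: (proj2 (@cvgrPdist_le _ _ _ _ FF _ _)) => /= e e0.
have d0 : 0 < e / (K + 1) by rewrite divr_gt0 // ltr_wpDl.
apply/(@nbhs_ballP R V xi); exists (e / (K + 1)) => //= z Bz.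
have zi i : `|xi ord0 i - z ord0 i| <= e / (K + 1).
  by have [_ /(_ ord0 i)] := Bz; rewrite /ball /= => /ltW.
rewrite -RintegralB //.
have Bi : L1 (fun x => F (dotp xi x) * f x - F (dotp z x) * f x).
  have := integrable_add (Fi xi) (integrable_scal (-1) (Fi z)).
  by congr (_.-integrable _ _); apply/funext => x /=; rewrite mulN1r.
apply: le_trans (le_normr_Rintegral measurableT Bi) _.
apply: (@le_trans _ _ (\int[lebesgue_rV]_x (e / (K + 1) * w x))).
  apply: le_Rintegral => //; [exact: integrable_norm|exact: integrable_scal|].
  move=> x _; rewrite -mulrBl normrM /w mulr_sumr.
  have := lipschitz1 Fd dF1 (dotp xi x) (dotp z x).
  rewrite -dotpNl -dotpDl => /le_trans L.
  apply: (@le_trans _ _ ((e / (K + 1) * \sum_i `|x ord0 i|) * `|f x|)).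
    rewrite ler_wpM2r //; apply: L; apply: sum_coord_bound => i.
    by rewrite !mxE; exact: zi.
  rewrite -mulrA mulr_suml mulr_sumr; apply: ler_sum => i _.
  by rewrite normrM.
rewrite RintegralZl // -/K mulrAC ler_pdivrMr ?ltr_wpDl //.
by rewrite ler_wpM2l ?(ltW e0) // lerDl.
Qed.

Lemma tame_transforms f : tame rapid f -> tame rapid (cosT f) /\ tame rapid (sinT f).
Proof.
pose P g := exists f, tame rapid f /\ (g = cosT f \/ g = sinT f).
have H : forall g, P g -> tame rapid g.
  apply: tame_coind => _ [{}f [tf [->|->]]]; split.
  - apply: (cont_transform tf (fun t => is_derive_cos t)).
    + by move=> t; rewrite normrN; exact: normr_sin_le1.
    + exact: normr_cos_le1.
    + exact: continuous_cos.
  - by have [] := rapid_transforms tf.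
  - move=> i; set ei : V := delta_mx ord0 i.
    (* The minus sign from the derivative of the cosine is absorbed into the vector, so that the
       derivative is literally a sine transform and stays in [P]. *)
    have tg : tame rapid (fun x => dotp (- ei) x * f x).
      under eq_fun do rewrite mulrC; apply: trapid_mul => //; exact: tslow_dotp.
    exists (sinT (fun x => dotp (- ei) x * f x)); split; last by eexists; split; [exact: tg|right].
    move=> x; apply: (is_derive_eqr (is_derive_cosT x ei tf)).
    rewrite /sinT -mulN1r -RintegralZl //.
      by apply: eq_Rintegral => y _; rewrite dotpNl; ring.
    apply: integrable_sin; apply: L1_tame.
    under eq_fun do rewrite mulrC; apply: trapid_mul => //; exact: tslow_dotp.
  - apply: (cont_transform tf (fun t => is_derive_sin t)).
    + exact: normr_cos_le1.
    + exact: normr_sin_le1.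
    + exact: continuous_sin.
  - by have [] := rapid_transforms tf.
  - move=> i; set ei : V := delta_mx ord0 i.
    exists (cosT (fun x => dotp ei x * f x)); split; first by move=> x; exact: is_derive_sinT.
    eexists; split; last by left.
    under eq_fun do rewrite mulrC; apply: trapid_mul => //; exact: tslow_dotp.
by move=> tf; split; apply: H; exists f; split=> //; [left|right].
Qed.

Lemma partial_gauss (e : R) i x : partial i (@gauss R n e) x = - e * (x ord0 i * gauss e x).
Proof.
have d : is_derive x (delta_mx ord0 i) (@gauss R n e) (gauss e x * (- (e / 2 * (2 * x ord0 i)))).
  apply: (@is_derive_comp1 _ _ _ _ (fun y : V => - (e / 2 * dotp y y)) expR).
  apply: is_deriveN; apply: is_derive_scal; exact: is_derive_dotpxx.
have [_ E] := d; apply: (etrans E); lra.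
Qed.

Lemma integral_gaussR (e : R) : 0 < e ->
  \int[lebesgue_rV]_x @gauss R n e x = Num.sqrt (2 * pi / e) ^+ n.
Proof. by move=> e0; rewrite /Rintegral integral_gauss. Qed.

(** Along the ray [t *: xi] the transform solves [y' = - (|xi|^2 / e) * t * y]. [B] divides it by
    the Gaussian solution of this equation and is therefore constant; its values at 1 and 0 are
    compared. *)
Lemma cosT_gauss (e : R) xi : 0 < e ->
  cosT (@gauss R n e) xi = Num.sqrt (2 * pi / e) ^+ n * gauss e^-1 xi.
Proof.
move=> e0; have tg := @trapid_gauss R n e e0.
(* A factor [y_i] on the Gaussian is [- e^-1] times a partial derivative, which integration by parts
   moves to the trigonometric factor. *)
have moment x : sinT (fun y => dotp xi y * gauss e y) x = e^-1 * dotp xi x * cosT (gauss e) x.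
  transitivity (sinT (fun y => \sum_i (- (xi ord0 i / e)) * partial i (gauss e) y) x).
    apply: eq_Rintegral => y _; congr (_ * _); rewrite /dotp mulr_suml.
    apply: eq_bigr => i _; rewrite partial_gauss; field; exact: lt0r_neq0.
  rewrite /dotp mulr_sumr mulr_suml.
  have tr (r : seq 'I_n) : tame rapid (fun y => \sum_(i <- r) (- (xi ord0 i / e)) * partial i (gauss e) y).
    elim: r => [|i r IH].
      by under eq_fun do rewrite big_nil; exact: trapid0.
    under eq_fun do rewrite big_cons.
    by apply: trapid_add => //; apply: trapid_scal; apply: tame_partial.
  elim: (index_enum _) => [|i r IH].
    rewrite big_nil; transitivity (\int[@lebesgue_rV R n]_x (0 : R)).
      by apply: eq_Rintegral => y _; rewrite big_nil mulr0.
    by rewrite Rintegral_cst // mul0r.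
  rewrite big_cons -IH; under [in LHS]eq_fun do rewrite big_cons.
  have tp : tame rapid (partial i (gauss e)) by exact: tame_partial.
  rewrite sinTD ?sinTZ; [|exact: L1_tame|exact: L1_tame (trapid_scal _ tp)|exact: L1_tame].
  congr (_ + _); rewrite -[sinT _ _]opprK -cosT_partial //; field; exact: lt0r_neq0.
pose B (t : R) := cosT (gauss e) (t *: xi) * expR (e^-1 / 2 * dotp xi xi * t ^+ 2).
have dB t : is_derive t (1 : R) B 0.
  have d1 : is_derive t (1 : R) (fun t : R => cosT (gauss e) (t *: xi))
      (- (e^-1 * dotp xi (t *: xi) * cosT (gauss e) (t *: xi))).
    rewrite -moment.
    have := is_derive_cosT (t *: xi) xi tg => /is_derive_line D.
    have := @is_derive_comp1 R R t 1 (fun s : R => s - t)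
      (fun h => cosT (gauss e) (h *: xi + t *: xi)) _ _
      (@is_derive_addf R R t 1 id (fun=> - t) _ _ (is_derive_id t 1) (is_derive_cstf t 1 (- t))).
    rewrite subrr => /(_ _ D); rewrite addr0 mulr1.
    by under [X in is_derive _ _ X _ -> _]eq_fun do rewrite -scalerDl subrK.
  have d2 : is_derive t (1 : R) (fun t : R => expR (e^-1 / 2 * dotp xi xi * t ^+ 2))
     (expR (e^-1 / 2 * dotp xi xi * t ^+ 2) * (e^-1 / 2 * dotp xi xi * (2 * t))).
    apply: (@is_derive_comp1 R R t 1 (fun t : R => e^-1 / 2 * dotp xi xi * t ^+ 2) expR).
    by apply: is_derive_scal; exact: is_derive_sqr.
  apply: is_derive_eqr (is_derive_mulf d1 d2) _; rewrite dotpZr; lra.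
have := @is_derive_0_is_cst R B 1 0 dB; rewrite /B.
rewrite expr0n /= mulr0 expR0 mulr1 scale1r expr1n mulr1 scale0r => E.
have E0 : cosT (@gauss R n e) 0 = Num.sqrt (2 * pi / e) ^+ n.
  rewrite -integral_gaussR //; apply: eq_Rintegral => x _.
  by rewrite -(scale0r 0) dotpZl mul0r cos0 mul1r.
by rewrite -E0 -E -[RHS]mulrA [X in _ * (_ * X)]/gauss -expRD subrr expR0 mulr1.
Qed.

(** The partial derivative of [gauss e x * x_i] in direction [i] has integral 0. *)
Lemma gauss_moment (e : R) i : 0 < e ->
  \int[@lebesgue_rV R n]_x (x ord0 i ^+ 2 * gauss e x) = e^-1 * \int[lebesgue_rV]_x @gauss R n e x.
Proof.
move=> e0; have tg := @trapid_gauss R n e e0.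
have tx := trapid_mul tg (@slow_coord R n i).
have t2 := trapid_mul tx (@slow_coord R n i).
have := integral_partial i tx.
have -> : partial i (fun x => gauss e x * x ord0 i) =
    (fun x => gauss e x + - e * (x ord0 i ^+ 2 * gauss e x)).
  apply/funext => x.
  have [_ E] := is_derive_mulf (tame_is_derive i x tg) (is_derive_coord i i x).
  by apply: (etrans E); rewrite eqxx partial_gauss mulr1; ring.
have L2 : L1 (fun x => x ord0 i ^+ 2 * gauss e x).
  by have := L1_tame t2; congr (_.-integrable _ _); apply/funext => x /=; rewrite expr2; congr EFin; ring.
rewrite RintegralD //; [|exact: L1_tame|exact: integrable_scal].
rewrite RintegralZl // => H; apply: (mulfI (lt0r_neq0 e0)).
by rewrite mulVKf ?lt0r_neq0 //; lra.
Qed.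

End transforms_tame.

(** * Fubini's theorem and dominated convergence for real-valued integrals *)

Section fubini_real.
Context d1 d2 (T1 : measurableType d1) (T2 : measurableType d2) (R : realType).
Variables (m1 : {sigma_finite_measure set T1 -> \bar R})
  (m2 : {sigma_finite_measure set T2 -> \bar R}).

(** A product bound holds in every application below, and it makes every section integrable rather
    than almost every one, so inner integrals can be rewritten at each point. *)
Lemma Rfubini_dom (F : T1 * T2 -> R) (f : T1 -> R) (g : T2 -> R) :
  measurable_fun setT F -> m1.-integrable setT (EFin \o f) ->
  m2.-integrable setT (EFin \o g) ->
  (forall x y, `|F (x, y)| <= `|f x| * `|g y|) ->
  [/\ forall x, m2.-integrable setT (EFin \o (fun y => F (x, y))),
      m1.-integrable setT (EFin \o (fun x => \int[m2]_y F (x, y))),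
      forall y, m1.-integrable setT (EFin \o (fun x => F (x, y))) &
      \int[m1]_x \int[m2]_y F (x, y) = \int[m2]_y \int[m1]_x F (x, y)].
Proof.
move=> mF fi gi Ffg.
have i2 x : m2.-integrable setT (EFin \o (fun y => F (x, y))).
  apply: (integrable_le (integrable_scal (f x) gi)).
    exact: (measurableT_comp mF (measurable_pair1 x)).
  by move=> y; rewrite [leRHS]normrM.
have i1 y : m1.-integrable setT (EFin \o (fun x => F (x, y))).
  apply: (integrable_le (integrable_scal (g y) fi)).
    exact: (measurableT_comp mF (measurable_pair2 y)).
  by move=> x; rewrite [leRHS]normrM mulrC.
have mFE : measurable_fun setT (EFin \o F) by exact/measurable_EFinP.
have iF : (m1 \x m2)%E.-integrable setT (EFin \o F).
  apply/(integrable12ltyP _ _ mFE).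
  apply: (@le_lt_trans _ _ (\int[m1]_x (`|f x|%:E * \int[m2]_y `|g y|%:E))%E).
    apply: ge0_le_integral => //.
    - by move=> x _; apply: integral_ge0.
    - apply: (measurable_fun_fubini_tonelli_F (abse \o (EFin \o F))) => [|p].
        exact: measurableT_comp.
      exact: abse_ge0.
    - apply: emeasurable_funM => //; apply/measurable_EFinP.
      exact: measurableT_comp (integrable_meas fi).
    - move=> x _; rewrite -ge0_integralZl //.
      + apply: ge0_le_integral => //.
        * by apply: measurableT_comp => //; have /integrableP[] := i2 x.
        * apply: emeasurable_funM => //; apply/measurable_EFinP.
          exact: measurableT_comp (integrable_meas gi).
        * by move=> y _; rewrite /= -EFinM lee_fin.
      + by apply/measurable_EFinP; exact: measurableT_comp (integrable_meas gi).
  have /integrableP[_ fi'] := fi; have /integrableP[_ gi'] := gi.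
  rewrite ge0_integralZr //.
  - by rewrite lte_mul_pinfty ?integral_ge0 // ge0_fin_numE ?integral_ge0.
  - by apply/measurable_EFinP; exact: measurableT_comp (integrable_meas fi).
  - by apply: integral_ge0.
have E2 x : (\int[m2]_y (F (x, y))%:E = (\int[m2]_y F (x, y))%:E)%E.
  by rewrite /Rintegral fineK //; exact: integrable_fin_num (i2 x).
have E1 y : (\int[m1]_x (F (x, y))%:E = (\int[m1]_x F (x, y))%:E)%E.
  by rewrite /Rintegral fineK //; exact: integrable_fin_num (i1 y).
split=> //.
  have := integrable_fubini_F iF; congr (_.-integrable _ _).
  by apply/funext => x; rewrite /fubini_F /= E2.
have := Fubini iF; rewrite /= => H; rewrite /Rintegral.
under eq_integral => x _ do rewrite -E2.
rewrite H; congr fine; apply: eq_integral => y _.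
by rewrite E1.
Qed.

End fubini_real.

Section dominated_real.
Context d (T : measurableType d) (R : realType) (mu : {measure set T -> \bar R}).

Lemma Rdominated (f_ : nat -> T -> R) (f g : T -> R) :
  (forall k, measurable_fun setT (f_ k)) -> measurable_fun setT f ->
  {ae mu, forall x, f_ ^~ x @ \oo --> f x} ->
  mu.-integrable setT (EFin \o g) ->
  {ae mu, forall x, forall k, `|f_ k x| <= g x} ->
  mu.-integrable setT (EFin \o f) /\
  (fun k => \int[mu]_x f_ k x) @ \oo --> \int[mu]_x f x.
Proof.
move=> mf_ mf ff gi fg.
have ff' : {ae mu, forall x, setT x -> (fun k => (f_ k x)%:E) @ \oo --> (f x)%:E}.
  by apply: filterS ff => x Hx _; apply: cvg_EFin; [exact: nearW|exact: Hx].
have fg' : {ae mu, forall x k, setT x -> (`|(f_ k x)%:E| <= (g x)%:E)%E}.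
  by apply: filterS fg => x Hx k _; exact: Hx.
have [fi _ H] := @dominated_convergence d T R mu setT measurableT
  (fun k x => (f_ k x)%:E) (EFin \o f) (EFin \o g)
  (fun k => (proj2 (measurable_EFinP _ _) (mf_ k)))
  (proj2 (measurable_EFinP _ _) mf)
  ff' gi fg'.
split=> //.
apply: fine_cvg; rewrite fineK; last exact: integrable_fin_num fi.
exact: H.
Qed.

End dominated_real.

(** * Fourier inversion and Bessel's inequality *)

Section inversion.
Context {R : realType} {n : nat}.
Local Notation V := 'rV[R]_n.
Local Notation mu := (@lebesgue_rV R n).
Local Notation L1 f := ((@lebesgue_rV R n).-integrable setT (EFin \o f)).
Implicit Types (f g u phi : V -> R) (x y v w xi : V).

Lemma measurable_dotp d (T : measurableType d) (F G : T -> V) :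
  measurable_fun setT F -> measurable_fun setT G ->
  measurable_fun setT (fun t => dotp (F t) (G t)).
Proof.
move=> mF mG; apply: measurable_sum => i.
by apply: measurable_funM; [apply: (measurableT_comp (measurable_coord i) mF)
  |apply: (measurableT_comp (measurable_coord i) mG)].
Qed.

Lemma measurable_sub_rV d (T : measurableType d) (F G : T -> V) :
  measurable_fun setT F -> measurable_fun setT G ->
  measurable_fun setT (fun t => F t - G t).
Proof.
move=> mF mG; apply: measurable_fun_rVP => i.
rewrite (_ : (fun t => _) = fun t : T => F t ord0 i - G t ord0 i); last first.
  by apply/funext => t; rewrite !mxE.
by apply: measurable_funB; [apply: (measurableT_comp (measurable_coord i) mF)
  |apply: (measurableT_comp (measurable_coord i) mG)].
Qed.

Lemma measurable_cosf d (T : measurableType d) (F : T -> R) :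
  measurable_fun setT F -> measurable_fun setT (fun t => cos (F t)).
Proof.
apply: measurableT_comp; apply: continuous_measurable_fun; exact: continuous_cos.
Qed.

Lemma measurable_sinf d (T : measurableType d) (F : T -> R) :
  measurable_fun setT F -> measurable_fun setT (fun t => sin (F t)).
Proof.
apply: measurableT_comp; apply: continuous_measurable_fun; exact: continuous_sin.
Qed.

(* The real part of e^{i w.xi} times the Fourier transform of u at xi;
   the imaginary part is [shiftS] below. *)
Definition shiftT u w xi : R := cos (dotp w xi) * cosT u xi + sin (dotp w xi) * sinT u xi.

Lemma shiftTE u w xi : L1 u ->
  shiftT u w xi = \int[mu]_v (cos (dotp (w - v) xi) * u v).
Proof.
move=> ui; rewrite /shiftT /cosT /sinT.
rewrite -!RintegralZl //; [|exact: integrable_sin|exact: integrable_cos].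
rewrite -RintegralD //.
- apply: eq_Rintegral => v _; rewrite dotpDl dotpNl cosB (dotpC xi); ring.
- exact: integrable_scal (integrable_cos _ ui).
- exact: integrable_scal (integrable_sin _ ui).
Qed.

Lemma measurable_gauss (e : R) : measurable_fun setT (@gauss R n e).
Proof. by apply: continuous_measurable_rV; exact: continuous_gauss. Qed.

Lemma gauss_ge0 (e : R) x : 0 <= @gauss R n e x.
Proof. exact: expR_ge0. Qed.

Lemma gauss_le1 (e : R) x : 0 <= e -> @gauss R n e x <= 1.
Proof.
by move=> e0; rewrite expR_le1 oppr_le0 mulr_ge0 ?dotp_ge0 // divr_ge0.
Qed.

Lemma integrable_gauss (e : R) : 0 < e -> L1 (@gauss R n e).
Proof. by move=> e0; apply: L1_tame; exact: trapid_gauss. Qed.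

(* The Gaussian approximate identity, of total mass (2 pi)^n. *)
Definition heat (e : R) : V -> R := cosT (gauss e).

Lemma heatE (e : R) : 0 < e ->
  heat e = fun x => Num.sqrt (2 * pi / e) ^+ n * gauss e^-1 x.
Proof. by move=> e0; apply/funext => x; rewrite /heat cosT_gauss. Qed.

Lemma heat_ge0 (e : R) x : 0 < e -> 0 <= heat e x.
Proof.
by move=> e0; rewrite heatE // mulr_ge0 ?gauss_ge0 // exprn_ge0 // sqrtr_ge0.
Qed.

Lemma integrable_heat (e : R) : 0 < e -> L1 (heat e).
Proof.
by move=> e0; rewrite heatE //; apply: integrable_scal; apply: integrable_gauss; rewrite invr_gt0.
Qed.

Lemma integral_heat (e : R) : 0 < e -> \int[mu]_x heat e x = (2 * pi) ^+ n.
Proof.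
move=> e0; have ei0 : 0 < e^-1 by rewrite invr_gt0.
have p0 : 0 <= 2 * pi :> R by rewrite mulr_ge0 // pi_ge0.
rewrite heatE // RintegralZl //; last exact: integrable_gauss.
rewrite integral_gaussR // -exprMn -sqrtrM ?divr_ge0 ?(ltW e0) //.
rewrite invrK (_ : _ / e * (_ * e) = (2 * pi) ^+ 2); last by field; exact: lt0r_neq0.
by rewrite sqrtr_sqr ger0_norm.
Qed.

(** The Gaussian makes the double integral absolutely convergent although [u] is merely integrable;
    exchanging the integrals gives the convolution of [u] with [heat e]. *)
Lemma shiftT_gauss u w (e : R) : 0 < e -> L1 u ->
  [/\ L1 (fun xi => shiftT u w xi * gauss e xi),
      L1 (fun v => u v * heat e (w - v)) &
  \int[mu]_xi (shiftT u w xi * gauss e xi) = \int[mu]_v (u v * heat e (w - v))].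
Proof.
move=> e0 ui; have gi := integrable_gauss e0.
pose F (p : V * V) := cos (dotp (w - p.2) p.1) * u p.2 * gauss e p.1.
have mF : measurable_fun setT F.
  apply: measurable_funM; last first.
    by apply: (measurableT_comp (@measurable_gauss e)); exact: measurable_fst.
  apply: measurable_funM; last first.
    by apply: (measurableT_comp (integrable_meas ui)); exact: measurable_snd.
  apply: measurable_cosf; apply: measurable_dotp; last exact: measurable_fst.
  by apply: measurable_sub_rV; [exact: measurable_cst|exact: measurable_snd].
have [|_ I1 _ E] := Rfubini_dom mF gi ui.
  move=> x y; rewrite /F /= !normrM -mulrA [leRHS]mulrC.
  by apply: ler_piMl; [apply: mulr_ge0; exact: normr_ge0|exact: normr_cos_le1].
have E1 xi : \int[mu]_y F (xi, y) = shiftT u w xi * gauss e xi.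
  have ci : L1 (fun v => cos (dotp (w - v) xi) * u v).
    apply: (integrable_mulb (K := 1)); [exact: ui| |by move=> y; exact: normr_cos_le1].
    apply: measurable_cosf; apply: measurable_dotp; last exact: measurable_cst.
    by apply: measurable_sub_rV; [exact: measurable_cst|exact: measurable_id].
  rewrite (shiftTE _ _ ui); exact: (RintegralZr (gauss e xi) measurableT ci).
have E2 v : \int[mu]_x F (x, v) = u v * heat e (w - v).
  rewrite /heat /cosT -RintegralZl; [|exact: measurableT|exact: integrable_cos].
  by apply: eq_Rintegral => x _; rewrite /F /=; ring.
split.
- by move: I1; congr (_.-integrable _ _); apply/funext => x /=; rewrite E1.
(* [Rfubini_dom] yields integrability of the iterated integral in the first variable only; the
   second comes from swapping the variables. *)
- have mF' : measurable_fun setT (fun p : V * V => F (p.2, p.1)).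
    apply: (measurableT_comp mF).
    by apply: measurable_fun_pair; [exact: measurable_snd|exact: measurable_fst].
  have [|_ I2 _ _] := Rfubini_dom mF' ui gi.
    move=> x y; rewrite /F /= !normrM -mulrA.
    by apply: ler_piMl; [apply: mulr_ge0; exact: normr_ge0|exact: normr_cos_le1].
  by move: I2; congr (_.-integrable _ _); apply/funext => x /=; rewrite -E2.
- transitivity (\int[mu]_xi \int[mu]_v F (xi, v)).
    by apply: eq_Rintegral => x _; rewrite E1.
  by rewrite E; apply: eq_Rintegral => x _; rewrite E2.
Qed.

Lemma integrable_shiftT phi w : tame rapid phi -> L1 (shiftT phi w).
Proof.
move=> tp; have [tc ts] := tame_transforms tp; apply: integrable_add.
  by apply: integrable_cos; exact: L1_tame.
by apply: integrable_sin; exact: L1_tame.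
Qed.

Lemma integrable_reflect f w : L1 f -> L1 (fun x => f (w - x)).
Proof.
move=> fi; have N1 : -1 * -1 = 1 :> R by rewrite mulrNN mulr1.
have := integrable_affine_rV w N1 fi; congr (_.-integrable _ _).
by apply/funext => z /=; rewrite scaleN1r addrC.
Qed.

Lemma Rintegral_reflect f w : L1 f -> \int[mu]_x f (w - x) = \int[mu]_x f x.
Proof.
move=> fi; have N1 : -1 * -1 = 1 :> R by rewrite mulrNN mulr1.
rewrite -(Rintegral_affine_rV w N1 fi).
by apply: eq_Rintegral => z _; rewrite scaleN1r addrC.
Qed.

(** The second moment tends to 0 with [e] while the mass is fixed: this is how [heat e] concentrates
    at the origin. *)
Lemma heat_moment (e : R) : 0 < e ->
  L1 (fun z => dotp z z * heat e z) /\
  \int[mu]_z (dotp z z * heat e z) = n%:R * e * (2 * pi) ^+ n.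
Proof.
move=> e0; have ei0 : 0 < e^-1 by rewrite invr_gt0.
have tg := @trapid_gauss R n e^-1 ei0.
pose a := Num.sqrt (2 * pi / e) ^+ n.
have i2 i : L1 (fun x : V => x ord0 i ^+ 2 * gauss e^-1 x).
  have := L1_tame (trapid_mul (trapid_mul tg (@slow_coord R n i)) (@slow_coord R n i)).
  by congr (_.-integrable _ _); apply/funext => x /=; rewrite expr2; congr EFin; ring.
have H (r : seq 'I_n) : L1 (fun x : V => \sum_(i <- r) x ord0 i ^+ 2 * gauss e^-1 x) /\
    \int[mu]_x (\sum_(i <- r) x ord0 i ^+ 2 * gauss e^-1 x) =
    \sum_(i <- r) (e * \int[mu]_x gauss e^-1 x).
  elim: r => [|i r [IH1 IH2]].
    split; first by under eq_fun do rewrite big_nil; exact: L1_tame trapid0.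
    rewrite big_nil; transitivity (\int[mu]_x (0 : R)).
      by apply: eq_Rintegral => y _; rewrite big_nil.
    by rewrite Rintegral_cst // mul0r.
  split; first by under eq_fun do rewrite big_cons; exact: integrable_add.
  have M := gauss_moment i ei0; rewrite invrK in M.
  rewrite big_cons -IH2 -M -(RintegralD measurableT (i2 i) IH1).
  by apply: eq_Rintegral => x _; rewrite big_cons.
have [H1 H2] := H (index_enum _).
have E : (fun z => dotp z z * heat e z) =
    (fun z : V => a * \sum_i z ord0 i ^+ 2 * gauss e^-1 z).
  apply/funext => z; rewrite heatE // mulrCA -/a dotpE; congr (_ * _).
  by rewrite mulr_suml.
split; first by rewrite E; exact: integrable_scal.
rewrite E (RintegralZl a measurableT H1) H2 sumr_const card_ord -(integral_heat e0) heatE //.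
by rewrite (RintegralZl _ measurableT (integrable_gauss ei0)) -mulr_natl -/a; ring.
Qed.

Lemma tame_bounded phi : tame rapid phi -> exists2 M, 0 <= M & forall x, `|phi x| <= M.
Proof.
move=> tp; have [C HC] := tameQ tp 0%N; exists C; last by move=> x; have := HC x; rewrite expr0 mul1r.
by apply: le_trans (HC 0); rewrite expr0 mul1r.
Qed.

(* A modulus of continuity that is integrated by second moments of Gaussians. *)
Lemma tame_modulus phi w (e : R) : tame rapid phi -> 0 < e ->
  exists2 K, 0 <= K & forall z, `|phi (w - z) - phi w| <= e + K * dotp z z.
Proof.
move=> tp e0; have [M M0 HM] := tame_bounded tp.
have FF : Filter (nbhs (w : V)) by exact: nbhs_filter.
have := proj1 (@cvgrPdist_le _ _ _ _ FF _ _) (tame_cont tp (x := w)) _ e0.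
move=> /(@nbhs_ballP R V w)[d /= d0 Hd].
(* Where some coordinate of [z] reaches [d], [dotp z z] is at least [d ^+ 2], and the trivial bound
   [2 * M] is absorbed by this constant. *)
have K0 : 0 <= 2 * M / d ^+ 2 by apply: divr_ge0; [exact: mulr_ge0|exact: sqr_ge0].
exists (2 * M / d ^+ 2) => //.
move=> z; have [/existsP[i Hi]|/existsPn Hz] := boolP [exists i, d <= `|z ord0 i|].
  apply: (@le_trans _ _ (2 * M)).
    by rewrite (le_trans (ler_normB _ _)) // mulr2n mulrDl mul1r lerD.
  rewrite -[leLHS]add0r lerD ?(ltW e0) // mulrAC ler_pdivlMr ?exprn_gt0 //.
  rewrite ler_wpM2l ?mulr_ge0 // (le_trans _ (coord_le_dotp z i)) //.
  by rewrite -[leRHS]real_normK ?num_real // lerXn2r ?nnegrE // ltW.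
rewrite (@le_trans _ _ e) //; last first.
  by rewrite lerDl; apply: mulr_ge0 => //; exact: dotp_ge0.
rewrite distrC; apply: Hd; split=> // i j; rewrite (ord1 i) /ball /= !mxE opprD opprK addNKr.
by rewrite ltNge; exact: Hz.
Qed.

Lemma gauss_harmonic x :
  (fun k : nat => @gauss R n (k.+1%:R^-1) x) @ \oo --> (1 : R).
Proof.
have c : (fun k : nat => - (k.+1%:R^-1 / 2 * dotp x x)) @ \oo --> (0 : R).
  rewrite -oppr0; apply: cvgN; rewrite -(mul0r (dotp x x)).
  apply: cvgM; last exact: cvg_cst.
  by rewrite -(mul0r (2^-1 : R)); apply: cvgM; [exact: cvg_harmonic|exact: cvg_cst].
suff : (fun k : nat => @gauss R n (k.+1%:R^-1) x) @ \oo --> (expR 0 : R) by rewrite expR0.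
by rewrite /gauss; apply: continuous_cvg; [exact: continuous_expR|exact: c].
Qed.

(** Two limits of the Gaussian-regularised integral are compared: dominated convergence gives the
    left-hand side, the approximate identity the right-hand side. *)
Lemma fourier_inversion phi w : tame rapid phi ->
  \int[mu]_xi shiftT phi w xi = (2 * pi) ^+ n * phi w.
Proof.
move=> tp; have pi_ := L1_tame tp; have si := integrable_shiftT w tp.
pose ek (k : nat) : R := k.+1%:R^-1.
have ek0 k : 0 < ek k by rewrite invr_gt0.
have ekc : ek @ \oo --> (0 : R) by exact: cvg_harmonic.
have c1 : (fun k => \int[mu]_xi (shiftT phi w xi * gauss (ek k) xi)) @ \oo -->
    \int[mu]_xi shiftT phi w xi.
  have [] // := @Rdominated _ _ R mu (fun k xi => shiftT phi w xi * gauss (ek k) xi)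
    (shiftT phi w) (fun xi => `|shiftT phi w xi|).
  - move=> k; apply: measurable_funM; [exact: (integrable_meas si)|exact: measurable_gauss].
  - exact: (integrable_meas si).
  - apply: aeW => x; have := cvgM (cvg_cst (shiftT phi w x)) (gauss_harmonic x).
    by rewrite mulr1; exact.
  - exact: (integrable_norm si).
  - apply: aeW => x k; rewrite normrM -[leRHS]mulr1 ler_wpM2l //.
    by rewrite ger0_norm ?gauss_ge0 // gauss_le1 // ltW.
have P0 : 0 <= (2 * pi) ^+ n :> R by rewrite exprn_ge0 // mulr_ge0 // pi_ge0.
have c2 : (fun k => \int[mu]_xi (shiftT phi w xi * gauss (ek k) xi)) @ \oo -->
    (2 * pi) ^+ n * phi w.
  apply/cvgrPdist_le => /= e e0.
  (* Integrated against the mass [(2 * pi) ^+ n], this part of the modulus costs at most [e / 2].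
     The constant [K] obtained from it does not depend on [k], so the second-moment term tends to
     0. *)
  have e1 : 0 < e / (2 * ((2 * pi) ^+ n + 1)).
    by rewrite divr_gt0 // mulr_gt0 // ltr_wpDl.
  have [K K0 HK] := tame_modulus w tp e1.
  have : (fun k => K * n%:R * (2 * pi) ^+ n * ek k) @ \oo --> (0 : R).
    by rewrite -[X in _ --> X](mulr0 (K * n%:R * (2 * pi) ^+ n)); apply: cvgM => //; exact: cvg_cst.
  move/cvgrPdist_le => /(_ (e / 2) (divr_gt0 e0 (ltr0n R 2))) /=.
  apply: filterS => k; rewrite sub0r normrN => Hk.
  have [_ hi ->] := shiftT_gauss w (ek0 k) pi_.
  have [mi mE] := heat_moment (ek0 k).
  have Hi := integrable_heat (ek0 k).
  pose D z := (phi (w - z) - phi w) * heat (ek k) z.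
  have Ai : L1 (fun z => phi (w - z) * heat (ek k) z).
    have := integrable_reflect w hi.
    by congr (_.-integrable _ _); apply/funext => z /=; rewrite subKr.
  have E : \int[mu]_v (phi v * heat (ek k) (w - v)) - (2 * pi) ^+ n * phi w = \int[mu]_z D z.
    have Hpi : L1 (fun z => phi w * heat (ek k) z) by exact: integrable_scal.
    rewrite -(Rintegral_reflect w hi) -(integral_heat (ek0 k)) mulrC.
    rewrite -(RintegralZl (phi w) measurableT Hi).
    rewrite -[LHS](RintegralB measurableT (integrable_reflect w hi) Hpi).
    by apply: eq_Rintegral => z _; rewrite /D subKr mulrBl.
  have Di : L1 D.
    have := integrable_add Ai (integrable_scal (- phi w) Hi).
    by congr (_.-integrable _ _); apply/funext => z /=; rewrite /D; congr EFin; ring.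
  rewrite distrC E; apply: le_trans (le_normr_Rintegral measurableT Di) _.
  set e' := e / _ in e1 HK.
  apply: (@le_trans _ _ (\int[mu]_z (e' * heat (ek k) z + K * (dotp z z * heat (ek k) z)))).
    apply: le_Rintegral => //; first exact: integrable_norm.
      by apply: integrable_add; exact: integrable_scal.
    move=> z _; rewrite normrM (ger0_norm (heat_ge0 _ (ek0 k))) mulrA -mulrDl.
    by rewrite ler_wpM2r ?heat_ge0.
  rewrite RintegralD //; [|exact: integrable_scal..].
  rewrite !RintegralZl // mE integral_heat //.
  rewrite [leRHS](splitr e) lerD //.
    rewrite /e' invfM mulrA mulrAC ler_pdivrMr ?ltr_wpDl //.
    by rewrite ler_wpM2l ?divr_ge0 ?(ltW e0) // lerDl.
  by apply: le_trans Hk; rewrite (le_trans _ (ler_norm _)) // le_eqVlt; apply/orP; left; apply/eqP; ring.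
by apply: (cvg_unique _ c1 c2).
Qed.

End inversion.

(** The integrals of the positive and negative parts are measurable by Tonelli, and so is [fine] of
    their difference, whether or not the sections are integrable. *)
Lemma measurable_Rint d1 d2 (T1 : measurableType d1) (T2 : measurableType d2)
    (R : realType) (m2 : {sigma_finite_measure set T2 -> \bar R}) (F : T1 * T2 -> R) :
  measurable_fun setT F -> measurable_fun setT (fun x => \int[m2]_y F (x, y)).
Proof.
move=> mF; have mE : measurable_fun setT (EFin \o F) by exact/measurable_EFinP.
apply: (measurableT_comp (@fine_measurable R setT measurableT)).
rewrite (_ : (fun x => _) = (fun x => (\int[m2]_y (EFin \o F)^\+ (x, y)) -
    (\int[m2]_y (EFin \o F)^\- (x, y)))%E); last first.
  apply/funext => x; rewrite integralE; congr (_ - _)%E; apply: eq_integral => y _.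
    by rewrite -[fun z => _]/((EFin \o F) \o (pair x)) funepos_comp.
  by rewrite -[fun z => _]/((EFin \o F) \o (pair x)) funeneg_comp.
apply: emeasurable_funB.
  apply: (measurable_fun_fubini_tonelli_F ((EFin \o F)^\+%E)).
    exact: measurable_funepos.
  by move=> p; exact: funepos_ge0.
apply: (measurable_fun_fubini_tonelli_F ((EFin \o F)^\-%E)).
  exact: measurable_funeneg.
by move=> p; exact: funeneg_ge0.
Qed.

Lemma integral_Rintegral d (T : measurableType d) (R : realType)
    (mu : {measure set T -> \bar R}) (f : T -> R) :
  mu.-integrable setT (EFin \o f) -> (\int[mu]_x (f x)%:E = (\int[mu]_x f x)%:E)%E.
Proof.
by move=> fi; rewrite /Rintegral fineK //; exact: (integrable_fin_num measurableT fi).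
Qed.

(** * Bessel's inequality by Gaussian regularisation *)

Section bessel.
Context {R : realType} {n : nat}.
Local Notation V := 'rV[R]_n.
Local Notation mu := (@lebesgue_rV R n).
Local Notation L1 f := ((@lebesgue_rV R n).-integrable setT (EFin \o f)).
Implicit Types (f g u phi : V -> R) (x y v w xi : V).

Lemma measurable_cosT u : measurable_fun setT u -> measurable_fun setT (cosT u).
Proof.
move=> mu_; apply: (@measurable_Rint _ _ _ _ R mu (fun p : V * V => cos (dotp p.1 p.2) * u p.2)).
apply: measurable_funM; last by apply: (measurableT_comp mu_); exact: measurable_snd.
by apply: measurable_cosf; apply: measurable_dotp; [exact: measurable_fst|exact: measurable_snd].
Qed.

Lemma measurable_sinT u : measurable_fun setT u -> measurable_fun setT (sinT u).
Proof.
move=> mu_; apply: (@measurable_Rint _ _ _ _ R mu (fun p : V * V => sin (dotp p.1 p.2) * u p.2)).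
apply: measurable_funM; last by apply: (measurableT_comp mu_); exact: measurable_snd.
by apply: measurable_sinf; apply: measurable_dotp; [exact: measurable_fst|exact: measurable_snd].
Qed.

Lemma normr_cosT u xi : L1 u -> `|cosT u xi| <= \int[mu]_x `|u x|.
Proof.
move=> ui; have ci := integrable_cos xi ui.
apply: le_trans (le_normr_Rintegral measurableT ci) _.
apply: (le_Rintegral measurableT (integrable_norm ci) (integrable_norm ui)) => x _ /=.
by rewrite normrM; apply: ler_piMl; [exact: normr_ge0|exact: normr_cos_le1].
Qed.

Lemma normr_sinT u xi : L1 u -> `|sinT u xi| <= \int[mu]_x `|u x|.
Proof.
move=> ui; have ci := integrable_sin xi ui.
apply: le_trans (le_normr_Rintegral measurableT ci) _.
apply: (le_Rintegral measurableT (integrable_norm ci) (integrable_norm ui)) => x _ /=.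
by rewrite normrM; apply: ler_piMl; [exact: normr_ge0|exact: normr_sin_le1].
Qed.

Lemma integral_heat_sub (e : R) w : 0 < e ->
  (\int[mu]_a (heat e (w - a))%:E = ((2 * pi) ^+ n)%:E)%E.
Proof.
move=> e0; have hi := integrable_heat (n := n) e0.
rewrite (integral_Rintegral (integrable_reflect w hi)).
by rewrite (Rintegral_reflect w hi) integral_heat.
Qed.

Lemma heat_sym (e : R) x : 0 < e -> heat e (- x) = heat e x.
Proof. by move=> e0; rewrite heatE // /gauss dotpNl dotpNr opprK. Qed.

Lemma measurable_heat_sub (e : R) : 0 < e ->
  measurable_fun setT (fun p : V * V => heat e (p.1 - p.2)).
Proof.
move=> e0; apply: (measurableT_comp (integrable_meas (integrable_heat e0))).
by apply: measurable_sub_rV; [exact: measurable_fst|exact: measurable_snd].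
Qed.

(* Schur's test for the convolution with [heat e]. *)
Lemma heat_schur u (e : R) : 0 < e -> L1 u -> L1 (fun x => u x ^+ 2) ->
  (\int[mu]_b `|((\int[mu]_v (u v * heat e (b - v))) * u b)%:E| <=
   ((2 * pi) ^+ n * \int[mu]_x u x ^+ 2)%:E)%E.
Proof.
move=> e0 ui u2i; have mu_ := integrable_meas ui.
pose P b := \int[mu]_v (u v * heat e (b - v)).
have mP : measurable_fun setT P.
  apply: (@measurable_Rint _ _ _ _ R mu (fun p : V * V => u p.2 * heat e (p.1 - p.2))).
  by apply: measurable_funM; [apply: (measurableT_comp mu_); exact: measurable_snd|exact: measurable_heat_sub].
(* The product [|u a| * |u b|] is at most half the sum of the squares; [H] and [H'] carry the two
   halves. The kernel is symmetric, so they have the same integral. *)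
pose H (p : V * V) := (2^-1 * u p.1 ^+ 2 * heat e (p.1 - p.2)).
pose H' (p : V * V) := (2^-1 * u p.2 ^+ 2 * heat e (p.1 - p.2)).
have mH : measurable_fun setT H.
  apply: measurable_funM; last exact: measurable_heat_sub.
  apply: measurable_funM => //; apply: measurable_funX.
  by apply: (measurableT_comp mu_); exact: measurable_fst.
have mH' : measurable_fun setT H'.
  apply: measurable_funM; last exact: measurable_heat_sub.
  apply: measurable_funM => //; apply: measurable_funX.
  by apply: (measurableT_comp mu_); exact: measurable_snd.
have H0 p : 0 <= H p by rewrite mulr_ge0 ?heat_ge0 // mulr_ge0 ?invr_ge0 ?sqr_ge0.
have H0' p : 0 <= H' p by rewrite mulr_ge0 ?heat_ge0 // mulr_ge0 ?invr_ge0 ?sqr_ge0.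
have half w : 0 <= 2^-1 * u w ^+ 2 by rewrite mulr_ge0 ?invr_ge0 ?sqr_ge0.
have mhalf : measurable_fun setT (fun w => (2^-1 * u w ^+ 2)%:E).
  by apply/measurable_EFinP; apply: measurable_funM => //; exact: measurable_funX.
have p0 : 0 <= (2 * pi) ^+ n :> R by rewrite exprn_ge0 // mulr_ge0 // pi_ge0.
have mhs w : measurable_fun setT (fun a : V => (heat e (w - a))%:E).
  apply/measurable_EFinP; exact: (measurableT_comp (measurable_heat_sub e0) (measurable_pair1 w)).
have half_heat w : (\int[mu]_a ((2^-1 * u w ^+ 2)%:E * (heat e (w - a))%:E) =
    (2^-1 * u w ^+ 2)%:E * ((2 * pi) ^+ n)%:E)%E.
  rewrite (ge0_integralZl _ measurableT (mhs w)) ?lee_fin //.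
    by rewrite integral_heat_sub.
  by move=> a _; rewrite lee_fin heat_ge0.
have total : (\int[mu]_b ((2^-1 * u b ^+ 2)%:E * ((2 * pi) ^+ n)%:E) =
    (2^-1 * ((2 * pi) ^+ n * \int[mu]_x u x ^+ 2))%:E)%E.
  rewrite (ge0_integralZr _ measurableT mhalf) ?lee_fin //; last by move=> b _; rewrite lee_fin.
  rewrite (integral_Rintegral (integrable_scal _ u2i)) (RintegralZl _ measurableT u2i) -EFinM.
  by congr EFin; ring.
apply: (@le_trans _ _ (\int[mu]_b \int[mu]_a (H (b, a) + H' (b, a))%:E)%E).
  apply: ge0_le_integral => //.
  - by apply: measurableT_comp => //; apply/measurable_EFinP; exact: measurable_funM.
  - apply: (measurable_fun_fubini_tonelli_F (fun p : V * V => (H p + H' p)%:E)).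
      by apply/measurable_EFinP; exact: measurable_funD.
    by move=> p; rewrite lee_fin addr_ge0.
  - move=> b _; have [_ I2 _] := shiftT_gauss b e0 ui.
    have I3 := integrable_scal `|u b| (integrable_norm I2).
    apply: (@le_trans _ _ (\int[mu]_a (`|u b| * `|u a * heat e (b - a)|)%:E)%E).
      rewrite (integral_Rintegral I3) (RintegralZl _ measurableT (integrable_norm I2)).
      rewrite abse_EFin lee_fin normrM mulrC ler_wpM2l //.
      exact: le_normr_Rintegral.
    apply: ge0_le_integral => //.
    + by have /integrableP[] := I3.
    + apply/measurable_EFinP.
      exact: (measurableT_comp (measurable_funD mH mH') (measurable_pair1 b)).
    + move=> a _; rewrite lee_fin /H /H' /= normrM (ger0_norm (heat_ge0 _ e0)) mulrA -mulrDl.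
      rewrite ler_wpM2r ?heat_ge0 // -[u b ^+ 2]real_normK ?num_real //.
      rewrite -[u a ^+ 2]real_normK ?num_real //.
      by have := sqr_ge0 (`|u b| - `|u a|); nra.
have mF1 (G : V * V -> R) : measurable_fun setT G -> (forall p : V * V, 0 <= G p) ->
    measurable_fun setT (fun b => (\int[mu]_a (G (b, a))%:E)%E).
  move=> mG G0; apply: (measurable_fun_fubini_tonelli_F (fun p : V * V => (G p)%:E)).
    exact/measurable_EFinP.
  by move=> p; rewrite lee_fin.
have mG1 (G : V * V -> R) b : measurable_fun setT G -> measurable_fun setT (fun a : V => (G (b : V, a))%:E).
  move=> mG; apply/measurable_EFinP; exact: (measurableT_comp mG (measurable_pair1 b)).
have IH : (\int[mu]_b \int[mu]_a (H (b, a))%:E =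
    (2^-1 * ((2 * pi) ^+ n * \int[mu]_x u x ^+ 2))%:E)%E.
  rewrite -total; apply: eq_integral => b _; rewrite -half_heat.
  by apply: eq_integral => a _; rewrite -EFinM.
have IH' : (\int[mu]_b \int[mu]_a (H' (b, a))%:E =
    (2^-1 * ((2 * pi) ^+ n * \int[mu]_x u x ^+ 2))%:E)%E.
  rewrite -IH (fubini_tonelli (m1 := mu) (m2 := mu) (fun p : V * V => (H' p)%:E)).
  - apply: eq_integral => b _; apply: eq_integral => a _.
    by rewrite /H /H' /= -[a - b]opprB heat_sym.
  - exact/measurable_EFinP.
  - by move=> p; rewrite lee_fin.
apply: (@le_trans _ _ (\int[mu]_b (\int[mu]_a (H (b, a))%:E + \int[mu]_a (H' (b, a))%:E))%E).
  rewrite le_eqVlt; apply/orP; left; apply/eqP; apply: eq_integral => b _.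
  apply: (ge0_integralD mu measurableT (f1 := fun a => (H (b, a))%:E)
    (f2 := fun a => (H' (b, a))%:E)).
  - by move=> a _; rewrite lee_fin.
  - exact: mG1.
  - by move=> a _; rewrite lee_fin.
  - exact: mG1.
rewrite ge0_integralD //; [| |exact: mF1| |exact: mF1].
- rewrite [X in (X + _)%E]IH [X in (_ + X)%E]IH' -EFinD lee_fin -mulrDl.
  by rewrite (_ : 2^-1 + 2^-1 = 1 :> R) ?mul1r //; lra.
- by move=> b _; apply: integral_ge0 => a _; rewrite lee_fin.
- by move=> b _; apply: integral_ge0 => a _; rewrite lee_fin.
Qed.

(** Expanding one factor of the squared transform gives a double integral of [F]. In the other
    order, the inner integral is the convolution with [heat e] times [u], to which [heat_schur]
    applies. *)
Lemma bessel_gauss u (e : R) : 0 < e -> L1 u -> L1 (fun x => u x ^+ 2) ->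
  (\int[mu]_xi ((cosT u xi ^+ 2 + sinT u xi ^+ 2) * gauss e xi)%:E <=
   ((2 * pi) ^+ n * \int[mu]_x u x ^+ 2)%:E)%E.
Proof.
move=> e0 ui u2i; have mu_ := integrable_meas ui.
pose M := \int[mu]_x `|u x|.
have M0 : 0 <= M by apply: Rintegral_ge0 => x _; exact: normr_ge0.
pose F (p : V * V) := shiftT u p.2 p.1 * gauss e p.1 * u p.2.
have mF : measurable_fun setT F.
  apply: measurable_funM; last by apply: (measurableT_comp mu_); exact: measurable_snd.
  apply: measurable_funM; last by apply: (measurableT_comp (@measurable_gauss R n e)); exact: measurable_fst.
  have md : measurable_fun setT (fun p : V * V => dotp p.2 p.1).
    by apply: measurable_dotp; [exact: measurable_snd|exact: measurable_fst].
  apply: measurable_funD; apply: measurable_funM.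
  - exact: measurable_cosf.
  - by apply: (measurableT_comp (measurable_cosT mu_)); exact: measurable_fst.
  - exact: measurable_sinf.
  - by apply: (measurableT_comp (measurable_sinT mu_)); exact: measurable_fst.
have g2i : L1 (fun xi => (2 * M) * gauss e xi).
  exact: integrable_scal (integrable_gauss e0).
have [|I0 I1 _ E] := Rfubini_dom mF g2i ui.
  move=> xi b; rewrite /F /= !normrM ler_wpM2r // ler_wpM2r //.
  rewrite (ger0_norm M0) normr_nat mulr2n mulrDl mul1r.
  apply: (le_trans (ler_normD _ _)); rewrite !normrM lerD //.
    apply: le_trans (normr_cosT xi ui).
    by apply: ler_piMl; [exact: normr_ge0|exact: normr_cos_le1].
  apply: le_trans (normr_sinT xi ui).
  by apply: ler_piMl; [exact: normr_ge0|exact: normr_sin_le1].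
have mF' : measurable_fun setT (fun p : V * V => F (p.2, p.1)).
  apply: (measurableT_comp mF).
  by apply: measurable_fun_pair; [exact: measurable_snd|exact: measurable_fst].
have E1 xi : \int[mu]_b F (xi, b) = (cosT u xi ^+ 2 + sinT u xi ^+ 2) * gauss e xi.
  transitivity (\int[mu]_b (gauss e xi * cosT u xi * (cos (dotp xi b) * u b) +
      gauss e xi * sinT u xi * (sin (dotp xi b) * u b))).
    by apply: eq_Rintegral => b _; rewrite /F /shiftT /= (dotpC b); ring.
  rewrite (RintegralD measurableT (integrable_scal _ (integrable_cos xi ui))
    (integrable_scal _ (integrable_sin xi ui))).
  rewrite (RintegralZl _ measurableT (integrable_cos xi ui)).
  rewrite (RintegralZl _ measurableT (integrable_sin xi ui)).
  rewrite -/(cosT u xi) -/(sinT u xi); ring.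
pose P b := \int[mu]_v (u v * heat e (b - v)).
have E2 b : \int[mu]_xi F (xi, b) = P b * u b.
  have [i1 _ E'] := shiftT_gauss b e0 ui.
  by rewrite /P -E' -(RintegralZr (u b) measurableT i1).
have mP : measurable_fun setT P.
  apply: (@measurable_Rint _ _ _ _ R mu (fun p : V * V => u p.2 * heat e (p.1 - p.2))).
  by apply: measurable_funM; [apply: (measurableT_comp mu_); exact: measurable_snd|exact: measurable_heat_sub].
have -> : (\int[mu]_xi ((cosT u xi ^+ 2 + sinT u xi ^+ 2) * gauss e xi)%:E =
    (\int[mu]_b (P b * u b))%:E)%E.
  transitivity ((\int[mu]_xi \int[mu]_b F (xi, b))%:E).
    rewrite -(integral_Rintegral I1); apply: eq_integral => xi _; by rewrite E1.
  by rewrite E; congr EFin; apply: eq_Rintegral => b _; rewrite E2.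
apply: (le_trans _ (heat_schur e0 ui u2i)).
rewrite {1}/Rintegral.
have := le_abse_integral mu measurableT
   (proj2 (measurable_EFinP _ _) (measurable_funM mP mu_)).
move=> /(le_trans _); apply.
(* If the integral were infinite, [fine] would give 0 and the bound would still hold. *)
have [fin|] := boolP ((\int[mu]_b (P b * u b)%:E)%E \is a fin_num).
  by rewrite fineK // lee_abs.
by rewrite fin_numEn => /orP[|] /eqP ->; exact: abse_ge0.
Qed.

(** The bound of [bessel_gauss] does not involve [e], and the Gaussians increase to 1 as [e]
    decreases to 0, so monotone convergence removes them. *)
Lemma bessel u : L1 u -> L1 (fun x => u x ^+ 2) ->
  (\int[mu]_xi (cosT u xi ^+ 2 + sinT u xi ^+ 2)%:E <=
   ((2 * pi) ^+ n * \int[mu]_x u x ^+ 2)%:E)%E.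
Proof.
move=> ui u2i; have mu_ := integrable_meas ui.
pose ek (k : nat) : R := k.+1%:R^-1.
have ek0 k : 0 < ek k by rewrite invr_gt0.
pose f_ k xi := ((cosT u xi ^+ 2 + sinT u xi ^+ 2) * gauss (ek k) xi)%:E.
have s0 xi : 0 <= cosT u xi ^+ 2 + sinT u xi ^+ 2 by apply: addr_ge0; exact: sqr_ge0.
have H := @cvg_monotone_convergence _ V R mu setT measurableT f_.
have L xi : limn (f_ ^~ xi) = (cosT u xi ^+ 2 + sinT u xi ^+ 2)%:E.
  apply/cvg_lim => //; apply: cvg_EFin; first exact: nearW.
  have := cvgM (cvg_cst (cosT u xi ^+ 2 + sinT u xi ^+ 2)) (gauss_harmonic xi).
  by rewrite mulr1; exact.
have HL : (\int[mu]_xi (cosT u xi ^+ 2 + sinT u xi ^+ 2)%:E =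
    \int[mu]_xi limn (f_ ^~ xi))%E by apply: eq_integral => xi _; rewrite L.
rewrite HL.
have {}H : (\int[mu]_xi f_ k xi @[k \oo] --> \int[mu]_xi limn (f_ ^~ xi))%E.
  apply: H.
  - move=> k; apply/measurable_EFinP; apply: measurable_funM; last exact: measurable_gauss.
    by apply: measurable_funD; apply: measurable_funX;
      [exact: measurable_cosT|exact: measurable_sinT].
  - by move=> k x _; rewrite lee_fin mulr_ge0 ?gauss_ge0.
  - move=> x _ k l kl; rewrite lee_fin ler_wpM2l // /gauss ler_expR lerN2.
    by rewrite ler_wpM2r ?dotp_ge0 // ler_wpM2r // lef_pV2 ?posrE ?ltr0n // ler_nat.
have <- := cvg_lim (@ereal_hausdorff R) H.
apply: lime_le; first by apply/cvg_ex; eexists; exact: H.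
by apply: nearW => k; exact: bessel_gauss.
Qed.

End bessel.

(** * Fast converging sequences in L^2 *)

(** With [q = sqrt s] the increments are at most [q * 2^-k], so all terms stay within [2 * q] of the
    first; squaring gives [4 * s]. *)
Lemma geometric_cauchy (R : realType) (a : nat -> R) (s : R) : 0 <= s ->
  (forall k, 4 ^+ k * (a k.+1 - a k) ^+ 2 <= s) ->
  (forall k, (a k - a 0%N) ^+ 2 <= 4 * s) /\ cvgn a.
Proof.
move=> s0 Hs; pose q := Num.sqrt s.
have q0 : 0 <= q by exact: sqrtr_ge0.
have q2 : q ^+ 2 = s by rewrite sqr_sqrtr.
have p2 k : 0 < 2 ^+ k :> R by rewrite exprn_gt0.
have d k : `|a k.+1 - a k| <= q * 2^-1 ^+ k.
  rewrite exprVn ler_pdivlMr // -ler_sqr ?nnegrE ?mulr_ge0 ?(ltW (p2 k)) //.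
  rewrite q2 exprMn real_normK ?num_real // mulrC -exprM mulnC exprM.
  by rewrite (_ : 2 ^+ 2 = 4 :> R) ?Hs // -natrX.
have b k : `|a k - a 0%N| <= q * (2 - 2 * 2^-1 ^+ k).
  elim: k => [|k IH]; first by rewrite subrr normr0 expr0 mulr1 subrr mulr0.
  have -> : a k.+1 - a 0%N = (a k.+1 - a k) + (a k - a 0%N) by ring.
  apply: (le_trans (ler_normD _ _)); apply: (le_trans (lerD (d k) IH)).
  by rewrite exprS; set w := _ ^+ k; rewrite le_eqVlt; apply/orP; left; apply/eqP; field.
split=> [k|].
  rewrite -real_normK ?num_real // -q2 (_ : 4 * q ^+ 2 = (q * 2) ^+ 2); last by ring.
  rewrite ler_sqr ?nnegrE ?mulr_ge0 // (le_trans (b k)) // ler_wpM2l //.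
  by rewrite gerBl mulr_ge0 // exprn_ge0 // invr_ge0.
have c : cvgn (series (fun k => a k.+1 - a k)).
  apply: normed_cvg; apply: (@series_le_cvg _ _ (geometric q 2^-1)).
  - by move=> k; exact: normr_ge0.
  - by move=> k; rewrite /geometric /= mulr_ge0 // exprn_ge0 // invr_ge0.
  - by move=> k; exact: d.
  - by apply: is_cvg_geometric_series; rewrite ger0_norm ?invr_ge0 //; lra.
have E : a = (fun k => a 0%N + series (fun k => a k.+1 - a k) k).
  by apply/funext => k; rewrite /series /= telescope_sumr // addrC subrK.
by rewrite E; apply: is_cvgD => //; exact: is_cvg_cst.
Qed.

Section L2_limit.
Context d (T : measurableType d) (R : realType) (mu : {measure set T -> \bar R}).
Variables (f_ : nat -> T -> R) (K : R).
Hypothesis mf : forall k, measurable_fun setT (f_ k).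
Hypothesis f0 : mu.-integrable setT (EFin \o (fun x => f_ 0%N x ^+ 2)).
Hypothesis K0 : 0 <= K.
Hypothesis fK : forall k,
  (\int[mu]_x ((f_ k.+1 x - f_ k x) ^+ 2)%:E <= (K / 8 ^+ k)%:E)%E.

(** A limsup is measurable whether or not the sequence converges, and equals the limit where it
    does; [fine] gives 0 at points where it is infinite. *)
Definition seq_limsup x : R := fine (limn_esup (fun k => (f_ k x)%:E)).

Lemma measurable_seq_limsup : measurable_fun setT seq_limsup.
Proof.
apply: (measurableT_comp (@fine_measurable R setT measurableT)).
by apply: (measurable_fun_limn_esup (f := fun k x => (f_ k x)%:E)) => k; exact/measurable_EFinP.
Qed.

(* The weights turn a bound C on the sum of the [h k x] into
   |f_{k+1} x - f_k x| <= 2^-k sqrt C, while the integral of the sum is finite. *)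
Let h k x : \bar R := (4 ^+ k * (f_ k.+1 x - f_ k x) ^+ 2)%:E.

Let h_ge0 k x : (0 <= h k x)%E.
Proof. by rewrite lee_fin; apply: mulr_ge0; [exact: exprn_ge0|exact: sqr_ge0]. Qed.

Let mh k : measurable_fun setT (h k).
Proof.
apply/measurable_EFinP; apply: measurable_funM; first exact: measurable_cst.
by apply: measurable_funX; exact: measurable_funB.
Qed.

Let S x : \bar R := (\sum_(k <oo) h k x)%E.

Let S_ge0 x : (0 <= S x)%E.
Proof. by apply: nneseries_ge0 => k _ _. Qed.

Let iS : mu.-integrable setT S.
Proof.
apply/integrableP; split.
  by apply: (@ge0_emeasurable_sum _ _ _ setT h xpredT).
rewrite (eq_integral S); last by move=> x _; rewrite gee0_abs.
rewrite integral_nneseries //.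
(* The [k]-th integral is at most [4^k * K / 8^k = K / 2^k], and these sum to [2 * K]. *)
apply: (@le_lt_trans _ _ (2 * K)%:E); last exact: ltry.
apply: le_trans (@epsilon_trick0 R (2 * K) xpredT _); last by rewrite mulr_ge0.
apply: lee_nneseries => [k _ _|k _]; first exact: integral_ge0.
rewrite /h; under eq_integral do rewrite EFinM.
rewrite ge0_integralZl ?lee_fin ?exprn_ge0 //.
- apply: (le_trans (lee_wpmul2l _ (fK k))); first by rewrite lee_fin exprn_ge0.
  rewrite -EFinM lee_fin le_eqVlt; apply/orP; left; apply/eqP.
  rewrite natrX exprS (_ : 8 = 4 * 2 :> R) ?exprMn; last by rewrite -natrM.
  have := exprn_gt0 k (ltr0n R 4) => p4; have := exprn_gt0 k (ltr0n R 2) => p2.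
  by field; rewrite !gt_eqF.
- by apply/measurable_EFinP; apply: measurable_funX; exact: measurable_funB.
- by move=> x _; rewrite lee_fin sqr_ge0.
Qed.

Let pointwise : {ae mu, forall x, [/\ (f_ ^~ x) @ \oo --> seq_limsup x &
  forall k, (f_ k x - f_ 0%N x) ^+ 2 <= 4 * fine (S x)]}.
Proof.
have := integrable_ae measurableT iS; apply: filterS => x /(_ I) fin.
have [|k|b c] := @geometric_cauchy R (f_ ^~ x) (fine (S x)).
- exact: fine_ge0.
- rewrite -lee_fin fineK //; apply: (@le_trans _ _ (\sum_(0 <= i < k.+1) h i x)%E).
    by rewrite big_nat_recr //= leeDr // sume_ge0.
  by apply: nneseries_lim_ge => i _ _.
split=> //; have ce : (fun k => (f_ k x)%:E) @ \oo --> (limn (f_ ^~ x))%:E.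
  by apply: cvg_EFin; [exact: nearW|exact: c].
have [_ E] := cvg_limn_einf_sup ce.
by rewrite /seq_limsup E /=; exact: c.
Qed.

(** Dominates every [f_ k x ^+ 2], by [a^2 <= 2 * b^2 + 2 * (a - b)^2] with [b = f_ 0 x] and
    [(a - b)^2 <= 4 * S]. *)
Let G x : R := 2 * f_ 0%N x ^+ 2 + 8 * fine (S x).

Let iG : mu.-integrable setT (EFin \o G).
Proof.
apply: integrable_add; first exact: integrable_scal.
apply: integrable_scal.
have mS : measurable_fun setT S by have /integrableP[] := iS.
apply: le_integrable iS => //.
  by apply/measurable_EFinP; apply: (measurableT_comp (@fine_measurable R setT measurableT)).
move=> x _; rewrite /comp; have := S_ge0 x; case: (S x) => [r||] //= _.
by rewrite leey.
Qed.

Let GK : {ae mu, forall x, forall k, f_ k x ^+ 2 <= G x}.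
Proof.
apply: filterS pointwise => x [_ H] k; have := H k.
rewrite /G; move: (fine _) (f_ k x) (f_ 0%N x) => s a b; have := sqr_ge0 (a - 2 * b); nra.
Qed.

Lemma seq_limsup_L2 : mu.-integrable setT (EFin \o (fun x => seq_limsup x ^+ 2)).
Proof.
have [] // := @Rdominated _ T R mu (fun k x => f_ k x ^+ 2) (fun x => seq_limsup x ^+ 2) G.
- by move=> k; exact: measurable_funX.
- by apply: measurable_funX; exact: measurable_seq_limsup.
- apply: filterS pointwise => x [H _]; rewrite expr2.
  by under eq_fun do rewrite expr2; exact: cvgM.
- by apply: filterS GK => x H k; rewrite ger0_norm ?sqr_ge0.
Qed.

Lemma seq_limsup_weak (phi : T -> R) : measurable_fun setT phi ->
  mu.-integrable setT (EFin \o (fun x => phi x ^+ 2)) ->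
  (fun k => \int[mu]_x (f_ k x * phi x)) @ \oo --> \int[mu]_x (seq_limsup x * phi x).
Proof.
move=> mphi phi2.
have [] // := @Rdominated _ T R mu (fun k x => f_ k x * phi x)
  (fun x => seq_limsup x * phi x) (fun x => G x + phi x ^+ 2).
- by move=> k; exact: measurable_funM.
- by apply: measurable_funM => //; exact: measurable_seq_limsup.
- by apply: filterS pointwise => x [H _]; apply: cvgM => //; exact: cvg_cst.
- exact: integrable_add.
- apply: filterS GK => x H k; rewrite normrM; have := H k.
  rewrite -[f_ k x ^+ 2]real_normK ?num_real // -[phi x ^+ 2]real_normK ?num_real //.
  have := normr_ge0 (f_ k x); have := normr_ge0 (phi x).
  move: (G x) `|f_ k x| `|phi x| => g a b a0 b0 h'; have := sqr_ge0 (a - b); nra.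
Qed.

End L2_limit.

(** * The wave equation driven by the noise kernel *)

Section density.
Import HBNNSimple.

(* The set function on the right is not an instance of [measure], so its
   integral is unfolded to the supremum over simple functions. *)
Lemma integral_density_le d (T : measurableType d) (R : realType)
    (mu : {measure set T -> \bar R}) (f w : T -> R) :
  measurable_fun setT f -> measurable_fun setT w ->
  (forall x, 0 <= f x) -> (forall x, 0 <= w x) ->
  (\int[mu]_x (f x * w x)%:E <=
   \int[fun A => \int[mu]_(x in A) (w x)%:E]_x (f x)%:E)%E.
Proof.
move=> mf mw f0 w0; pose nu A := (\int[mu]_(x in A) (w x)%:E)%E; rewrite -/nu.
have nu0 : nu set0 = 0%E by rewrite /nu integral_set0.
have f0' x : (0 <= (EFin \o f) x)%E by rewrite /= lee_fin.
rewrite [leRHS]/integral /= patch_setT.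
have -> : (fun x => (f x)%:E)^\+%E = EFin \o f.
  by apply/funext => x; rewrite funeposE; apply/max_idPl; rewrite lee_fin.
have -> : (fun x => (f x)%:E)^\-%E = cst 0%E.
  by apply/funext => x; rewrite funenegE; apply/max_idPr; rewrite leeNl oppe0 lee_fin.
(* The negative part of the integrand is 0. The only nonnegative simple functions below it vanish,
   so the supremum is 0 as soon as [nu set0 = 0]. *)
rewrite [X in (_ - X)%E](_ : _ = 0%E); last first.
  rewrite (_ : [set _ | _ in _] = [set 0%E]) ?ereal_sup1//.
  have s0 (k : {nnsfun T >-> R}) : (forall x, (k x)%:E <= 0)%E -> sintegral nu k = 0%E.
    move=> k0; rewrite /sintegral fsbig1// => r _.
    have [->|r0] := eqVneq r 0; first by rewrite mul0e.
    rewrite (_ : _ @^-1` _ = set0) ?nu0 ?mule0// -subset0 => x /= kx.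
    case/eqP: r0; rewrite -kx; apply/eqP; rewrite eq_le -lee_fin k0/=; exact: fun_ge0.
  apply/seteqP; split=> [_ [k /= k0 <-]|_ ->]; first exact: s0.
  exists (@nnsfun0 _ T R); last by apply: s0 => x; rewrite lexx.
  by move=> x; rewrite lexx.
rewrite sube0.
have mf' : measurable_fun setT (EFin \o f) by exact/measurable_EFinP.
pose h := nnsfun_approx measurableT mf'.
have -> : (\int[mu]_x (f x * w x)%:E =
    limn (fun n => \int[mu]_x (h n x * w x)%:E))%E.
  rewrite -monotone_convergence//.
  - apply: eq_integral => x _; apply/esym/cvg_lim => //; rewrite EFinM.
    under eq_fun do rewrite EFinM.
    by apply: cvgeZr => //; apply: (cvg_nnsfun_approx measurableT mf').
  - by move=> n; apply/measurable_EFinP; apply: measurable_funM.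
  - by move=> n x _; rewrite lee_fin mulr_ge0.
  - move=> x _ a b ab; rewrite lee_fin ler_wpM2r//.
    by apply/lefP/(nd_nnsfun_approx measurableT mf').
apply: lime_le.
  apply: ereal_nondecreasing_is_cvgn => a b ab; apply: ge0_le_integral => //.
  - by move=> x _; rewrite lee_fin mulr_ge0.
  - by apply/measurable_EFinP; apply: measurable_funM.
  - by apply/measurable_EFinP; apply: measurable_funM.
  - move=> x _; rewrite lee_fin ler_wpM2r//.
    by apply/lefP/(nd_nnsfun_approx measurableT mf').
(* The integral of [h n * w] is the simple integral of [h n] against [nu], hence one of the
   competitors in the supremum on the right. *)
apply: nearW => n; apply: ereal_sup_ubound; exists (h n) => /=.
  by move=> x; rewrite nnsfun_approxE; exact: (@le_approx _ _ R setT (EFin \o f)).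
rewrite /sintegral -(fsbig_widen (range (h n)) setT)//=; last first.
  by move=> r [_ Nr] /=; rewrite preimage10// nu0 mule0.
transitivity (\int[mu]_x \sum_(y \in range (h n)) (y * \1_(h n @^-1` [set y]) x * w x)%:E)%E; last first.
  apply: eq_integral => x _; rewrite fsumEFin// -mulr_fsuml -fimfunE//.
rewrite ge0_integral_fsum//; last 2 first.
  - move=> r; apply/measurable_EFinP/measurable_funM => //.
    by apply: measurable_funM => //.
  - by move=> r x _; rewrite lee_fin mulr_ge0//; have := nnfun_muleindic_ge0 (h n) r x; rewrite lee_fin.
apply: eq_fsbigr => r; rewrite inE => -[x0 _ hx].
have r0 : 0 <= r by rewrite -hx; exact: fun_ge0.
rewrite /nu; under [RHS]eq_integral => x _ do rewrite -mulrA EFinM.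
rewrite ge0_integralZl//; last 2 first.
  - by apply/measurable_EFinP/measurable_funM.
  - by move=> x _; rewrite lee_fin mulr_ge0.
congr (_ * _)%E; rewrite integral_mkcond; apply: eq_integral => x _.
by rewrite patchE indicE; case: ifPn => _; rewrite ?mul1r ?mul0r.
Qed.
End density.

Lemma normc_sqr (R : realType) (z : R[i]) :
  normc z ^+ 2 = complex.Re z ^+ 2 + complex.Im z ^+ 2.
Proof. by case: z => a b /=; rewrite sqr_sqrtr// addr_ge0 ?sqr_ge0. Qed.

Lemma dalang_integrable (R : realType) n (h : 'rV[R]_n -> R[i]) :
  ctemperate h -> dalang h ->
  (@lebesgue_rV R n).-integrable setT (EFin \o (fun xi =>
    (complex.Re (h xi) ^+ 2 + complex.Im (h xi) ^+ 2) / japan xi)).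
Proof.
move=> [mr mi _] D.
have mj : measurable_fun setT (fun xi : 'rV[R]_n => (japan xi)^-1).
  apply: (@measurable_funTS _ _ _ _ setT).
  apply: continuous_measurable_rV => x; apply: continuousV.
    by rewrite gt_eqF// japan_gt0.
  exact: continuous_japan.
have mw : measurable_fun setT (fun xi => (2 * pi) ^- n *
    (complex.Re (h xi) ^+ 2 + complex.Im (h xi) ^+ 2) : R).
  by apply: measurable_funM => //; apply: measurable_funD;
    apply: measurable_funX.
have c0 : 0 < (2 * pi : R) ^+ n by rewrite exprn_gt0// mulr_gt0// pi_gt0.
have W : (@lebesgue_rV R n).-integrable setT (EFin \o (fun xi => (japan xi)^-1 *
    ((2 * pi) ^- n * (complex.Re (h xi) ^+ 2 + complex.Im (h xi) ^+ 2)))).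
  have p0 xi : 0 <= (japan xi)^-1 *
      ((2 * pi) ^- n * (complex.Re (h xi) ^+ 2 + complex.Im (h xi) ^+ 2)).
    apply: mulr_ge0; first by rewrite invr_ge0 ltW// japan_gt0.
    by apply: mulr_ge0; [rewrite invr_ge0 ltW | apply: addr_ge0; exact: sqr_ge0].
  apply/integrableP; split; first by apply/measurable_EFinP; apply: measurable_funM.
  under eq_integral => x _ do rewrite /= ger0_norm//.
  apply: le_lt_trans D; apply: (le_trans (integral_density_le _ mj mw _ _)).
  - by move=> x; rewrite invr_ge0 ltW// japan_gt0.
  - move=> x; apply: mulr_ge0; first by rewrite invr_ge0 ltW.
    by apply: addr_ge0; exact: sqr_ge0.
  rewrite le_eqVlt; apply/orP; left; apply/eqP; congr integral.
    apply/funext => A; apply: eq_integral => x _.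
    by rewrite -normc_sqr EFinM.
  by apply/funext => x; rewrite enormE.
have := integrable_scal ((2 * pi) ^+ n) W; apply: eq_integrable => // x _ /=.
by rewrite mulrCA mulVKf ?gt_eqF// mulrC.
Qed.

(** * The distributional convolution as a spectral integral *)

Section fourier_parity.
Context {R : realType} {n : nat}.
Local Notation V := 'rV[R]_n.
Local Notation mu := (@lebesgue_rV R n).
Local Notation L1 f := ((@lebesgue_rV R n).-integrable setT (EFin \o f)).
Local Notation iC := (fun a b : R => complex.Complex a b).
Implicit Types (f g u phi M : V -> R) (x y v w xi z : V) (s : R).

Lemma Rintegral_odd f : L1 f -> (forall x, f (- x) = - f x) -> \int[mu]_x f x = 0.
Proof.
move=> fi fN; have := Rintegral_reflect 0 fi.
under eq_Rintegral do rewrite sub0r fN -mulN1r.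
rewrite (RintegralZl (-1) measurableT fi) mulN1r => E; lra.
Qed.

Lemma cosT_odd f xi : L1 f -> (forall x, f (- x) = - f x) -> cosT f xi = 0.
Proof.
move=> fi fN; apply: Rintegral_odd; first exact: integrable_cos.
by move=> x; rewrite dotpNr cosN fN mulrN.
Qed.

Lemma sinT_even f xi : L1 f -> (forall x, f (- x) = f x) -> sinT f xi = 0.
Proof.
move=> fi fN; apply: Rintegral_odd; first exact: integrable_sin.
by move=> x; rewrite dotpNr sinN fN mulNr.
Qed.

Lemma cosTN u xi : cosT u (- xi) = cosT u xi.
Proof. by apply: eq_Rintegral => x _; rewrite dotpNl cosN. Qed.

Lemma sinTN u xi : L1 u -> sinT u (- xi) = - sinT u xi.
Proof.
move=> ui; rewrite -[RHS]mulN1r -sinTZ//.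
by apply: eq_Rintegral => x _; rewrite dotpNl sinN mulNr mulN1r mulrN.
Qed.

Lemma fourierE f g z : L1 f -> L1 g ->
  fourier (fun x => iC (f x) (g x)) z =
  iC (cosT f z + sinT g z) (cosT g z - sinT f z).
Proof.
move=> fi gi; rewrite /fourier /cintegral /cosT /sinT -mulN1r; congr complex.Complex.
  rewrite -RintegralD//; [|exact: integrable_cos|exact: integrable_sin].
  by apply: eq_Rintegral => x _ /=; rewrite dotpC cosN sinN mulNr opprK.
rewrite -(RintegralZl (-1) measurableT (integrable_sin z fi)).
rewrite -RintegralD//; [|exact: integrable_cos|exact/integrable_scal/integrable_sin].
by apply: eq_Rintegral => x _ /=; rewrite dotpC cosN sinN mulNr mulN1r.
Qed.

Definition shiftS u w xi : R := sin (dotp w xi) * cosT u xi - cos (dotp w xi) * sinT u xi.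

Lemma shiftTN u w xi : L1 u -> shiftT u w (- xi) = shiftT u w xi.
Proof.
by move=> ui; rewrite /shiftT dotpNr cosN sinN cosTN sinTN// mulrNN.
Qed.

Lemma shiftSN u w xi : L1 u -> shiftS u w (- xi) = - shiftS u w xi.
Proof.
by move=> ui; rewrite /shiftS dotpNr cosN sinN cosTN sinTN// mulrN opprK mulNr opprB addrC.
Qed.

Lemma tame_shift u w : tame rapid u ->
  tame rapid (shiftT u w) /\ tame rapid (shiftS u w).
Proof.
move=> tu; have [tc ts] := tame_transforms tu; have [sc ss] := tslow_trig w.
have E f g : tame rapid f -> tame slow g -> tame rapid (fun x => g x * f x).
  by move=> tf tg; under eq_fun do rewrite mulrC; exact: trapid_mul.
split; first by apply: trapid_add; exact: E.
rewrite (_ : shiftS u w = fun x => sin (dotp w x) * cosT u x +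
   -1 * (cos (dotp w x) * sinT u x)); last by apply/funext => x; rewrite mulN1r.
by apply: trapid_add; [|apply: trapid_scal]; exact: E.
Qed.

Lemma tame_mult_shift M u w : tame slow M -> tame rapid u ->
  tame rapid (fun x => M x * shiftT u w x) /\ tame rapid (fun x => M x * shiftS u w x).
Proof.
move=> tM /(tame_shift w)[t1 t2].
by split; under eq_fun do rewrite mulrC; exact: trapid_mul.
Qed.

(* s = 1 is used to represent z |-> phi (w - z) as a Fourier transform,
   s = -1 to represent z |-> wave_trace r phi (w + z). *)
Lemma modulated_shift M u w z s : s = 1 \/ s = -1 -> tame slow M -> tame rapid u ->
  cosT (fun x => M x * shiftT u w x) z + sinT (fun x => s * (M x * shiftS u w x)) z =
  \int[mu]_x (M x * shiftT u (w - s *: z) x).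
Proof.
move=> s1 tM tu; have [t1 t2] := tame_mult_shift w tM tu.
rewrite /cosT /sinT -RintegralD//; last 2 first.
- by apply: integrable_cos; exact: L1_tame.
- by apply: integrable_sin; apply: integrable_scal; exact: L1_tame.
apply: eq_Rintegral => x _; rewrite /shiftT /shiftS dotpDl dotpNl dotpZl.
by case: s1 => ->; rewrite ?mul1r ?mulN1r ?opprK ?cosB ?sinB ?cosD ?sinD; ring.
Qed.

(** Since [M] is even, the real component is even and the imaginary one odd, so the sine transform
    of the former and the cosine transform of the latter vanish; the result is real. *)
Lemma fourier_modulated M u w z s : s = 1 \/ s = -1 -> tame slow M ->
  (forall x, M (- x) = M x) -> tame rapid u ->
  fourier (fun x => iC (M x * shiftT u w x) (s * (M x * shiftS u w x))) z =
  iC (\int[mu]_x (M x * shiftT u (w - s *: z) x)) 0.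
Proof.
move=> s1 tM Me tu; have [t1 t2] := tame_mult_shift w tM tu.
have [i1 i2] := (L1_tame t1, L1_tame t2); have ui := L1_tame tu.
rewrite fourierE//; last exact: integrable_scal.
rewrite modulated_shift// cosT_odd ?sinT_even ?subrr//.
- by move=> x; rewrite Me shiftTN.
- exact: integrable_scal.
- by move=> x; rewrite Me shiftSN// !mulrN.
Qed.

(** The origin lies in the hyperplane where the first coordinate is 0, which is null by integrating
    along that coordinate. In dimension 0 the measure is a Dirac mass at the origin. *)
Lemma ae_neq0 : (0 < n)%N -> {ae mu, forall x, x != 0}.
Proof.
case: n => // m _.
pose A := [set x : 'rV[R]_m.+1 | x ord0 ord0 = 0].
have mA : measurable A.
  by rewrite -[A]setTI; apply: (measurable_coord ord0 measurableT (measurable_set1 0)).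
exists A; split=> //; last first.
  by move=> x /= /negP; rewrite negbK => /eqP ->; rewrite /A /= mxE.
rewrite -(setIT A) -integral_indic// ge0_integral_rVS//; last first.
  by apply/measurable_EFinP; exact: measurable_indic.
rewrite [X in integral _ _ X](_ : _ = (fun=> \int[lebesgue_rV]_(v in [set: 'rV[R]_m]) 1%E)%E \_ [set 0%R]); last first.
  apply/funext => t; rewrite patchE; case: ifPn => [|/negP]; rewrite inE /= => t0.
    apply: eq_integral => v _; rewrite indicE mem_set//.
    by rewrite /A /= mxE unlift_none.
  apply: integral0_eq => v _; rewrite indicE memNset//.
  by rewrite /A /= mxE unlift_none.
rewrite -integral_mkcond integral_cst//.
by rewrite /= lebesgue_measure_set1 mule0.
Qed.

Lemma measurable_wave_mult r : measurable_fun setT (@wave_mult R n r).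
Proof. by apply: continuous_measurable_rV; exact: tame_cont (tslow_wave_mult r). Qed.

Lemma measurable_enorm : measurable_fun setT (@enorm R n).
Proof.
apply: (measurableT_comp (continuous_measurable_fun (@sqrt_continuous R))).
by apply: measurable_dotp; exact: measurable_id.
Qed.

Lemma integral_sin_enorm (f : V -> R) r : (0 < n)%N -> measurable_fun setT f ->
  \int[mu]_x (sin (r * enorm x) / enorm x * f x) = \int[mu]_x (wave_mult r x * f x).
Proof.
move=> n0 mf; congr fine; apply: ae_eq_integral => //.
- apply/measurable_EFinP; apply: measurable_funM => //; apply: measurable_funM.
    by apply: measurable_sinf; apply: measurable_funM => //; exact: measurable_enorm.
  rewrite (_ : (fun x => _) = fun x : V => enorm x `^ (-1)); last first.
    by apply/funext => x; rewrite powR_inv1// sqrtr_ge0.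
  exact: (measurableT_comp (measurable_powR _) measurable_enorm).
- by apply/measurable_EFinP; apply: measurable_funM => //; exact: measurable_wave_mult.
- by apply: filterS (ae_neq0 n0) => x x0 _; rewrite wave_multE.
Qed.

Definition inv_const : R := (2 * pi) ^- n.

(** For real [phi], the value at [w] of the convolution of the fundamental solution with [phi]. *)
Definition wave_trace r phi w : R :=
  \int[mu]_x (inv_const * wave_mult r x * shiftT phi w x).

Lemma wave_apply r T (phi : V -> R[i]) w : (0 < n)%N -> wave_fundamental_solution r T ->
  schwartz phi ->
  T (fun z => phi (w - z)) = iC (wave_trace r (fun x => complex.Re (phi x)) w)
                                (wave_trace r (fun x => complex.Im (phi x)) w).
Proof.
move=> n0 [_ _ FT] /schwartzP[]; set p := fun x => complex.Re _; set q := fun x => complex.Im _.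
move=> tp tq; have [pi_ qi] := (L1_tame tp, L1_tame tq).
have tc : tame slow (fun _ : V => inv_const) by exact: tslow_cst.
have [a1 b1] := tame_mult_shift w tc tp; have [a2 b2] := tame_mult_shift w tc tq.
have tb2 := trapid_scal (-1) b2.
have [[[La1 Lb1] La2] Lb2] := (L1_tame a1, L1_tame b1, L1_tame a2, L1_tame b2).
have Lb2' := L1_tame tb2.
(* [A + i B] is [inv_const] times [(shiftT p + i shiftS p) + i (shiftT q + i shiftS q)]. Writing the
   test function as its Fourier transform is necessary because [T] is known only through
   [fourier_dist T]. *)
pose A x := inv_const * shiftT p w x + -1 * (inv_const * shiftS q w x).
pose B x := inv_const * shiftS p w x + inv_const * shiftT q w x.
have tA : tame rapid A by exact: trapid_add.
have tB : tame rapid B by exact: trapid_add.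
have inv f z : tame rapid f -> \int[mu]_x (inv_const * shiftT f z x) = f z.
  move=> tf; rewrite (RintegralZl inv_const measurableT (integrable_shiftT z tf)).
  by rewrite fourier_inversion// mulKf// gt_eqF// exprn_gt0// mulr_gt0// pi_gt0.
have odd1 z : cosT (fun x => inv_const * shiftS p w x) z = 0.
  by apply: cosT_odd => // x; rewrite shiftSN// mulrN.
have odd2 z : cosT (fun x => -1 * (inv_const * shiftS q w x)) z = 0.
  by rewrite cosTZ// cosT_odd ?mulr0// => x; rewrite shiftSN// mulrN.
have Es f z : tame rapid f -> cosT (fun x => inv_const * shiftT f w x) z +
    sinT (fun x => inv_const * shiftS f w x) z = f (w - z).
  move=> tf; have := modulated_shift w z (or_introl erefl) tc tf.
  rewrite inv// scale1r => <-; congr (_ + _).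
  by apply: eq_Rintegral => x _; rewrite mul1r.
have -> : (fun z => phi (w - z)) = fourier (fun x => iC (A x) (B x)).
  apply/funext => z; rewrite fourierE; [|exact: L1_tame|exact: L1_tame].
  rewrite /A /B !cosTD// !sinTD// odd1 odd2 (sinTZ (-1) z Lb2).
  rewrite (@sinT_even (fun x => _ * shiftT p w x))//; last by move=> x; rewrite shiftTN.
  rewrite (@sinT_even (fun x => _ * shiftT q w x))//; last by move=> x; rewrite shiftTN.
  rewrite !addr0 !add0r mulN1r opprK !Es// /p /q.
  by case: (phi _).
rewrite -[LHS]/(fourier_dist T (fun x => iC (A x) (B x))) FT; last by apply/schwartzP; split.
have LM f : tame rapid f -> L1 (fun x => wave_mult r x * f x).
  move=> tf; apply: L1_tame; under eq_fun do rewrite mulrC.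
  by apply: trapid_mul => //; exact: tslow_wave_mult.
have even f : \int[mu]_x (wave_mult r x * (inv_const * shiftT f w x)) = wave_trace r f w.
  by apply: eq_Rintegral => x _; rewrite mulrCA mulrA.
have odd s f : L1 f -> L1 (fun x => wave_mult r x * (s * (inv_const * shiftS f w x))) ->
    \int[mu]_x (wave_mult r x * (s * (inv_const * shiftS f w x))) = 0.
  move=> Lf Lw; apply: Rintegral_odd => // x.
  by rewrite /wave_mult dotpNl dotpNr opprK shiftSN// !mulrN.
rewrite /dist_of_rfun /dist_of_cfun /cintegral /=; congr complex.Complex.
  under eq_Rintegral do rewrite mul0r subr0.
  rewrite integral_sin_enorm//; last exact: integrable_meas (L1_tame tA).
  under eq_Rintegral do rewrite mulrDr.
  by rewrite (RintegralD measurableT (LM _ a1) (LM _ tb2)) even odd ?addr0//; exact: LM tb2.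
under eq_Rintegral do rewrite mul0r addr0.
rewrite integral_sin_enorm//; last exact: integrable_meas (L1_tame tB).
under eq_Rintegral do rewrite mulrDr.
rewrite (RintegralD measurableT (LM _ b1) (LM _ a2)) even.
under eq_Rintegral do rewrite -[X in _ * X]mul1r.
by rewrite odd ?add0r//; apply: LM; under eq_fun do rewrite mul1r.
Qed.

Definition noise_trace (h : V -> R[i]) r phi w : R :=
  \int[mu]_x (inv_const * wave_mult r x *
    (complex.Re (h x) * shiftT phi w x + complex.Im (h x) * shiftS phi w x)).

Lemma noise_traceE kappa h r phi w : noise_kernel kappa h -> tame rapid phi ->
  \int[mu]_y (fine (kappa y) * wave_trace r phi (w + y)) = noise_trace h r phi w.
Proof.
move=> hk tp.
pose M x := inv_const * @wave_mult R n r x.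
have tM : tame slow M by apply: tslow_mul; [exact: tslow_cst|exact: tslow_wave_mult].
have Me x : M (- x) = M x by rewrite /M /wave_mult dotpNl dotpNr opprK.
have [t1 t2] := tame_mult_shift w tM tp.
(* The factor [-1] makes the Fourier transform of [th] at [y] the trace at [w + y] instead of
   [w - y]. This transform is real, so the real part of the identity for [h] is the one to read
   off. *)
pose th x := iC (M x * shiftT phi w x) (-1 * (M x * shiftS phi w x)).
have sth : schwartz th by apply/schwartzP; split=> //; exact: trapid_scal.
have /(congr1 (fun z : R[i] => complex.Re z)) := nk_fourier hk sth.
rewrite /fourier_dist /dist_of_efun /dist_of_rfun /dist_of_cfun /= => E.
transitivity (\int[mu]_x complex.Re ((fine (kappa x))%:C%C * fourier th x)).
  apply: eq_Rintegral => y _.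
  rewrite (fourier_modulated w y (or_intror erefl) tM Me tp) /= mulr0 subr0.
  by rewrite scaleN1r opprK.
rewrite E; apply: eq_Rintegral => x _.
by rewrite /th /M; case: (h x) => a b /=; ring.
Qed.

Lemma conv_wave kappa h r T (phi : V -> R[i]) w : (0 < n)%N ->
  noise_kernel kappa h -> wave_fundamental_solution r T -> schwartz phi ->
  conv_dist (reflect_translate w T) (dist_of_efun kappa) phi =
  iC (noise_trace h r (fun x => complex.Re (phi x)) w)
     (noise_trace h r (fun x => complex.Im (phi x)) w).
Proof.
move=> n0 hk WT sp; have [tp tq] := proj1 (schwartzP _) sp.
rewrite /conv_dist /reflect_translate.
rewrite (_ : (fun y => T _) = fun y => iC
    (wave_trace r (fun x => complex.Re (phi x)) (w + y))
    (wave_trace r (fun x => complex.Im (phi x)) (w + y))); last first.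
  apply/funext => y; rewrite -(wave_apply _ n0 WT sp).
  by congr T; apply/funext => z; rewrite addrAC.
rewrite /dist_of_efun /dist_of_rfun /dist_of_cfun /cintegral /=.
congr complex.Complex; rewrite -(noise_traceE _ _ hk)//; apply: eq_Rintegral => y _.
  by rewrite mul0r subr0.
by rewrite mul0r addr0.
Qed.

End fourier_parity.

(** * Inverse transforms of integrable spectral functions *)

Section pair_transform.
Context {R : realType} {n : nat}.
Local Notation V := 'rV[R]_n.
Local Notation mu := (@lebesgue_rV R n).
Local Notation L1 f := ((@lebesgue_rV R n).-integrable setT (EFin \o f)).
Implicit Types (f g u phi : V -> R) (x y v w xi z : V).

Local Notation cn := (@inv_const R n).
(** The real part of the inverse Fourier transform of [u1 + i u2] at [v - w]. *)
Definition pairT u1 u2 w v : R := cn * (cosT u1 (w - v) + sinT u2 (w - v)).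

Lemma measurable_reflect f w : measurable_fun setT f ->
  measurable_fun setT (fun v => f (w - v)).
Proof.
move=> mf; apply: (measurableT_comp mf).
by apply: measurable_sub_rV; [exact: measurable_cst|exact: measurable_id].
Qed.

Lemma measurable_pairT u1 u2 w : measurable_fun setT u1 -> measurable_fun setT u2 ->
  measurable_fun setT (pairT u1 u2 w).
Proof.
move=> m1 m2; apply: measurable_funM => //; apply: measurable_funD.
  by apply: measurable_reflect; exact: measurable_cosT.
by apply: measurable_reflect; exact: measurable_sinT.
Qed.

Lemma inv_const_gt0 : 0 < cn :> R.
Proof. by rewrite invr_gt0 exprn_gt0// mulr_gt0// pi_gt0. Qed.

(** The square of a sum is at most twice the sum of the squares, then Bessel's inequality applies to
    [u1] and [u2] separately. Its factor [(2 * pi) ^+ n] cancels one of the two factors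
    [inv_const]. *)
Lemma pairT_L2 u1 u2 w : L1 u1 -> L1 u2 ->
  L1 (fun x => u1 x ^+ 2) -> L1 (fun x => u2 x ^+ 2) ->
  (\int[mu]_v (pairT u1 u2 w v ^+ 2)%:E <=
   (2 * cn * (\int[mu]_x u1 x ^+ 2 + \int[mu]_x u2 x ^+ 2))%:E)%E.
Proof.
move=> i1 i2 s1 s2; have [m1 m2] := (integrable_meas i1, integrable_meas i2).
have mC := measurable_cosT m1; have mS := measurable_sinT m2.
pose F x := cosT u1 x ^+ 2 + sinT u1 x ^+ 2 + (cosT u2 x ^+ 2 + sinT u2 x ^+ 2).
have q0 (a b : R) : 0 <= a ^+ 2 + b ^+ 2 by rewrite addr_ge0 ?sqr_ge0.
have mF1 : measurable_fun setT (fun x => cosT u1 x ^+ 2 + sinT u1 x ^+ 2).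
  by apply: measurable_funD; apply: measurable_funX => //; exact: measurable_sinT.
have mF2 : measurable_fun setT (fun x => cosT u2 x ^+ 2 + sinT u2 x ^+ 2).
  by apply: measurable_funD; apply: measurable_funX => //; exact: measurable_cosT.
have mF : measurable_fun setT F by exact: measurable_funD.
have c0 := inv_const_gt0.
apply: (@le_trans _ _ (\int[mu]_v (2 * cn ^+ 2 * F (w - v))%:E)%E).
  apply: ge0_le_integral => //.
  - by move=> x _; rewrite lee_fin sqr_ge0.
  - by apply/measurable_EFinP/measurable_funX; exact: measurable_pairT.
  - by apply/measurable_EFinP/measurable_funM => //; exact: measurable_reflect.
  - move=> v _; rewrite lee_fin /pairT /F exprMn [2 * _]mulrC -[leRHS]mulrA.
        rewrite ler_wpM2l ?sqr_ge0//.
    move: (cosT u1 _) (sinT u1 _) (cosT u2 _) (sinT u2 _) => a b d e.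
    have := sqr_ge0 (a - e); have := sqr_ge0 b; have := sqr_ge0 d; nra.
under eq_integral do rewrite EFinM.
have cc : 0 <= 2 * cn ^+ 2 :> R by rewrite mulr_ge0// sqr_ge0.
rewrite ge0_integralZl//; last 2 first.
- by apply/measurable_EFinP; exact: measurable_reflect.
- by move=> v _; rewrite lee_fin addr_ge0.
have -> : (\int[mu]_v (F (w - v))%:E = \int[mu]_v (F v)%:E)%E.
  have N1 : -1 * -1 = 1 :> R by rewrite mulrNN mulr1.
  have := @ge0_integral_affine_rV R n (-1) w (EFin \o F) N1.
  move=> <-; last 2 first.
  - exact/measurable_EFinP.
  - by move=> x; rewrite lee_fin addr_ge0.
  by apply: eq_integral => v _; rewrite /= scaleN1r addrC.
rewrite /F; under eq_integral do rewrite EFinD.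
rewrite ge0_integralD//; last 4 first.
- by move=> v _; rewrite lee_fin.
- exact/measurable_EFinP.
- by move=> v _; rewrite lee_fin.
- exact/measurable_EFinP.
have E : 2 * cn = 2 * cn ^+ 2 * (2 * pi) ^+ n :> R.
  by rewrite /inv_const expr2 !mulrA mulfVK// gt_eqF// exprn_gt0// mulr_gt0// pi_gt0.
rewrite E -mulrA [leRHS]EFinM lee_wpmul2l// mulrDr EFinD leeD//; exact: bessel.
Qed.

Lemma shiftSE u w xi : L1 u ->
  shiftS u w xi = \int[mu]_v (sin (dotp (w - v) xi) * u v).
Proof.
move=> ui; rewrite /shiftS /cosT /sinT -mulNr.
rewrite -!RintegralZl //; [|exact: integrable_sin|exact: integrable_cos].
rewrite -RintegralD //.
- by apply: eq_Rintegral => v _; rewrite dotpDl dotpNl sinB (dotpC xi); ring.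
- exact: integrable_scal (integrable_cos _ ui).
- exact: integrable_scal (integrable_sin _ ui).
Qed.

Lemma transform_dual (c : R -> R) u phi w : continuous c -> (forall t, `|c t| <= 1) ->
  L1 u -> L1 phi ->
  [/\ L1 (fun v => (\int[mu]_x (c (dotp (w - v) x) * u x)) * phi v),
      L1 (fun x => u x * (\int[mu]_v (c (dotp (w - v) x) * phi v))) &
      \int[mu]_v ((\int[mu]_x (c (dotp (w - v) x) * u x)) * phi v) =
      \int[mu]_x (u x * (\int[mu]_v (c (dotp (w - v) x) * phi v)))].
Proof.
move=> cc c1 ui pi_; have [mu_ mp] := (integrable_meas ui, integrable_meas pi_).
pose F (p : V * V) := c (dotp (w - p.1) p.2) * u p.2 * phi p.1.
have mw : measurable_fun setT (fun p : V * V => c (dotp (w - p.1) p.2)).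
  apply: (measurableT_comp (continuous_measurable_fun cc)).
  apply: measurable_dotp; last exact: measurable_snd.
  by apply: measurable_sub_rV; [exact: measurable_cst|exact: measurable_fst].
have mF : measurable_fun setT F.
  apply: measurable_funM; last by apply: (measurableT_comp mp); exact: measurable_fst.
  by apply: measurable_funM => //; apply: (measurableT_comp mu_); exact: measurable_snd.
have FB v x : `|F (v, x)| <= `|phi v| * `|u x|.
  by rewrite /F !normrM /= mulrC ler_wpM2l// -[leRHS]mul1r ler_wpM2r.
have Lu v : L1 (fun x => c (dotp (w - v) x) * u x).
  apply: (integrable_mulb (K := 1)) => //.
  exact: (measurableT_comp mw (measurable_pair1 v)).
have Lp x : L1 (fun v => c (dotp (w - v) x) * phi v).
  apply: (integrable_mulb (K := 1)) => //.
  exact: (measurableT_comp mw (measurable_pair2 x)).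
have E1 v : \int[mu]_x F (v, x) = (\int[mu]_x (c (dotp (w - v) x) * u x)) * phi v.
  rewrite mulrC -(RintegralZl (phi v) measurableT (Lu v)).
  by apply: eq_Rintegral => x _; rewrite mulrC.
have E2 x : \int[mu]_v F (v, x) = u x * (\int[mu]_v (c (dotp (w - v) x) * phi v)).
  rewrite -(RintegralZl (u x) measurableT (Lp x)).
  by apply: eq_Rintegral => v _; rewrite /F /=; ring.
have [_ I1 _ E] := Rfubini_dom mF pi_ ui FB.
pose F' (p : V * V) := F (p.2, p.1).
have mF' : measurable_fun setT F'.
  by apply: (measurableT_comp mF); apply/measurable_fun_pairP; split;
    [exact: measurable_snd|exact: measurable_fst].
have FB' x v : `|F' (x, v)| <= `|u x| * `|phi v| by rewrite mulrC; exact: FB.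
have [_ I2 _ _] := Rfubini_dom mF' ui pi_ FB'.
split.
- by move: I1; apply: eq_integrable => // v _ /=; rewrite E1.
- by move: I2; apply: eq_integrable => // v _ /=; rewrite /F' E2.
- by under eq_Rintegral do rewrite -E1; rewrite E; apply: eq_Rintegral => x _; rewrite E2.
Qed.

(** By Fubini the transform passes to [phi]. The right-hand side has the shape of [noise_trace],
    which makes the two comparable in the limit. *)
Lemma pairT_dual u1 u2 w phi : L1 u1 -> L1 u2 -> L1 phi ->
  \int[mu]_v (pairT u1 u2 w v * phi v) =
  cn * \int[mu]_x (u1 x * shiftT phi w x + u2 x * shiftS phi w x).
Proof.
move=> i1 i2 ip.
have [C1 C2 C3] := transform_dual w (@continuous_cos R) (@normr_cos_le1 R) i1 ip.
have [S1 S2 S3] := transform_dual w (@continuous_sin R) (@normr_sin_le1 R) i2 ip.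
transitivity (cn * \int[mu]_v (cosT u1 (w - v) * phi v + sinT u2 (w - v) * phi v)).
  rewrite -(RintegralZl cn measurableT (integrable_add C1 S1)).
  by apply: eq_Rintegral => v _; rewrite /pairT -mulrA mulrDl.
congr (_ * _); rewrite (RintegralD measurableT C1 S1) C3 S3.
rewrite -(RintegralD measurableT C2 S2).
by apply: eq_Rintegral => x _; rewrite shiftTE// shiftSE.
Qed.

End pair_transform.

(** * Truncation in frequency *)

Section truncation.
Context {R : realType} {n : nat}.
Local Notation V := 'rV[R]_n.
Local Notation mu := (@lebesgue_rV R n).
Local Notation L1 f := ((@lebesgue_rV R n).-integrable setT (EFin \o f)).
Implicit Types (f g u phi : V -> R) (x y v w xi z : V).

Definition cutoff (m : nat) x : R := if dotp x x <= m%:R then 1 else 0.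

Lemma cutoff_itv m x : 0 <= cutoff m x <= 1.
Proof. by rewrite /cutoff; case: ifP; rewrite ?lexx ?ler01. Qed.

Lemma measurable_cutoff m : measurable_fun setT (cutoff m).
Proof.
apply: measurable_fun_ifT => //; apply: measurable_fun_ler => //.
by apply: measurable_dotp; exact: measurable_id.
Qed.

Lemma integrable_cutoff m : L1 (cutoff m).
Proof.
apply: (@integrable_japan_dom _ _ _ ((1 + m%:R) ^+ n) (measurable_cutoff m)) => x.
rewrite /cutoff; case: ifP => xm; last by rewrite normr0 mulr0 exprn_ge0.
by rewrite normr1 mulr1 lerXn2r ?nnegrE ?addr_ge0 ?dotp_ge0// lerD2l.
Qed.

Lemma cvg_cutoff x : (fun m => cutoff m x) @ \oo --> (1 : R).
Proof.
apply: cvg_near_cst; near=> m; rewrite /cutoff ifT//.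
near: m; exact: nbhs_infty_ger.
Unshelve. all: by end_near. Qed.

(** The clause [k <= N k] ensures that the cutoffs tend to 1 at every point; small tails alone would
    allow bounded radii. *)
Lemma cutoff_tail f : L1 f -> (forall x, 0 <= f x) ->
  exists N : nat -> nat, forall k, (k <= N k)%N /\
    \int[mu]_x ((1 - cutoff (N k) x) * f x) <= 8 ^- k.
Proof.
move=> fi f0; have mf := integrable_meas fi.
have m1 m : measurable_fun setT (fun x => (1 - cutoff m x) * f x).
  by apply: measurable_funM => //; apply: measurable_funB => //; exact: measurable_cutoff.
have c1 : {ae mu, forall x, (fun m => (1 - cutoff m x) * f x) @ \oo --> (0 : R)}.
  apply: aeW => x; rewrite -[X in _ --> X](_ : (1 - 1) * f x = _); last first.
    by rewrite subrr mul0r.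
  by apply: cvgM; [apply: cvgB; [exact: cvg_cst|exact: cvg_cutoff]|exact: cvg_cst].
have c2 : {ae mu, forall x m, `|(1 - cutoff m x) * f x| <= f x}.
  apply: aeW => x m; have /andP[k0 k1] := cutoff_itv m x.
  by rewrite normrM (ger0_norm (f0 x)) ler_piMl// ger0_norm ?subr_ge0// gerBl.
have [_ cvg0] := Rdominated m1 (measurable_cst (0 : R)) c1 fi c2.
have {cvg0}cvg0 : (fun m => \int[mu]_x ((1 - cutoff m x) * f x)) @ \oo --> (0 : R).
  by rewrite [X in _ --> X](_ : _ = 0) in cvg0; last by rewrite /Rintegral integral0.
suff H k : exists m, (k <= m)%N /\ \int[mu]_x ((1 - cutoff m x) * f x) <= 8 ^- k.
  by have [N HN] := choice H; exists N.
have e0 : 0 < (8 ^- k : R) by rewrite invr_gt0 exprn_gt0.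
have /cvgr_distC_le/(_ _ e0)[m _ Hm] := cvg0.
exists (maxn m k); split; first exact: leq_maxr.
have := Hm (maxn m k) (leq_maxl _ _); rewrite subr0; apply: le_trans; exact: ler_norm.
Qed.

End truncation.

Section truncated_multiplier.
Context {R : realType} {n : nat}.
Local Notation V := 'rV[R]_n.
Local Notation mu := (@lebesgue_rV R n).
Local Notation L1 f := ((@lebesgue_rV R n).-integrable setT (EFin \o f)).
Variables (W h : V -> R).
Hypothesis mh : measurable_fun setT h.
Hypothesis LW : L1 W.
Hypothesis hW : forall x, h x ^+ 2 <= W x * japan x.
Implicit Types (x : V) (r : R).

(** Used with [h] the real and then the imaginary part of the spectral function, and the same [W]
    for both, so that one choice of radii serves both. *)
Definition trunc m r x : R := cutoff m x * (wave_mult r x * h x).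

Let W0 x : 0 <= W x.
Proof.
by have := le_trans (sqr_ge0 (h x)) (hW x); rewrite pmulr_lge0// japan_gt0.
Qed.

Lemma measurable_trunc m r : measurable_fun setT (trunc m r).
Proof.
apply: measurable_funM; first exact: measurable_cutoff.
by apply: measurable_funM => //; exact: measurable_wave_mult.
Qed.

Section bounds.
Variables (K r : R).
Hypothesis wK : forall x, wave_mult r x ^+ 2 * japan x <= K.

Let K0 : 0 <= K.
Proof.
by apply: le_trans (wK 0); rewrite mulr_ge0 ?sqr_ge0// ltW// japan_gt0.
Qed.

Lemma sqr_wave_mult x : (wave_mult r x * h x) ^+ 2 <= K * W x.
Proof.
rewrite exprMn.
apply: (@le_trans _ _ (wave_mult r x ^+ 2 * (W x * japan x))).
  by rewrite ler_wpM2l ?sqr_ge0.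
by rewrite mulrCA mulrC ler_wpM2r.
Qed.

Lemma sqr_trunc m x : trunc m r x ^+ 2 <= K * W x.
Proof.
apply: le_trans (sqr_wave_mult x); rewrite exprMn ler_piMl ?sqr_ge0//.
by have /andP[c0 c1] := cutoff_itv m x; rewrite expr_le1.
Qed.

Lemma integrable_sqr_trunc m : L1 (fun x => trunc m r x ^+ 2).
Proof.
apply: (integrable_le (integrable_scal K LW)).
  by apply: measurable_funX; exact: measurable_trunc.
move=> x; rewrite !ger0_norm ?sqr_ge0 ?mulr_ge0//; exact: sqr_trunc.
Qed.

(** With [c] in [[0, 1]], [c * |a| <= c + a^2]: the cutoff is integrable, and so is the bound
    [K * W] on the square. *)
Lemma integrable_trunc m : L1 (trunc m r).
Proof.
apply: (integrable_le (integrable_add (integrable_cutoff m) (integrable_scal K LW))).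
  exact: measurable_trunc.
move=> x; have /andP[c0 c1] := cutoff_itv m x.
have kw : 0 <= K * W x by rewrite mulr_ge0.
rewrite [leRHS]ger0_norm ?addr_ge0// /trunc normrM (ger0_norm c0).
have := sqr_wave_mult x; rewrite -[X in X <= _]real_normK ?num_real//.
move: kw c0 c1 (normr_ge0 (wave_mult r x * h x)).
move: (K * W x) (cutoff m x) `|_| => k c a k0 c0 c1 a0 ak.
by have := sqr_ge0 (1 - a); nra.
Qed.

Lemma trunc_diff m m' e : \int[mu]_x ((1 - cutoff m x) * W x) <= e ->
  \int[mu]_x ((1 - cutoff m' x) * W x) <= e ->
  \int[mu]_x ((trunc m' r x - trunc m r x) ^+ 2) <= 2 * K * e.
Proof.
move=> me me'.
have Lc k : L1 (fun x => (1 - cutoff k x) * W x).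
  apply: (integrable_mulb (K := 1)) => //.
    by apply: measurable_funB => //; exact: measurable_cutoff.
  move=> x; have /andP[c0 c1] := cutoff_itv k x.
  by rewrite ger0_norm ?subr_ge0// gerBl.
have LD := integrable_add (Lc m) (Lc m').
apply: (@le_trans _ _ (K * \int[mu]_x ((1 - cutoff m x) * W x + (1 - cutoff m' x) * W x))); last first.
  rewrite (RintegralD measurableT (Lc m) (Lc m')) [2 * K]mulrC -mulrA ler_wpM2l//.
  by rewrite mulrDl mul1r lerD.
(* For [a], [b] in [[0, 1]], [(b - a)^2 <= (1 - a) + (1 - b)]. This is symmetric, so the two radii
   may come in either order. *)
have P x : (trunc m' r x - trunc m r x) ^+ 2 <=
    K * ((1 - cutoff m x) * W x + (1 - cutoff m' x) * W x).
  rewrite /trunc -mulrBl exprMn.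
  apply: (@le_trans _ _ ((cutoff m' x - cutoff m x) ^+ 2 * (K * W x))).
    by rewrite ler_wpM2l ?sqr_ge0// sqr_wave_mult.
  rewrite -mulrDl mulrCA ler_wpM2l// ler_wpM2r//.
  have /andP[c0 c1] := cutoff_itv m x; have /andP[d0 d1] := cutoff_itv m' x.
  move: (cutoff m x) (cutoff m' x) c0 c1 d0 d1 => a b a0 a1 b0 b1.
  by have := mulr_ge0 a0 b0; nra.
have LE : L1 (fun x => (trunc m' r x - trunc m r x) ^+ 2).
  apply: (integrable_le (integrable_scal K LD)).
    by apply: measurable_funX; apply: measurable_funB; exact: measurable_trunc.
  move=> x; rewrite (ger0_norm (sqr_ge0 _)) ger0_norm; first exact: P.
  exact: le_trans (sqr_ge0 _) (P x).
rewrite -(RintegralZl K measurableT LD); apply: le_Rintegral => //.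
exact: integrable_scal.
Qed.

End bounds.
End truncated_multiplier.

(** * The jointly measurable density *)

Section wave_density.
Context {R : realType} {n : nat}.
Local Notation V := 'rV[R]_n.
Local Notation mu := (@lebesgue_rV R n).
Local Notation cn := (@inv_const R n).
Local Notation L1 f := ((@lebesgue_rV R n).-integrable setT (EFin \o f)).
Implicit Types (x v w : V) (r : R) (phi : V -> R).

Lemma integrable_sqr_tame phi : tame rapid phi -> L1 (fun x => phi x ^+ 2).
Proof.
move=> tp; have [M _ HM] := tame_bounded tp.
apply: (integrable_mulb (K := M) (L1_tame tp)) => //.
exact: integrable_meas (L1_tame tp).
Qed.

Lemma pairTB u1 u2 u1' u2' w v : L1 u1 -> L1 u2 -> L1 u1' -> L1 u2' ->
  pairT u1' u2' w v - pairT u1 u2 w v =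
  pairT (fun x => u1' x - u1 x) (fun x => u2' x - u2 x) w v.
Proof.
move=> i1 i2 j1 j2; rewrite /pairT -mulrBr; congr (_ * _).
have E f : (fun x : V => f x) = f by [].
have D f g : (fun x : V => f x - g x) = (fun x => f x + -1 * g x) :> (V -> R).
  by apply/funext => x; rewrite mulN1r.
rewrite !D cosTD ?sinTD ?cosTZ ?sinTZ//; [ring| |]; exact: integrable_scal.
Qed.

Lemma measurable_trunc_pair h m : measurable_fun setT h ->
  measurable_fun setT (fun q : (measurableTypeR R * V) * V => trunc h m q.1.1 q.2).
Proof.
move=> mh; have m2 := @measurable_snd _ _ (measurableTypeR R * V)%type V.
have m11 : measurable_fun setT (fun q : (measurableTypeR R * V) * V => q.1.1).
  by apply: (measurableT_comp measurable_fst); exact: measurable_fst.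
apply: measurable_funM; first exact: (measurableT_comp (measurable_cutoff m) m2).
apply: measurable_funM; last exact: (measurableT_comp mh m2).
apply: measurable_funM => //.
apply: (measurableT_comp (continuous_measurable_fun (@continuous_sincd R 0))).
by apply: measurable_funM; [exact: measurable_funX|exact: measurable_dotp].
Qed.

Lemma measurable_pairT_trunc h1 h2 m w : measurable_fun setT h1 -> measurable_fun setT h2 ->
  measurable_fun setT (fun p : measurableTypeR R * V =>
    pairT (trunc h1 m p.1) (trunc h2 m p.1) w p.2).
Proof.
move=> m1 m2; apply: measurable_funM => //.
have md : measurable_fun setT
    (fun q : (measurableTypeR R * V) * V => dotp (w - q.1.2) q.2).
  apply: measurable_dotp; last exact: measurable_snd.
  apply: measurable_sub_rV; first exact: measurable_cst.
  by apply: (measurableT_comp measurable_snd); exact: measurable_fst.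
apply: measurable_funD.
  apply: (@measurable_Rint _ _ _ _ R mu (fun q : (measurableTypeR R * V) * V =>
    cos (dotp (w - q.1.2) q.2) * trunc h1 m q.1.1 q.2)).
  by apply: measurable_funM; [exact: measurable_cosf|exact: measurable_trunc_pair].
apply: (@measurable_Rint _ _ _ _ R mu (fun q : (measurableTypeR R * V) * V =>
  sin (dotp (w - q.1.2) q.2) * trunc h2 m q.1.1 q.2)).
by apply: measurable_funM; [exact: measurable_sinf|exact: measurable_trunc_pair].
Qed.

Section weak_limit.
Variables (h : V -> R[i]) (w : V) (N : nat -> nat).
Let h1 x := complex.Re (h x).
Let h2 x := complex.Im (h x).
Let W x := (h1 x ^+ 2 + h2 x ^+ 2) / japan x.
Hypothesis m1 : measurable_fun setT h1.
Hypothesis m2 : measurable_fun setT h2.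
Hypothesis LW : L1 W.
Hypothesis HN : forall k, (k <= N k)%N /\
  \int[mu]_x ((1 - cutoff (N k) x) * W x) <= 8 ^- k.

Let b1 x : h1 x ^+ 2 <= W x * japan x.
Proof. by rewrite divfK ?gt_eqF ?japan_gt0// lerDl sqr_ge0. Qed.

Let b2 x : h2 x ^+ 2 <= W x * japan x.
Proof. by rewrite divfK ?gt_eqF ?japan_gt0// lerDr sqr_ge0. Qed.

Definition approximant (k : nat) (p : measurableTypeR R * V) : R :=
  pairT (trunc h1 (N k) p.1) (trunc h2 (N k) p.1) w p.2.

(** The limsup is pointwise, so its slice at a fixed time is the limsup of the slices: measurability
    is joint, while convergence is studied one time at a time. *)
Definition wave_density : measurableTypeR R * V -> R := seq_limsup approximant.

Lemma measurable_wave_density : measurable_fun setT wave_density.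
Proof.
by apply: measurable_seq_limsup => k; exact: measurable_pairT_trunc.
Qed.

Section fixed_time.
Variables (K r : R).
Hypothesis wK : forall x, wave_mult r x ^+ 2 * japan x <= K.

Let K0 : 0 <= K.
Proof.
by apply: le_trans (wK 0); rewrite mulr_ge0 ?sqr_ge0// ltW// japan_gt0.
Qed.

Let t1 m : L1 (trunc h1 m r). Proof. exact: (integrable_trunc m1 LW b1 wK). Qed.
Let t2 m : L1 (trunc h2 m r). Proof. exact: (integrable_trunc m2 LW b2 wK). Qed.
Let s1 m : L1 (fun x => trunc h1 m r x ^+ 2).
Proof. exact: (integrable_sqr_trunc m1 LW b1 wK). Qed.
Let s2 m : L1 (fun x => trunc h2 m r x ^+ 2).
Proof. exact: (integrable_sqr_trunc m2 LW b2 wK). Qed.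

Let mA k : measurable_fun setT (fun v => approximant k (r, v)).
Proof.
exact: (measurable_pairT w (measurable_trunc m1 (N k) r) (measurable_trunc m2 (N k) r)).
Qed.

Let A0 : L1 (fun v => approximant 0 (r, v) ^+ 2).
Proof.
apply/integrableP; split; first by apply/measurable_EFinP; exact: measurable_funX.
apply: (le_lt_trans _ (ltry (2 * cn * (\int[mu]_x trunc h1 (N 0) r x ^+ 2 +
  \int[mu]_x trunc h2 (N 0) r x ^+ 2)))).
apply: (le_trans _ (pairT_L2 w (t1 _) (t2 _) (s1 _) (s2 _))).
rewrite le_eqVlt; apply/orP; left; apply/eqP; apply: eq_integral => v _.
by rewrite /= ger0_norm// sqr_ge0.
Qed.

Let AK k : (\int[mu]_v ((approximant k.+1 (r, v) - approximant k (r, v)) ^+ 2)%:E <=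
  ((8 * cn * K) / 8 ^+ k)%:E)%E.
Proof.
have tb k' : (k <= k')%N -> \int[mu]_x ((1 - cutoff (N k') x) * W x) <= 8 ^- k.
  move=> kk'; apply: (le_trans (proj2 (HN k'))).
  by rewrite lef_pV2 ?posrE ?exprn_gt0// ler_eXn2l// ltr1n.
have d0 := tb k (leqnn k); have d1 := tb k.+1 (leqnSn k).
have D1 := trunc_diff m1 LW b1 wK d0 d1; have D2 := trunc_diff m2 LW b2 wK d0 d1.
have dif f m m' : L1 (trunc f m r) -> L1 (trunc f m' r) ->
    L1 (fun x => trunc f m r x ^+ 2) -> L1 (fun x => trunc f m' r x ^+ 2) ->
    L1 (fun x => trunc f m' r x - trunc f m r x) /\
    L1 (fun x => (trunc f m' r x - trunc f m r x) ^+ 2).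
  move=> i j si sj; split.
    have := integrable_add j (integrable_scal (-1) i).
    by apply: eq_integrable => // x _ /=; rewrite mulN1r.
  apply: (integrable_le (integrable_add (integrable_scal 2 si) (integrable_scal 2 sj))).
    apply: measurable_funX.
    exact: (measurable_funB (integrable_meas j) (integrable_meas i)).
  move=> x; rewrite (ger0_norm (sqr_ge0 _)) [leRHS]ger0_norm; last first.
    by apply: addr_ge0; apply: mulr_ge0 => //; exact: sqr_ge0.
  by move: (trunc f m r x) (trunc f m' r x) => a b; have := sqr_ge0 (a + b); nra.
have [i1 j1] := dif h1 (N k) (N k.+1) (t1 _) (t1 _) (s1 _) (s1 _).
have [i2 j2] := dif h2 (N k) (N k.+1) (t2 _) (t2 _) (s2 _) (s2 _).
under eq_integral => v _ do rewrite /approximant /= pairTB//.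
apply: (le_trans (pairT_L2 w i1 i2 j1 j2)); rewrite lee_fin.
(* Each of the two components contributes [2 * K * 8^-k] by [trunc_diff], whence the constant
   [8 * cn * K]. *)
apply: (@le_trans _ _ (2 * cn * (2 * K * 8 ^- k + 2 * K * 8 ^- k))).
  by rewrite ler_wpM2l ?lerD// mulr_ge0// ltW// inv_const_gt0.
by rewrite le_eqVlt; apply/orP; left; apply/eqP; ring.
Qed.

Lemma wave_density_L2 : L1 (fun v => wave_density (r, v) ^+ 2).
Proof.
have K8 : 0 <= 8 * cn * K by rewrite !mulr_ge0// ltW// inv_const_gt0.
exact: (seq_limsup_L2 mA A0 K8 AK).
Qed.

(** The pairings of the approximants with [phi] converge to the left-hand side by the L^2 argument,
    and to the right-hand side by [pairT_dual] and dominated convergence as the cutoffs tend to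
    1. *)
Lemma wave_density_weak phi : tame rapid phi ->
  \int[mu]_v (wave_density (r, v) * phi v) = noise_trace h r phi w.
Proof.
move=> tp; have K8 : 0 <= 8 * cn * K by rewrite !mulr_ge0// ltW// inv_const_gt0.
have Lp := L1_tame tp; have [tT tS] := tame_shift w tp.
have c1 := seq_limsup_weak mA A0 K8 AK (integrable_meas Lp) (integrable_sqr_tame tp).
pose F x := wave_mult r x * (h1 x * shiftT phi w x + h2 x * shiftS phi w x).
have mF : measurable_fun setT F.
  apply: measurable_funM; first exact: measurable_wave_mult.
  by apply: measurable_funD; apply: measurable_funM => //; apply: integrable_meas; exact: L1_tame.
pose G x := 2 * K * W x + (shiftT phi w x ^+ 2 + shiftS phi w x ^+ 2).
have LG : L1 G.
  apply: integrable_add; first exact: integrable_scal.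
  by apply: integrable_add; exact: integrable_sqr_tame.
have FG x : `|F x| <= G x.
  have := sqr_wave_mult b1 wK x; have := sqr_wave_mult b2 wK x.
  rewrite (_ : F x = wave_mult r x * h1 x * shiftT phi w x +
    wave_mult r x * h2 x * shiftS phi w x); last by rewrite /F; ring.
  rewrite /G -[2 * K * W x]mulrA; move: (wave_mult r x * h1 x) (wave_mult r x * h2 x) (K * W x) => a b k.
  move: (shiftT phi w x) (shiftS phi w x) => p q Hb Ha.
  have := sqr_ge0 a; have := sqr_ge0 p; have := sqr_ge0 q.
  rewrite ler_norml => q0 p0 a0; apply/andP; split.
    by have := sqr_ge0 (a + p); have := sqr_ge0 (b + q); nra.
  by have := sqr_ge0 (a - p); have := sqr_ge0 (b - q); nra.
have mFk k : measurable_fun setT (fun x => cutoff (N k) x * F x).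
  by apply: measurable_funM => //; exact: measurable_cutoff.
have cF : {ae mu, forall x, (fun k => cutoff (N k) x * F x) @ \oo --> F x}.
  apply: aeW => x; rewrite -[X in _ --> X]mul1r; apply: cvgM; last exact: cvg_cst.
  apply: cvg_near_cst; near=> k; rewrite /cutoff ifT//.
  apply: (@le_trans _ _ k%:R); last by rewrite ler_nat; exact: (proj1 (HN k)).
  near: k; exact: nbhs_infty_ger.
have bF : {ae mu, forall x k, `|cutoff (N k) x * F x| <= G x}.
  apply: aeW => x k; apply: le_trans (FG x); have /andP[k0 k1] := cutoff_itv (N k) x.
  by rewrite normrM ger0_norm// ler_piMl.
have [LF cF'] := Rdominated mFk mF cF LG bF.
have c2 : (fun k => \int[mu]_v (approximant k (r, v) * phi v)) @ \oo -->
    noise_trace h r phi w.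
  rewrite /noise_trace; under eq_Rintegral do rewrite -mulrA.
  rewrite (RintegralZl cn measurableT LF).
  rewrite (_ : (fun k => _) = (fun k => cn * \int[mu]_x (cutoff (N k) x * F x))).
    by apply: cvgM => //; exact: cvg_cst.
  apply/funext => k; rewrite -[LHS]/(\int[mu]_v (pairT (trunc h1 (N k) r) (trunc h2 (N k) r) w v * phi v)).
  rewrite pairT_dual//; congr (_ * _); apply: eq_Rintegral => x _.
  by rewrite /trunc /F; ring.
exact: (cvg_unique _ c1 c2).
Unshelve. all: by end_near. Qed.

End fixed_time.
End weak_limit.
End wave_density.

(** * Measurability of the convolution *)

Section kernels.
Context {R : realType} {n : nat}.
Local Notation V := 'rV[R]_n.
Local Notation mu := (@lebesgue_rV R n).
Local Notation RR := (measurableTypeR R).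

(** Writing [1/x] as [x * (x^2)^-1] leaves a power with nonnegative base; both sides are 0 at
    [x = 0]. *)
Lemma measurable_invr d (T : measurableType d) (f : T -> R) :
  measurable_fun setT f -> measurable_fun setT (fun x => (f x)^-1).
Proof.
move=> mf; rewrite (_ : (fun x => _) = fun x => f x * (f x ^+ 2) `^ (-1)); last first.
  apply/funext => x; rewrite powR_inv1 ?sqr_ge0//.
  have [->|f0] := eqVneq (f x) 0; first by rewrite invr0 mul0r.
  by rewrite expr2 invfM mulrA mulfV// mul1r.
apply: measurable_funM => //.
by apply: (measurableT_comp (measurable_powR _)); exact: measurable_funX.
Qed.

Lemma measurable_kernel_conv (G : R -> V -> R) (kappa : V -> \bar R) (t : R) (x : V) :
  measurable_fun setT (fun p : RR * V => G p.1 p.2) -> (forall r y, 0 <= G r y) ->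
  measurable_fun setT kappa -> (forall y, 0 <= kappa y)%E ->
  measurable_fun setT (fun p : RR * V => kernel_conv (G (t - p.1)) x kappa p.2).
Proof.
move=> mG G0 mk k0.
pose F (q : (RR * V) * V) := ((G (t - q.1.1) (x - q.2)%R)%:E * kappa (q.1.2 - q.2)%R)%E.
apply: (measurable_fun_fubini_tonelli_F (m2 := mu) F); last first.
  by move=> q; rewrite mule_ge0// lee_fin.
have m11 : measurable_fun setT (fun q : (RR * V) * V => q.1.1).
  by apply: (measurableT_comp measurable_fst); exact: measurable_fst.
have m12 : measurable_fun setT (fun q : (RR * V) * V => q.1.2).
  by apply: (measurableT_comp measurable_snd); exact: measurable_fst.
have m2 := @measurable_snd _ _ (RR * V)%type V.
apply: emeasurable_funM; last first.
  by apply: (measurableT_comp mk); exact: measurable_sub_rV.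
apply/measurable_EFinP.
have mp : measurable_fun setT (fun q : (RR * V) * V => (t - q.1.1 : RR, x - q.2 : V)).
  apply/measurable_fun_pairP; split; first exact: measurable_funB.
  exact: measurable_sub_rV.
exact: (measurableT_comp mG mp).
Qed.

Lemma measurable_heat_kernel : measurable_fun setT (fun p : RR * V => heat_kernel p.1 p.2).
Proof.
have m1 := @measurable_fst _ _ RR V; have m2 := @measurable_snd _ _ RR V.
apply: measurable_funM.
  by apply: (measurableT_comp (measurable_powR _)); exact: measurable_funM.
apply: (measurableT_comp (@measurable_expR R)); apply: measurable_funN.
apply: measurable_funM; last by apply: measurable_invr; exact: measurable_funM.
by apply: measurable_funX; exact: (measurableT_comp measurable_enorm m2).
Qed.

Lemma heat_kernel_ge0 r (y : V) : 0 <= heat_kernel r y.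
Proof. by rewrite mulr_ge0 ?powR_ge0 ?expR_ge0. Qed.

Lemma measurable_wave_kernel : measurable_fun setT (fun p : RR * V => wave_kernel p.1 p.2).
Proof.
have m1 := @measurable_fst _ _ RR V; have m2 := @measurable_snd _ _ RR V.
have me : measurable_fun setT (fun p : RR * V => enorm p.2).
  exact: (measurableT_comp measurable_enorm m2).
apply: measurable_fun_ifT => //; first exact: measurable_fun_ltr.
case: (n == 1)%N => //; apply: measurable_funM => //.
apply: (measurableT_comp (measurable_powR _)).
by apply: measurable_funB; exact: measurable_funX.
Qed.

Lemma wave_kernel_ge0 r (y : V) : 0 <= wave_kernel r y.
Proof.
rewrite /wave_kernel; case: ifP => // _; case: ifP => _; first by rewrite invr_ge0.
by rewrite mulr_ge0 ?powR_ge0// invr_ge0 mulr_ge0// pi_ge0.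
Qed.

Lemma Lfun2 (f : V -> R) : measurable_fun setT f ->
  mu.-integrable setT (EFin \o (fun x => f x ^+ 2)) -> f \in Lfun mu 2%:E.
Proof.
move=> mf /integrableP[_ f2].
rewrite inE; apply/andP; split; first by rewrite inE.
rewrite inE /= /finite_norm unlock poweR_lty//.
apply: le_lt_trans f2; rewrite le_eqVlt; apply/orP; left; apply/eqP.
apply: eq_integral => x _ /=.
by rewrite powR_mulrn// real_normK ?num_real// ger0_norm ?sqr_ge0.
Qed.

End kernels.

Theorem lemma3p13 (R : realType) (d : nat) (hd : (0 < d)%N)
    (kappa : 'rV[R]_d -> \bar R) (h : 'rV[R]_d -> R[i])
    (hkappa : noise_kernel kappa h) :
  (* a) *)
  (forall G : R -> 'rV[R]_d -> R,
    G = heat_kernel \/ ((d <= 2)%N /\ G = wave_kernel) ->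
    forall (t : R) (x : 'rV[R]_d), 0 <= t ->
      measurable_fun (`[0, t[ `*` [set: 'rV[R]_d])
        (fun p : R * 'rV[R]_d => kernel_conv (G (t - p.1)) x kappa p.2))
  /\
  (* b) *)
  ((3 <= d)%N -> dalang h ->
    forall G : R -> @distribution_type R d,
      (forall t : R, 0 < t -> wave_fundamental_solution t (G t)) ->
    forall (t : R) (x : 'rV[R]_d), 0 <= t ->
      exists2 g : R * 'rV[R]_d -> R,
        measurable_fun (`[0, t[ `*` [set: 'rV[R]_d]) g &
        {ae lebesgue_measure, forall s : R, s \in `[0, t[ ->
          (fun y => g (s, y)) \in Lfun lebesgue_rV 2%:E /\
          eq_tempered (dist_of_rfun (fun y => g (s, y)))
            (conv_dist (reflect_translate x (G (t - s)))
                       (dist_of_efun kappa))}).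
Proof.
split=> [G hG t x _|_ hD G hG t x _].
  apply: measurable_funTS.
  have [mk _] := nk_temperate hkappa.
  apply: measurable_kernel_conv => //; last exact: nk_ge0 hkappa.
    by case: hG => [->|[_ ->]]; [exact: measurable_heat_kernel|exact: measurable_wave_kernel].
  by case: hG => [->|[_ ->]]; [exact: heat_kernel_ge0|exact: wave_kernel_ge0].
have hT := nk_fourier_temperate hkappa; have [m1 m2 _] := hT.
have LW := dalang_integrable hT hD.
have W0 (xi : 'rV[R]_d) : 0 <= (complex.Re (h xi) ^+ 2 + complex.Im (h xi) ^+ 2) / japan xi.
  by apply: divr_ge0; [apply: addr_ge0; exact: sqr_ge0|exact: ltW (japan_gt0 _)].
have [N HN] := cutoff_tail LW W0.
(* The density is indexed by the elapsed time [t - s]. *)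
pose g (p : R * 'rV[R]_d) := wave_density h x N (t - p.1, p.2).
have mg : measurable_fun setT g.
  have mp : measurable_fun setT (fun p : measurableTypeR R * 'rV[R]_d =>
      (t - p.1 : measurableTypeR R, p.2)).
    apply/measurable_fun_pairP; split; last exact: measurable_snd.
    exact: (measurable_funB (measurable_cst t) measurable_fst).
  exact: (measurableT_comp (measurable_wave_density x N m1 m2) mp).
exists g; first exact: measurable_funTS.
(* The conclusion is in fact proved for every [s] in [[0, t)], where [t - s > 0]. *)
apply: aeW => s; rewrite in_itv /= => /andP[s0 st].
have r0 : 0 < t - s by rewrite subr_gt0.
have rt : 0 < t - s <= t by rewrite r0 gerBl.
have [K _ HK] := @wave_mult_bound R d t.
have wK xi := HK (t - s) xi rt.
split.
  apply: Lfun2; first exact: (measurableT_comp mg (measurable_pair1 s)).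
  exact: (wave_density_L2 x m1 m2 LW HN wK).
move=> phi sphi; rewrite (conv_wave x hd hkappa (hG _ r0) sphi).
have [tp tq] := proj1 (schwartzP _) sphi.
rewrite -(wave_density_weak x m1 m2 LW HN wK tp) -(wave_density_weak x m1 m2 LW HN wK tq).
rewrite /dist_of_rfun /dist_of_cfun /cintegral /=.
by congr complex.Complex; apply: eq_Rintegral => y _; case: (phi y) => a b /=;
  rewrite mul0r ?subr0 ?addr0.
Qed.
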